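(* For every constant $\epsilon>0$ there is a polynomial-time algorithm that, given an instance $(V,d,k,\rho)$ of the $k$ median forest problem, outputs $S\subseteq V$ with $|S|=k$ such that $$\sum_{u\in V} d(u,S)+\rho\cdot d(\mathrm{MST}(V/S))\le(3+\epsilon)\cdot\min_{S'\subseteq V,\,|S'|=k}\Big(\sum_{u\in V} d(u,S')+\rho\cdot d(\mathrm{MST}(V/S'))\Big).$$
   Context: An instance of the $k$ median forest problem consists of a finite metric space $(V,d)$, an integer $1\le k\le |V|$, and a parameter $\rho\ge 0$. The goal is to find $S\subseteq V$ with $|S|=k$ minimizing $\sum_{u\in V} d(u,S)+\rho\cdot d(\mathrm{MST}(V/S))$. Here $d(u,S)=\min_{w\in S}d(u,w)$. $\mathrm{MST}(V/S)$ denotes a minimum spanning tree of the graph obtained from the complete graph on $V$, with edge lengths $d$, by contracting all vertices of $S$ into a single vertex. $d(\mathrm{MST}(V/S))$ is its total length, i.e. the minimum total length of an edge set that connects every vertex of $V$ to some vertex of $S$. *)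

(* Defs.v *)
From mathcomp Require Import all_boot all_order all_algebra.
From mathcomp Require Import reals.
Set Implicit Arguments.
Unset Strict Implicit.
Unset Printing Implicit Defensive.
Import Order.TTheory GRing.Theory Num.Theory.
Local Open Scope ring_scope.

Definition is_metric (n : nat) (d : 'I_n -> 'I_n -> rat) : Prop :=
  [/\ (forall u v, 0 <= d u v),
      (forall u v, d u v = 0 <-> u = v),
      (forall u v, d u v = d v u) &
      (forall u v w, d u w <= d u v + d v w)].

(* an upper bound on all distances (used only as the neutral value of the
   finite minima below; it never changes a minimum over a nonempty range) *)
Definition dmax (n : nat) (d : 'I_n -> 'I_n -> rat) : rat :=
  \big[Num.max/0]_(v : 'I_n) \big[Num.max/0]_(w : 'I_n) d v w.

Definition dist_to (n : nat) (d : 'I_n -> 'I_n -> rat) (S : {set 'I_n})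
  (u : 'I_n) : rat :=
  \big[Num.min/dmax d]_(w in S) d u w.

Definition eweight (n : nat) (d : 'I_n -> 'I_n -> rat)
  (F : {set 'I_n * 'I_n}) : rat :=
  \sum_(e in F) d e.1 e.2.

Definition erel (n : nat) (F : {set 'I_n * 'I_n}) : rel 'I_n :=
  fun x y => ((x, y) \in F) || ((y, x) \in F).

Definition connects_to (n : nat) (F : {set 'I_n * 'I_n}) (S : {set 'I_n}) :
  bool := [forall u : 'I_n, [exists s in S, connect (erel F) u s]].

(* d(MST(V/S)) = minimum total length of an edge set connecting every
   vertex of V to some vertex of S.  The neutral value eweight d setT is the
   weight of the full edge set, which is feasible when S is nonempty and is
   an upper bound for every weight, so this is the true minimum. *)
Definition mst_contracted (n : nat) (d : 'I_n -> 'I_n -> rat)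
  (S : {set 'I_n}) : rat :=
  \big[Num.min/eweight d setT]_(F : {set 'I_n * 'I_n} | connects_to F S)
     eweight d F.

Definition kmf_cost (n : nat) (d : 'I_n -> 'I_n -> rat) (rho : rat)
  (S : {set 'I_n}) : rat :=
  \sum_(u : 'I_n) dist_to d S u + rho * mst_contracted d S.

(* Model of computation: unit-cost integer RAM (registers indexed by   *)
(* nat, holding integers) with constants, addition, subtraction,       *)
(* indirect load/store, conditional jump and halt.  No multiplication, *)
(* so it is polynomially equivalent to Turing machines.                *)

Inductive instr : Type :=
  | IConst of nat & int
  | IAdd of nat & nat & nat
  | ISub of nat & nat & nat
  | ILoad of nat & nat
  | IStore of nat & nat
  | IJpos of nat & nat
  | IHalt.

Definition ram_state : Type := (nat * (nat -> int))%type.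

Definition upd (m : nat -> int) (i : nat) (v : int) : nat -> int :=
  fun j => if j == i then v else m j.

(* one step; None means the machine has halted (Halt or pc out of range) *)
Definition ram_step (P : seq instr) (s : ram_state) : option ram_state :=
  let: (pc, m) := s in
  match nth IHalt P pc with
  | IHalt => None
  | IConst i c => Some (pc.+1, upd m i c)
  | IAdd i j l => Some (pc.+1, upd m i (m j + m l))
  | ISub i j l => Some (pc.+1, upd m i (m j - m l))
  | ILoad i j => Some (pc.+1, upd m i (m `|m j|%N))
  | IStore i j => Some (pc.+1, upd m `|m i|%N (m j))
  | IJpos i t => Some (if 0 < m i then t else pc.+1, m)
  end.

Fixpoint ram_run (P : seq instr) (t : nat) (s : ram_state) : option ram_state :=
  match ram_step P s with
  | None => Some s
  | Some s' => if t is t'.+1 then ram_run P t' s' else None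
  end.

(* input encoding: m[0]=n, m[1]=k, m[2],m[3] = numerator/denominator of rho,
   m[4+2(i n+j)], m[5+2(i n+j)] = numerator/denominator of d(i,j); 0 elsewhere *)
Definition kmf_input (n : nat) (d : 'I_n -> 'I_n -> rat) (k : nat) (rho : rat)
  : nat -> int :=
  fun a =>
    if a == 0%N then n%:Z else
    if a == 1%N then k%:Z else
    if a == 2%N then numq rho else
    if a == 3%N then denq rho else
    \sum_(i : 'I_n) \sum_(j : 'I_n)
       (if a == (4 + 2 * (i * n + j))%N then numq (d i j)
        else if a == (5 + 2 * (i * n + j))%N then denq (d i j) else 0).

Definition ibits (z : int) : nat := (trunc_log 2 `|z|%N).+1.

Definition kmf_size (n : nat) (d : 'I_n -> 'I_n -> rat) (k : nat) (rho : rat)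
  : nat :=
  (ibits n%:Z + ibits k%:Z + ibits (numq rho) + ibits (denq rho) +
   \sum_(i : 'I_n) \sum_(j : 'I_n) (ibits (numq (d i j)) + ibits (denq (d i j))))%N.

Definition kmf_output (n : nat) (m : nat -> int) : {set 'I_n} :=
  [set i : 'I_n | m i != 0].

(* Main.v *)
(** Local search over exchanges of at most [p] centres has locality gap
    [3 + 2/p].  Let [S] be locally optimal and [O] optimal, let [eta] send each
    [o] in [O] to its nearest centre in [S], and consider closing [A] and opening
    [B] where every [o] with [eta o] in [A] lies in [B].  Each opened [o] serves
    its optimal cluster and connects it by its optimal tree, saving the service
    distances of the cluster and the parent edges of its vertices in the forest
    of [S].  A client of a closed [s] whose optimal centre [o] stays closed moves
    to [eta o].  For the forest, the elements of [S] in the optimal tree of [o]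
    are chained together, the last one being linked to [eta o]; since [eta o] is
    no farther from [o] than that element, all links cost at most twice the
    optimal forest.  Both parts of the objective thus charge
    [alpha o] to [o] in [B] and [gamma s] to [s] in [A], with total
    [cost O - cost S] and at most [2 cost O].  Averaging over exchanges that use
    each [o] with weight one and each [s] with weight at most [1 + 1/p] gives the
    gap.

    For the algorithm, the distances and [rho] are multiplied by a common
    denominator, and an exchange is accepted only if it improves the integer cost
    by a factor [1 - 1/q] with [q] linear in [n], so that the number of rounds is
    linear in [q] times the bit size.  It is written in a while language with
    arrays, which is compiled to the RAM. *)
Require Import Defs.
From mathcomp Require Import all_boot all_order all_algebra.
From mathcomp Require Import reals.
From mathcomp Require Import zify ring lra.
Import Order.TTheory GRing.Theory Num.Theory.
Local Open Scope ring_scope.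

Set Implicit Arguments.
Unset Strict Implicit.

(** * Minimum spanning forests *)

(** Forests never appear as graphs without cycles. A forest rooted in [X] is a derivation of
    [grow X c], attaching one vertex at a time. Read from the front it gives parent edges; read
    backwards from the full vertex set it merges clusters, and there the factor 2 for the closing
    links comes from a potential that counts the distance of each surviving top twice.

    Local optimality is only approximate, and every exchange in the averaging loses up to
    [cost S / q]. The weights of the exchanges sum to at most [k], so the loss is a fraction [k / q]
    of the cost, and this is why [q] must grow with [n]. One integer [N] is used twice, as exchange
    size and in [q = n * N].

    On the machine the obstacle is space: the input occupies the registers from 0 on, the output has
    to end there too, and there is no multiplication to compute the length of the input. The heap is
    therefore placed at [(lo + 64) * 2 ^ n], an address that doublings reach in linear time. *)

Lemma erel_sub n (F G : {set 'I_n * 'I_n}) :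
  F \subset G -> forall x y, connect (erel F) x y -> connect (erel G) x y.
Proof.
move=> /subsetP sFG; apply: connect_sub => x y.
by rewrite /erel => /orP[] h; apply: connect1; rewrite (sFG _ h) ?orbT.
Qed.

Lemma erel_connectC n (F : {set 'I_n * 'I_n}) : connect_sym (erel F).
Proof. by apply: sym_connect_sym => x y; rewrite /erel orbC. Qed.

Lemma connects_toP n (F : {set 'I_n * 'I_n}) (S : {set 'I_n}) :
  reflect (forall u, exists2 s, s \in S & connect (erel F) u s)
          (connects_to F S).
Proof.
apply: (iffP forallP) => [h u|h u]; last by apply/exists_inP; exact: h.
by have /exists_inP := h u.
Qed.

Lemma sum_setU_le (R : numDomainType) (T : finType) (f : T -> R) (A B : {set T}) :
  (forall x, 0 <= f x) ->
  \sum_(x in A :|: B) f x <= \sum_(x in A) f x + \sum_(x in B) f x.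
Proof.
move=> f0; rewrite (bigID (mem A)) /=; apply: lerD.
  rewrite (eq_bigl (mem A)) // => e; rewrite !inE.
  by case: (e \in A); rewrite ?andbT ?andbF.
rewrite [leRHS](bigID (mem A)) /= addrC.
rewrite (eq_bigl (fun e => (e \in B) && (e \notin A))).
  by rewrite lerDl sumr_ge0.
by move=> e; rewrite !inE; case: (e \in A); rewrite ?andbT ?andbF.
Qed.

Lemma sum_bigcup_le (R : numDomainType) (I T : finType) (f : T -> R)
    (P : pred I) (A : I -> {set T}) :
  (forall x, 0 <= f x) ->
  \sum_(x in \bigcup_(i | P i) A i) f x <= \sum_(i | P i) \sum_(x in A i) f x.
Proof.
move=> f0; elim/big_ind2: _ => [|A1 x1 A2 x2 h1 h2|//]; first by rewrite big_set0.
exact: le_trans (sum_setU_le _ _ f0) (lerD h1 h2).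
Qed.

Section Grow.
Variables (R : realDomainType) (n : nat) (w : 'I_n -> 'I_n -> R).

Hypothesis w0 : forall u v, 0 <= w u v.

(** A spanning forest rooted in [X], encoded as the order in which vertices are attached, so that
    induction on derivations replaces reasoning about trees. Such an induction starts at the full
    vertex set, where every vertex is its own root. *)
Inductive grow : {set 'I_n} -> R -> Prop :=
| grow_done : grow setT 0
| grow_step (X : {set 'I_n}) (x y : 'I_n) (c : R) : x \in X -> y \notin X -> grow (y |: X) c ->
    grow X (w x y + c).

(** The runs of Prim's algorithm with ties left open; also the specification of the program
    [prim_cmd]. *)
Inductive prim : {set 'I_n} -> R -> Prop :=
| prim_done : prim setT 0
| prim_step (X : {set 'I_n}) (x y : 'I_n) (c : R) : x \in X -> y \notin X ->
    (forall x' y', x' \in X -> y' \notin X -> w x y <= w x' y') ->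
    prim (y |: X) c -> prim X (w x y + c).

Lemma prim_grow X c : prim X c -> grow X c.
Proof. by elim=> [|X' x y c' xX yX _ _ h]; [left|right]. Qed.

Lemma grow_feasible X c : grow X c ->
  exists2 F, connects_to F X & \sum_(e in F) w e.1 e.2 <= c.
Proof.
elim=> [|X' x y c' xX yX _ [F /connects_toP cF le]].
  exists set0; last by rewrite big_set0.
  by apply/connects_toP => u; exists u; rewrite ?inE.
exists ((x, y) |: F).
  apply/connects_toP => u; have [s sX us] := cF u.
  have us' : connect (erel ((x, y) |: F)) u s.
    by apply: (erel_sub _ us); apply: subsetUr.
  move: sX; rewrite !inE => /orP[/eqP sy|sX]; last by exists s.
  exists x => //; apply: connect_trans us' _; rewrite sy.
  by apply: connect1; rewrite /erel !inE eqxx orbT.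
apply: le_trans (sum_setU_le _ _ _) _ => //.
by rewrite big_set1 lerD2l.
Qed.

(** The parent of [v] is the vertex it was attached to. The induction principle expresses that
    parent pointers lead to [X], in the form used later to prove connectivity. *)
Lemma grow_parent X c : grow X c ->
  exists p : 'I_n -> 'I_n,
   \sum_(v in ~: X) w (p v) v = c /\
   forall P : 'I_n -> Prop, (forall v, v \in X -> P v) ->
     (forall v, v \notin X -> P (p v) -> P v) -> forall v, P v.
Proof.
elim=> [|X' x y c' xX yX _ [p [su ind]]].
  by exists id; split=> [|P h _ v]; [rewrite setCT big_set0|apply: h].
exists (fun v => if v == y then x else p v); split.
  rewrite (bigD1 y) ?inE //= eqxx -su; congr (_ + _).
  apply: eq_big => v; first by rewrite !inE negb_or andbC.
  by case/andP=> _ /negPf ->.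
move=> P hX hp; apply: ind => [v|v].
  rewrite !inE => /orP[/eqP ->|]; last exact: hX.
  by apply: hp => //; rewrite eqxx; apply: hX.
rewrite !inE negb_or => /andP[vy vX] h; apply: hp => //.
by rewrite (negPf vy).
Qed.

Lemma prim_exists X : X != set0 -> exists c, prim X c.
Proof.
have [m] := ubnP #|~: X|; elim: m => // m IH in X *.
rewrite ltnS => le X0; have [->|XT] := eqVneq X setT; first by exists 0; left.
have /set0Pn [x0 x0X] := X0.
have [y0 y0X] : exists y, y \notin X.
  apply/existsP; apply: contraT; rewrite negb_exists => /forallP h.
  by case/eqP: XT; apply/setP=> y; rewrite inE; have := h y; rewrite negbK.
pose Pr (e : 'I_n * 'I_n) := (e.1 \in X) && (e.2 \notin X).
have P0 : Pr (x0, y0) by rewrite /Pr x0X y0X.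
have [[x y] /andP[/= xX yX] hm] := Order.TotalTheory.arg_minP (fun e => w e.1 e.2) P0.
have [||c hc] := IH (y |: X).
- apply: leq_trans le; apply: proper_card; rewrite properE; apply/andP; split.
    by rewrite setCS subsetUr.
  by apply/subsetPn; exists y; rewrite !inE ?eqxx.
- by apply/set0Pn; exists y; rewrite !inE eqxx.
exists (w x y + c); apply: prim_step => // x' y' x'X y'X.
by apply: (hm (x', y')); rewrite /Pr x'X y'X.
Qed.

Hypothesis wC : forall u v, w u v = w v u.

(* The first edge of F entering X on a path from y to X is at least as heavy
   as the minimum crossing edge, and becomes redundant once y joins X. *)
Lemma exchange (F : {set 'I_n * 'I_n}) (X : {set 'I_n}) (y : 'I_n) :
  connects_to F X -> y \notin X ->
  exists e a b, [/\ e \in F, (e = (a, b)) \/ (e = (b, a)), a \in X, b \notin X &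
    connects_to (F :\ e) (y |: X)].
Proof.
move=> /connects_toP cF yX.
have inv z pth : path (erel F) z pth -> z \notin X -> last z pth \in X ->
    exists e a b, [/\ e \in F, (e = (a, b)) \/ (e = (b, a)), a \in X, b \notin X &
    connect (erel (F :\ e)) z b].
  elim: pth z => [|z' pth IH] z /=; first by move=> _ /negP h /h.
  move=> /andP[zz' pz'] zX lX.
  have [z'X|z'X] := boolP (z' \in X).
    case/orP: zz' => h.
      by exists (z, z'), z', z; split=> //; right.
    by exists (z', z), z', z; split=> //; left.
  have [e [a [b [eF eab aX bX co]]]] := IH _ pz' z'X lX.
  exists e, a, b; split=> //; apply: connect_trans co; apply: connect1.
  have ne u v : u \notin X -> v \notin X -> (u, v) != e.
    move=> uX vX; apply/negP => /eqP h; case: eab; rewrite -h => -[h1 h2].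
      by rewrite h1 aX in uX.
    by rewrite h2 aX in vX.
  by rewrite /erel !inE !ne.
have [s sX /connectP[pth pp ls]] := cF y.
have [|e [a [b [eF eab aX bX co]]]] := inv _ _ pp yX; first by rewrite -ls.
exists e, a, b; split=> //; apply/connects_toP => u.
(* A path to [X] is cut where it enters [X] or just before it uses [e]. The only endpoint of [e]
   outside [X] is [b], so in the second case the path stands at [b], which [co] connects to [y]
   without [e]. *)
have key : forall pth z, path (erel F) z pth -> last z pth \in X ->
   exists2 s, s \in y |: X & connect (erel (F :\ e)) z s.
  elim=> [|z' q IH] z /=.
    by move=> _ zX; exists z; rewrite ?inE ?zX ?orbT.
  move=> /andP[zz' pq] lX.
  have [zX|zX] := boolP (z \in X); first by exists z; rewrite ?inE ?zX ?orbT.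
  have [s' s'X cs] := IH _ pq lX.
  have [ee|ne] := boolP ((e == (z, z')) || (e == (z', z))).
    have zb : z = b.
      case/orP: ee => /eqP ee; case: eab; rewrite ee => -[? ?]; subst => //;
      by rewrite aX in zX.
    exists y; first by rewrite !inE eqxx.
    by rewrite zb erel_connectC.
  exists s' => //; apply: connect_trans cs; apply: connect1.
  move: ne; rewrite negb_or /erel !inE eq_sym => /andP[-> /=].
  by rewrite eq_sym => ->; exact: zz'.
have [t tX /connectP[q pq lq]] := cF u.
by apply: key pq _; rewrite -lq.
Qed.

(** The edge added by Prim is charged to the edge [e] given by [exchange]; what remains of [F] is
    feasible for the enlarged root set, so the induction continues with it. *)
Lemma prim_min X c (F : {set 'I_n * 'I_n}) :
  prim X c -> connects_to F X -> c <= \sum_(e in F) w e.1 e.2.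
Proof.
move=> h; elim: h F => [F _|X' x y c' xX yX hm _ IH F cF]; first exact: sumr_ge0.
have [e [a [b [eF eab aX bX co]]]] := exchange cF yX.
rewrite (big_setD1 e eF) /=; apply: lerD; last exact: IH.
apply: le_trans (hm a b aX bX) _.
case: eab => -> /=; [exact: lexx | rewrite (wC b); exact: lexx].
Qed.

Lemma feasible_grow X (F : {set 'I_n * 'I_n}) : X != set0 -> connects_to F X ->
  exists2 c, c <= \sum_(e in F) w e.1 e.2 & grow X c.
Proof.
move=> /prim_exists [c hc] cF; exists c; last exact: prim_grow.
exact: prim_min hc cF.
Qed.

End Grow.

(** * Closing links *)

Section Closing.
Variables (n : nat) (d : 'I_n -> 'I_n -> rat).
Hypothesis dM : is_metric d.

Let d0 u v : 0 <= d u v. Proof. by case: dM. Qed.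
Let dxx u : d u u = 0. Proof. by case: dM => _ h _ _; apply/h. Qed.
Let dC u v : d u v = d v u. Proof. by case: dM. Qed.
Let dT u v w : d u w <= d u v + d v w. Proof. by case: dM. Qed.

(* [top x] is the one element of [S] in the cluster of [x] that is not yet
   linked by [h] to another element of [S]; it lies within [l x] of [x].  When
   two clusters merge, the farther of the two tops is linked to the nearer, at
   cost at most twice its own distance. *)
Lemma grow_links (S X : {set 'I_n}) c : grow d X c ->
  exists (r : 'I_n -> 'I_n) (Fo : 'I_n -> {set 'I_n * 'I_n})
    (h : 'I_n -> 'I_n) (top : 'I_n -> option 'I_n) (l : 'I_n -> rat),
  [/\ [/\ forall v, r v \in X, forall v, v \in X -> r v = v,
      forall v, connect (erel (Fo (r v))) v (r v) &
      \sum_(v in X) \sum_(e in Fo v) d e.1 e.2 <= c],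
      forall x, 0 <= l x,
      forall x t, top x = Some t ->
        [/\ x \in X, t \in S, r t = x, h t = t & d t x <= l x],
      (forall s, s \in S -> h s \in S /\ r (h s) = r s) /\
      (forall P : 'I_n -> Prop, (forall x t, top x = Some t -> P t) ->
         (forall s, s \in S -> P (h s) -> P s) -> forall s, s \in S -> P s) &
      \sum_(s in S) d s (h s) + 2 * \sum_(x in X) l x <= 2 * c].
Proof.
elim=> {X c} [|X x y c xX yX _].
  exists id, (fun _ => set0), id,
    (fun x => if x \in S then Some x else None), (fun _ => 0); split=> //.
  - split=> [v|||] //; first by rewrite inE.
    by rewrite big1 // => v _; rewrite big_set0.
  - by move=> x t; case: ifP => // h [<-]; rewrite inE dxx.
  - by split=> // P h1 h2 s sS; apply: (h1 s); rewrite sS.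
  - by rewrite !big1 ?mulr0 ?addr0.
move=> [r [Fo [h [top [l [[rX rid co su] l0 tp [hS ind] cost]]]]]].
have xy : x != y by apply: contraNneq yX => <-.
have rx : r x = x by apply: rid; rewrite !inE xX orbT.
have ry : r y = y by apply: rid; rewrite !inE eqxx.
(* The derivation attached [y] to [x]; going back to the root set [X] merges the cluster of [y] into
   that of [x] along the edge [(x, y)]. *)
pose r' v := if r v == y then x else r v.
pose Fo' v := if v == x then (x, y) |: (Fo x :|: Fo y) else
              if v == y then set0 else Fo v.
have forest : [/\ forall v, r' v \in X, forall v, v \in X -> r' v = v,
      forall v, connect (erel (Fo' (r' v))) v (r' v) &
      \sum_(v in X) \sum_(e in Fo' v) d e.1 e.2 <= d x y + c].
  split.
  - move=> v; rewrite /r'; case: eqP => // /eqP ne.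
    by have := rX v; rewrite !inE (negPf ne).
  - move=> v vX; rewrite /r' rid ?inE ?vX ?orbT //.
    by case: eqP vX yX => // -> ->.
  - move=> v; have cv := co v; rewrite /r'; case: eqP => [rv|/eqP ne].
      rewrite rv in cv; rewrite /Fo' eqxx; apply: (@connect_trans _ _ y).
        by apply: (erel_sub _ cv); apply/subsetP => e he; rewrite !inE he !orbT.
      by apply: connect1; rewrite /erel !inE eqxx ?orbT.
    rewrite /Fo' (negPf ne); case: eqP => [rv|_]; last exact: co.
    rewrite rv in cv *.
    by apply: (erel_sub _ cv); apply/subsetP => e he; rewrite !inE he !orbT.
  - rewrite (big_setU1 _ yX) /= (bigD1 x xX) /= in su.
    rewrite (bigD1 x xX) /= {1}/Fo' eqxx.
    have -> : \sum_(i in X | i != x) \sum_(e in Fo' i) d e.1 e.2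
      = \sum_(i in X | i != x) \sum_(e in Fo i) d e.1 e.2.
      apply: eq_bigr => i /andP[iX ix]; rewrite /Fo' (negPf ix).
      by case: eqP iX yX => // -> ->.
    apply: le_trans (lerD (sum_setU_le _ _ _) (lexx _)) _ => //.
    rewrite big_set1 /= -addrA lerD2l; apply: le_trans su.
    apply: le_trans (lerD (sum_setU_le _ _ _) (lexx _)) _ => //.
    by rewrite [X in X + _ <= _]addrC addrA.
have r'E u v : r u = r v -> r' u = r' v by rewrite /r' => ->.
have [hx hy] : x \in y |: X /\ y \in y |: X by rewrite !inE xX eqxx orbT.
rewrite (big_setU1 _ yX) /= (bigD1 x xX) /= in cost.
have dxy : d x y >= 0 by [].
(* the three merge cases only differ in the new top and link of x *)
have merge (h' : 'I_n -> 'I_n) (tx : option 'I_n) (lx : rat) :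
   0 <= lx ->
   (forall t, tx = Some t -> [/\ t \in S, r' t = x, h' t = t & d t x <= lx]) ->
   (forall z t, z != x -> z != y -> top z = Some t -> h' t = t) ->
   (forall s, s \in S -> h' s \in S /\ r' (h' s) = r' s) ->
   (forall P : 'I_n -> Prop, (forall t, tx = Some t -> P t) ->
     (forall s, s \in S -> P (h' s) -> P s) ->
     (forall t, top x = Some t -> P t) /\ (forall t, top y = Some t -> P t) /\
     (forall s, s \in S -> P (h s) -> P s)) ->
   \sum_(s in S) d s (h' s) + 2 * lx <=
     \sum_(s in S) d s (h s) + 2 * (l x + l y + d x y) ->
  exists (r : 'I_n -> 'I_n) (Fo : 'I_n -> {set 'I_n * 'I_n})
    (h : 'I_n -> 'I_n) (top : 'I_n -> option 'I_n) (l : 'I_n -> rat),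
  [/\ [/\ forall v, r v \in X, forall v, v \in X -> r v = v,
      forall v, connect (erel (Fo (r v))) v (r v) &
      \sum_(v in X) \sum_(e in Fo v) d e.1 e.2 <= d x y + c],
      forall x, 0 <= l x,
      forall x t, top x = Some t ->
        [/\ x \in X, t \in S, r t = x, h t = t & d t x <= l x],
      (forall s, s \in S -> h s \in S /\ r (h s) = r s) /\
      (forall P : 'I_n -> Prop, (forall x t, top x = Some t -> P t) ->
         (forall s, s \in S -> P (h s) -> P s) -> forall s, s \in S -> P s) &
      \sum_(s in S) d s (h s) + 2 * \sum_(x in X) l x <= 2 * (d x y + c)].
  move=> lx0 htx htop hh' hP hc.
  exists r', Fo', h', (fun z => if z == x then tx else if z == y then None else top z),
    (fun z => if z == x then lx else l z); split=> //.
  - by move=> z; case: ifP.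
  - move=> z t; case: (eqVneq z x) => [->|zx].
      by move=> /htx [? ? ? ?]; split.
    case: (eqVneq z y) => // zy tz; have [zX tS rt ht dt] := tp _ _ tz.
    split=> //; first by move: zX; rewrite !inE (negPf zy).
      by rewrite /r' rt (negPf zy).
    exact: htop tz.
  - split=> // P h1 h2 s sS.
    have [|a1 [a2 a3]] := hP P _ h2.
      by move=> t tt; apply: (h1 x); rewrite eqxx.
    apply: ind sS => // z t tz.
    have [zx|zx] := eqVneq z x; first by apply: a1; rewrite -zx.
    have [zy|zy] := eqVneq z y; first by apply: a2; rewrite -zy.
    by apply: (h1 z); rewrite (negPf zx) (negPf zy).
  - rewrite (bigD1 x xX) /= eqxx.
    rewrite [X in lx + X](eq_bigr l); last by move=> i /andP[_ /negPf ->].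
    lra.
have [cy0 cx0] : l y >= 0 /\ l x >= 0 by [].
case ty : (top y) => [t|]; last first.
  apply: (merge h (top x) (l x)) => //.
  - move=> t /tp [_ ? rt ? ?]; split=> //.
    by rewrite /r' rt (negPf xy).
  - by move=> z t _ _ /tp [].
  - by move=> s /hS [? /r'E].
  - by move=> P a1 a2; split=> //; split=> // t; rewrite ty.
  - lra.
have [_ tS rt ht dt] := tp _ _ ty.
have r't : r' t = x by rewrite /r' rt eqxx.
have dtx : d t x <= l y + d x y.
  by apply: le_trans (dT _ y _) _; rewrite lerD // dC.
case tx : (top x) => [u|]; last first.
  apply: (merge h (Some t) (l y + d x y)) => //.
  - by rewrite addr_ge0.
  - by move=> _ [<-].
  - by move=> z t' _ _ /tp [].
  - by move=> s /hS [? /r'E].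
  - move=> P a1 a2; split; first by rewrite tx.
    by split=> // t'; rewrite ty => -[<-]; apply: a1.
  - lra.
have [_ uS ru hu du] := tp _ _ tx.
have r'u : r' u = x by rewrite /r' ru (negPf xy).
have dtu : d t u <= l x + l y + d x y.
  by apply: le_trans (dT _ x _) _; rewrite [d x u]dC; lra.
have tu : t != u by apply: contraNneq xy => e; rewrite -ru -rt e.
have link a b : a \in S -> b \in S -> h a = a -> r' a = r' b -> a != b ->
   let h' s := if s == a then b else h s in
   [/\ (forall s, s \in S -> h' s \in S /\ r' (h' s) = r' s),
   \sum_(s in S) d s (h' s) = \sum_(s in S) d s (h s) + d a b &
   forall P : 'I_n -> Prop, P b -> (forall s, s \in S -> P (h' s) -> P s) ->
     P a /\ (forall s, s \in S -> P (h s) -> P s)].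
  move=> aS bS ha rab ab h'; split.
  - move=> s sS; rewrite /h'; case: eqP => [->|_]; first by rewrite rab.
    by have [? /r'E] := hS _ sS.
  - rewrite (bigD1 a aS) (bigD1 a aS) /= ha dxx add0r /h' eqxx addrC.
    congr (_ + _); apply: eq_bigr => s /andP[_ /negPf ->] //.
  - move=> P Pb h2; have Pa : P a by apply: h2 => //; rewrite /h' eqxx.
    split=> // s sS Ps; have [->//|sa] := eqVneq s a.
    by apply: h2 => //; rewrite /h' (negPf sa).
(* The tops lie within [l x] and [l y + d x y] of [x], so their link costs at most twice the larger
   bound. Dropping the top with the larger bound frees exactly that amount in the potential. *)
have [le|lt] := lerP (l x) (l y + d x y).
  have [|l1 l2 l3] := link t u tS uS ht _ tu; first by rewrite r't r'u.
  apply: (merge (fun s => if s == t then u else h s) (Some u) (l x)) => //.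
  - by move=> _ [<-]; split=> //; rewrite eq_sym (negPf tu).
  - move=> z t' zx zy /tp [_ _ rt' ht' _]; case: eqP => // tt.
    by rewrite -rt' tt rt eqxx in zy.
  - move=> P a1 a2; have [b1 b2] := l3 P (a1 _ erefl) a2.
    split; first by move=> t'; rewrite tx => -[<-]; apply: a1.
    by split=> // t'; rewrite ty => -[<-].
  - by rewrite l2; lra.
have [||l1 l2 l3] := link u t uS tS hu _ _; rewrite ?r't ?r'u // 1?eq_sym //.
apply: (merge (fun s => if s == u then t else h s) (Some t) (l y + d x y)) => //.
- by rewrite addr_ge0.
- by move=> _ [<-]; split=> //; rewrite (negPf tu).
- move=> z t' zx zy /tp [_ _ rt' ht' _]; case: eqP => // tt.
  by rewrite -rt' tt ru eqxx in zx.
- move=> P a1 a2; have [b1 b2] := l3 P (a1 _ erefl) a2.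
  split; first by move=> t'; rewrite tx => -[<-].
  by split=> // t'; rewrite ty => -[<-]; apply: a1.
- by rewrite l2 dC; lra.
Qed.

(** The top [t] left in the cluster of [o] is linked to [eta o], and [d t (eta o) <= d t o + d o
    (eta o) <= 2 * d o t] is paid by the potential [2 * l o] left over in [grow_links]. The last
    clause is induction along the links, whose chains end with a link to [eta (r s)]. *)
Lemma closing_map (S O : {set 'I_n}) c (eta : 'I_n -> 'I_n) : grow d O c ->
  (forall o, o \in O -> eta o \in S /\ forall s, s \in S -> d o (eta o) <= d o s) ->
  exists (r : 'I_n -> 'I_n) (Fo : 'I_n -> {set 'I_n * 'I_n}) (H : 'I_n -> 'I_n),
  [/\ forall v, r v \in O,
      forall v, connect (erel (Fo (r v))) v (r v),
      \sum_(v in O) \sum_(e in Fo v) d e.1 e.2 <= c,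
      \sum_(s in S) d s (H s) <= 2 * c &
      forall P : 'I_n -> Prop,
        (forall s, s \in S -> H s = eta (r s) -> P s) ->
        (forall s, s \in S -> H s \in S -> r (H s) = r s -> P (H s) -> P s) ->
        forall s, s \in S -> P s].
Proof.
move=> /(grow_links S) [r [Fo [h [top [l [[rX rid co su] l0 tp [hS ind] cost]]]]]] he.
exists r, Fo, (fun s => if top (r s) == Some s then eta (r s) else h s); split=> //.
- apply: le_trans cost.
  rewrite (bigID (fun s => top (r s) == Some s)) /=.
  rewrite [X in _ + X](eq_bigr (fun s => d s (h s))); last by move=> s /andP[_ /negPf ->].
  rewrite [X in X + _](eq_bigr (fun s => d s (eta (r s)))); last by move=> s /andP[_ ->].
  rewrite [X in _ <= X + _](bigID (fun s => top (r s) == Some s)) /=.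
  rewrite [X in _ <= X + _ + _]big1; last by move=> s /andP[_ /eqP /tp [_ _ _ -> _]].
  rewrite add0r addrC lerD2l mulr_sumr.
  rewrite (partition_big r (mem O)) //=.
  apply: ler_sum => o oO; have [eo eo'] := he o oO.
  case to : (top o) => [t|]; last first.
    rewrite big1 ?mulr_ge0 // => s /andP[/andP[sS ts] /eqP rs].
    by rewrite rs to in ts.
  have [_ tS rt _ dt] := tp _ _ to.
  rewrite (big_pred1 t) => [|s]; last first.
    apply/andP/eqP => [[/andP[_ /eqP h1] /eqP h2]|->].
      by move: h1; rewrite h2 to => -[].
    by rewrite tS rt to !eqxx.
  rewrite rt; apply: le_trans (dT _ o _) _; have := eo' t tS; rewrite (dC o t); lra.
- move=> P h1 h2; apply: ind => [x t xt|s sS Ps].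
    by have [_ tS rt _ _] := tp _ _ xt; apply: h1 => //; rewrite rt xt eqxx.
  have [ts|ts] := boolP (top (r s) == Some s); first by apply: h1; rewrite ?ts.
  by have [a1 a2] := hS _ sS; apply: h2; rewrite ?(negPf ts).
Qed.

End Closing.

(** * Cost of a swap *)

Lemma bigmin_attained (R : realDomainType) (I : finType) (P : pred I) (f : I -> R) x0 :
  (exists i, P i) -> (forall i, P i -> f i <= x0) ->
  exists2 i, P i & \big[Num.min/x0]_(j | P j) f j = f i.
Proof.
move=> [i0 Pi0] h.
have [i Pi hm] := Order.TotalTheory.arg_minP f Pi0.
exists i => //; apply/eqP; rewrite eq_le; apply/andP; split.
  exact: bigmin_le_cond.
by apply: le_bigmin => //; apply: h.
Qed.

Section Costs.
Variables (n : nat) (d : 'I_n -> 'I_n -> rat) (rho : rat).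
Hypothesis dM : is_metric d.
Hypothesis rho0 : 0 <= rho.

Let d0 u v : 0 <= d u v. Proof. by case: dM. Qed.
Let dC u v : d u v = d v u. Proof. by case: dM. Qed.
Let dT u v w : d u w <= d u v + d v w. Proof. by case: dM. Qed.

Lemma le_dmax u v : d u v <= dmax d.
Proof.
apply: le_trans (le_bigmax _ _ u).
exact: (le_bigmax _ (fun w => d u w) v).
Qed.

Lemma dist_to_le (S : {set 'I_n}) u w : w \in S -> dist_to d S u <= d u w.
Proof. exact: bigmin_le_cond. Qed.

Lemma dist_to_attained (S : {set 'I_n}) u : S != set0 ->
  exists2 w, w \in S & dist_to d S u = d u w.
Proof.
move=> /set0Pn [s sS]; apply: bigmin_attained; first by exists s.
by move=> i _; apply: le_dmax.
Qed.

Lemma dist_to_ge0 (S : {set 'I_n}) u : S != set0 -> 0 <= dist_to d S u.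
Proof. by move=> /(dist_to_attained u) [w _ ->]. Qed.

Lemma connects_to_setT (S : {set 'I_n}) : S != set0 -> connects_to setT S.
Proof.
move=> /set0Pn [s sS]; apply/connects_toP => u; exists s => //.
by apply: connect1; rewrite /erel inE.
Qed.

Lemma mst_le (S : {set 'I_n}) F : connects_to F S -> mst_contracted d S <= eweight d F.
Proof. by move=> h; rewrite [leLHS]/mst_contracted; apply: (@bigmin_le_cond _ _ _ _ F (fun F => connects_to F S)). Qed.

Lemma mst_attained (S : {set 'I_n}) : S != set0 ->
  exists2 F, connects_to F S & mst_contracted d S = eweight d F.
Proof.
move=> S0; apply: bigmin_attained; first by exists setT; apply: connects_to_setT.
move=> F _; rewrite /eweight [leRHS](bigID (mem F)) /=.
by rewrite [X in _ <= X + _](eq_bigl (mem F)) ?lerDl ?sumr_ge0 // => e; rewrite inE.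
Qed.

Lemma mst_ge0 (S : {set 'I_n}) : S != set0 -> 0 <= mst_contracted d S.
Proof. by move=> /mst_attained [F _ ->]; apply: sumr_ge0. Qed.

Lemma kmf_cost_ge0 (S : {set 'I_n}) : S != set0 -> 0 <= kmf_cost d rho S.
Proof.
by move=> S0; rewrite addr_ge0 ?mulr_ge0 ?mst_ge0 // sumr_ge0 // => u _; apply: dist_to_ge0.
Qed.

(** Lets an exchange that leaves fewer than [k] centres, because an opened one was already in [S],
    be padded to size [k]. *)
Lemma kmf_cost_anti (S T : {set 'I_n}) : S != set0 -> S \subset T ->
  kmf_cost d rho T <= kmf_cost d rho S.
Proof.
move=> S0 /subsetP sST; apply: lerD.
  apply: ler_sum => u _; have [w wS ->] := dist_to_attained u S0.
  by apply: dist_to_le; apply: sST.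
apply: ler_wpM2l => //; have [F /connects_toP cF ->] := mst_attained S0.
apply: mst_le; apply/connects_toP => u; have [s sS cs] := cF u.
by exists s => //; apply: sST.
Qed.

Lemma nearest (S : {set 'I_n}) : S != set0 -> exists f : 'I_n -> 'I_n,
  forall u, f u \in S /\ dist_to d S u = d u (f u).
Proof.
move=> S0; have h u : exists w, (w \in S) && (dist_to d S u == d u w).
  by have [w wS e] := dist_to_attained u S0; exists w; rewrite wS e eqxx.
by exists (fun u => xchoose (h u)) => u; have /andP[? /eqP] := xchooseP (h u).
Qed.

(** Prim gives a derivation of at most the optimal weight, and [grow_feasible] turns it back into a
    feasible edge set, so the weights agree. *)
Lemma mst_grow (S : {set 'I_n}) : S != set0 -> grow d S (mst_contracted d S).
Proof.
move=> S0; have [F cF e] := mst_attained S0.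
have [c le g] := feasible_grow d0 dC S0 cF.
have [G cG le'] := grow_feasible d0 g.
have := mst_le cG; rewrite e => h.
suff -> : eweight d F = c by [].
apply/eqP; rewrite eq_le le andbT; exact: le_trans h le'.
Qed.

(* Cost of closing A and opening B: an opened o pays for the clients and the
   tree of its optimal cluster (and saves what S paid for them), a closed s
   pays twice the optimal cost of its clients plus the length of its closing
   link. *)
Lemma swap_cost (S O : {set 'I_n}) : S != set0 -> O != set0 ->
  exists (eta : 'I_n -> 'I_n) (alpha gamma : 'I_n -> rat),
  [/\ forall o, o \in O -> eta o \in S,
      forall s, 0 <= gamma s,
      \sum_(o in O) alpha o = kmf_cost d rho O - kmf_cost d rho S,
      \sum_(s in S) gamma s <= 2 * kmf_cost d rho O &
      forall A B : {set 'I_n}, A \subset S -> B \subset O ->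
        (forall o, o \in O -> eta o \in A -> o \in B) ->
        kmf_cost d rho (S :\: A :|: B) <=
          kmf_cost d rho S + \sum_(o in B) alpha o + \sum_(s in A) gamma s].
Proof.
move=> S0 O0.
have [eta heta] := nearest S0; have [on hon] := nearest O0.
have he o : o \in O -> eta o \in S /\ forall s, s \in S -> d o (eta o) <= d o s.
  move=> _; have [h1 h2] := heta o; split=> // s sS; rewrite -h2; exact: dist_to_le.
have [r [Fo [H [rO co su sH ind]]]] := closing_map dM (mst_grow O0) he.
have [p [sp pind]] := grow_parent (mst_grow S0).
(* [M o] is the weight of the optimal tree of [o], and [W o] is what the forest of [S] pays for the
   parent edges of the vertices in that tree's cluster; opening [o] trades [W o] for [M o]. *)
pose M u := \sum_(e in Fo u) d e.1 e.2.
pose W o := \sum_(v in ~: S | r v == o) d (p v) v.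
(* The bound from [closing_map] is tight, since the union of the optimal trees is itself feasible.
   This makes the sum of [alpha] an equality. *)
have suE : \sum_(v in O) M v = mst_contracted d O.
  apply/eqP; rewrite eq_le su /=.
  apply: le_trans (_ : eweight d (\bigcup_(v in O) Fo v) <= _); last first.
    by rewrite /eweight; apply: sum_bigcup_le.
  apply: mst_le; apply/connects_toP => u; exists (r u) => //.
  by apply: (erel_sub _ (co u)); apply: bigcup_sup.
exists eta, (fun o => \sum_(j | on j == o) (d j (on j) - d j (eta j)) + rho * (M o - W o)),
  (fun s => 2 * \sum_(j | eta j == s) d j (on j) + rho * d s (H s)); split.
- by move=> o _; have [] := heta o.
- by move=> s; rewrite addr_ge0 ?mulr_ge0 // sumr_ge0.
- rewrite big_split /= -mulr_sumr sumrB suE /kmf_cost.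
  have -> : \sum_(i in O) W i = mst_contracted d S.
    by rewrite -sp [RHS](partition_big r (mem O)) // => v _; apply: rO.
  have -> : \sum_(i in O) \sum_(j | on j == i) (d j (on j) - d j (eta j)) =
     \sum_j dist_to d O j - \sum_j dist_to d S j.
    rewrite -sumrB [RHS](partition_big on (mem O)) /=; last first.
      by move=> j _; have [] := hon j.
    apply: eq_bigr => i _; apply: eq_bigr => j _.
    by have [_ ->] := hon j; have [_ ->] := heta j.
  by rewrite mulrBr; ring.
- rewrite big_split /= -!mulr_sumr /kmf_cost mulrDr; apply: lerD; last first.
    by rewrite mulrCA; apply: ler_wpM2l.
  rewrite ler_pM2l // [leRHS](partition_big eta (mem S)) /=; last first.
    by move=> j _; have [] := heta j.
  apply: ler_sum => i _; apply: ler_sum => j _.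
  by have [_ ->] := hon j.
move=> A B AS BO hAB; set T := _ :|: B.
have inT1 s : s \in S -> s \notin A -> s \in T by move=> h1 h2; rewrite !inE h1 h2.
have inT2 s : s \in B -> s \in T by move=> h; rewrite !inE h orbT.
have etaT o : o \in O -> o \notin B -> eta o \in T.
  move=> oO oB; apply: inT1; first by have [] := heta o.
  by apply: contra oB; apply: hAB.
have med : \sum_u dist_to d T u <= \sum_u dist_to d S u
   + \sum_(o in B) \sum_(j | on j == o) (d j (on j) - d j (eta j))
   + \sum_(s in A) 2 * \sum_(j | eta j == s) d j (on j).
  have -> : \sum_(o in B) \sum_(j | on j == o) (d j (on j) - d j (eta j))
     = \sum_(j | on j \in B) (d j (on j) - d j (eta j)).
    rewrite [RHS](partition_big on (mem B)) //=; apply: eq_bigr => o oB.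
    by apply: eq_bigl => j; case: (eqVneq (on j) o) => [->|]; rewrite ?oB ?andbF.
  have -> : \sum_(s in A) 2 * \sum_(j | eta j == s) d j (on j)
     = \sum_(j | eta j \in A) 2 * d j (on j).
    rewrite [RHS](partition_big eta (mem A)) //=; apply: eq_bigr => s sA.
    rewrite mulr_sumr.
    by apply: eq_bigl => j; case: (eqVneq (eta j) s) => [->|]; rewrite ?sA ?andbF.
  rewrite [X in _ + X + _]big_mkcond [X in _ + _ + X]big_mkcond /= -!big_split /=.
  apply: ler_sum => j _; have [oj ->] := heta j; have [onO _] := hon j.
  have q0 : 0 <= 2 * d j (on j) by rewrite mulr_ge0.
  have [onB|onB] := boolP (on j \in B).
    apply: le_trans (_ : d j (on j) <= _); first by apply: dist_to_le; apply: inT2.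
    by case: ifP => _; lra.
  have [eA|eA] := boolP (eta j \in A); last first.
    apply: le_trans (dist_to_le _ (inT1 _ oj eA)) _; lra.
  (* With [o = on j], the new distance is at most [d j o + d o (eta o)], and [d o (eta o) <= d o
     (eta j) <= d j o + d j (eta j)]; the increase is thus at most [2 * d j o]. *)
  apply: le_trans (dist_to_le _ (etaT _ onO onB)) _.
  apply: le_trans (dT _ (on j) _) _.
  have [_ h] := he _ onO; have := h _ oj.
  have := dT (on j) j (eta j); rewrite [d (on j) j]dC; lra.
have mst : mst_contracted d T <= mst_contracted d S
    + \sum_(o in B) (M o - W o) + \sum_(s in A) d s (H s).
  (* The new edge set: parent edges of vertices outside the opened clusters, optimal trees of the
     opened centres, closing links of the closed ones. *)
  pose F1 := \bigcup_(v in ~: S | r v \notin B) [set (p v, v)].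
  pose F2 := \bigcup_(o in B) Fo o.
  pose F3 := \bigcup_(s in A) [set (s, H s)].
  pose F := F1 :|: F2 :|: F3.
  have e0 (e : 'I_n * 'I_n) : 0 <= d e.1 e.2 by [].
  have wF : eweight d F <= \sum_(v in ~: S | r v \notin B) d (p v) v
      + \sum_(o in B) M o + \sum_(s in A) d s (H s).
    apply: le_trans (sum_setU_le _ _ e0) _; apply: lerD.
      apply: le_trans (sum_setU_le _ _ e0) _; apply: lerD.
        apply: le_trans (sum_bigcup_le _ _ e0) _; apply: ler_sum => v _.
        by rewrite big_set1.
      exact: (sum_bigcup_le _ _ e0).
    apply: le_trans (sum_bigcup_le _ _ e0) _; apply: ler_sum => v _.
    by rewrite big_set1.
  have WE : \sum_(v in ~: S | r v \notin B) d (p v) v + \sum_(o in B) W o = mst_contracted d S.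
    rewrite -sp [RHS](bigID (fun v => r v \in B)) /= addrC; congr (_ + _).
    rewrite [RHS](partition_big r (mem B)) /=; last by move=> v /andP[].
    apply: eq_bigr => o oB; apply: eq_bigl => v.
    by case: (eqVneq (r v) o) => [->|]; rewrite ?oB ?andbT ?andbF.
  apply: le_trans (_ : eweight d F <= _); last first.
    by rewrite sumrB -{1}WE; apply: le_trans wF _; lra.
  apply: mst_le; apply/connects_toP.
  pose Q v := exists2 t, t \in T & connect (erel F) v t.
  have Qedge u v : (u, v) \in F \/ (v, u) \in F -> Q v -> Q u.
    move=> uv [t tT cv]; exists t => //; apply: connect_trans cv.
    by apply: connect1; rewrite /erel; case: uv => ->; rewrite ?orbT.
  have Q1 v : r v \in B -> Q v.
    move=> rB; exists (r v); first exact: inT2.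
    apply: (erel_sub _ (co v)); apply/subsetP => e he'; rewrite !inE.
    by rewrite (_ : e \in F2) ?orbT //; apply/bigcupP; exists (r v).
  have edgeH s : s \in A -> (s, H s) \in F.
    by move=> sA; rewrite !inE; apply/orP; right; apply/bigcupP; exists s; rewrite ?inE.
  (* Links are followed as long as they lead to closed centres. A chain in the cluster of [o] ends
     at [eta o], which stays open unless [o] is opened, and then the tree of [o] connects the whole
     cluster. *)
  have Q2 s : s \in S -> Q s.
    apply: ind => {}s sS.
      move=> Hs; have [rB|rB] := boolP (r s \in B); first exact: Q1.
      have [sA|sA] := boolP (s \in A); last by exists s; [apply: inT1|].
      apply: (Qedge s (H s)); first by left; apply: edgeH.
      by rewrite Hs; exists (eta (r s)) => //; apply: etaT.
    move=> _ _ QH.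
    have [sA|sA] := boolP (s \in A); last by exists s; [apply: inT1|].
    by apply: (Qedge s (H s)) => //; left; apply: edgeH.
  apply: (pind Q) => // v vS Qp.
  have [rB|rB] := boolP (r v \in B); first exact: Q1.
  apply: (Qedge v (p v)) => //; right; rewrite !inE; apply/orP; left.
  apply/orP; left; apply/bigcupP; exists v; last by rewrite inE.
  by rewrite inE vS rB.
have := ler_wpM2l rho0 mst; rewrite !mulrDr !mulr_sumr => mst'.
rewrite /kmf_cost !big_split /=; lra.
Qed.
End Costs.

(** * The locality gap *)

Lemma card_between (T : finType) (A B : {set T}) k : A \subset B ->
  (#|A| <= k <= #|B|)%N -> exists C : {set T}, [/\ A \subset C, C \subset B & #|C| = k].
Proof.
move=> AB; elim: k => [|k IH] /andP[Ak kB].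
  by exists A; split=> //; apply/eqP; rewrite -leqn0.
rewrite leq_eqVlt in Ak; case/orP: Ak => [/eqP Ak|Ak]; first by exists A; split.
have [|C [AC CB Ck]] := IH; first by rewrite -ltnS Ak ltnW.
have /subsetPn [x xB xC] : ~~ (B \subset C).
  by apply/negP => /subset_leq_card; rewrite Ck leqNgt kB.
exists (x |: C); split; first exact: subset_trans AC (subsetUr _ _).
  by rewrite subUset sub1set xB.
by rewrite cardsU1 xC Ck.
Qed.

Lemma card_eq_bij (T : finType) (A B : {set T}) : #|A| = #|B| ->
  exists f : T -> T, {in A &, injective f} /\ f @: A = B.
Proof.
move=> AB; pose f x := nth x (enum B) (index x (enum A)).
have sz x : x \in A -> (index x (enum A) < size (enum B))%N.
  by move=> xA; rewrite -cardE -AB cardE index_mem mem_enum.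
have fi : {in A &, injective f}.
  move=> x y xA yA; rewrite /f (set_nth_default y) ?sz // => /eqP.
  rewrite nth_uniq ?sz ?enum_uniq // => /eqP h.
  rewrite -[x](nth_index x (s := enum A)) ?mem_enum // h.
  by rewrite (set_nth_default y) ?nth_index ?index_mem ?mem_enum.
exists f; split=> //; apply/eqP; rewrite eqEcard card_in_imset // AB leqnn andbT.
apply/subsetP => _ /imsetP [x xA ->].
by rewrite -mem_enum mem_nth ?sz.
Qed.

Section Locality.
Variables (n : nat) (d : 'I_n -> 'I_n -> rat) (rho : rat).
Hypothesis dM : is_metric d.
Hypothesis rho0 : 0 <= rho.

(** The exchanges are grouped by the image [s] of [eta]. A group counts each [al] of its preimage
    [Bs s] once and uses exchanges of total weight at most [#|Bs s|], each losing up to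
    [cost S / q]. Summed over the groups, these losses are at most [k / q] times the cost of [S],
    and the closings contribute at most [(1 + 1/p) * 2 * cost O]. *)
Lemma local_opt_bound (S O : {set 'I_n}) (k p : nat) (q : rat) :
  #|S| = k -> #|O| = k -> (0 < k)%N -> (0 < p)%N -> 0 < q ->
  (forall T : {set 'I_n}, #|T| = k -> (#|S :\: T| <= p)%N ->
     q * (kmf_cost d rho S - kmf_cost d rho T) <= kmf_cost d rho S) ->
  (1 - k%:R / q) * kmf_cost d rho S <= (3 + 2 / p%:R) * kmf_cost d rho O.
Proof.
move=> Sk Ok k0 p0 q0 loc.
have S0 : S != set0 by rewrite -card_gt0 Sk.
have O0 : O != set0 by rewrite -card_gt0 Ok.
have [eta [al [ga [etaS ga0 sal sga sw]]]] := swap_cost dM rho0 S0 O0.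
set cS := kmf_cost d rho S in loc sal sga sw *.
set cO := kmf_cost d rho O in sal sga *.
(* [B] may meet [S :\: A], so [T] can be smaller than [k]. It is padded to [T'] by elements of [A],
   which keeps [S :\: T'] inside [A]. *)
have swp (A B : {set 'I_n}) : A \subset S -> B \subset O ->
    (forall o, o \in O -> eta o \in A -> o \in B) -> #|A| = #|B| -> (#|A| <= p)%N ->
    - (cS / q) <= \sum_(o in B) al o + \sum_(s in A) ga s.
  move=> AS BO h cAB Ap; set T := S :\: A :|: B.
  have T0 : T != set0.
    have /set0Pn [o oO] := O0; apply/set0Pn.
    have [oB|oB] := boolP (o \in B); first by exists o; rewrite inE oB orbT.
    exists (eta o); rewrite !inE etaS // andbT; apply/orP; left.
    by apply: contra oB; apply: h.
  have [||T' [TT' T'A cT']] := @card_between _ T (T :|: A) k; first exact: subsetUl.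
    apply/andP; split.
      apply: leq_trans (leq_card_setU _ _) _.
      by rewrite cardsD (setIidPr AS) -cAB subnK ?Sk // -Sk subset_leq_card.
    rewrite -Sk; apply: subset_leq_card; apply/subsetP => x xS; rewrite !inE xS.
    by case: (x \in A); rewrite ?orbT.
  have sub : (#|S :\: T'| <= p)%N.
    apply: leq_trans Ap; apply: subset_leq_card; apply/subsetP => x.
    rewrite inE => /andP[xT xS]; apply: contraR xT => xA.
    by apply: (subsetP TT'); rewrite !inE xA xS.
  have := loc _ cT' sub; rewrite mulrC -ler_pdivlMr // => l1.
  have := sw A B AS BO h; have := kmf_cost_anti dM rho0 T0 TT'; lra.
set x := cS / q in swp.
have x0 : 0 <= x by apply: divr_ge0; [exact: kmf_cost_ge0|exact: ltW].
(* Each [s] in [E] is matched with one representative of its preimage. As [#|S| = #|O|], the other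
   elements [O'] of [O] are as many as the centres outside [E], and [be] matches these. Closing a
   centre outside [E] forces no particular opening. *)
pose E := eta @: O.
pose Bs s := [set o in O | eta o == s].
pose rep s := odflt s [pick o in Bs s].
have repP s : s \in E -> rep s \in Bs s.
  move=> /imsetP [o oO ->]; rewrite /rep; case: pickP => //= h.
  by have := h o; rewrite inE oO eqxx.
pose O' := [set o in O | o != rep (eta o)].
have cE : #|rep @: E| = #|E|.
  apply: card_in_imset => s t sE tE e; have := repP s sE; have := repP t tE.
  by rewrite e !inE => /andP[_ /eqP e1] /andP[_ /eqP e2]; rewrite -e1 -e2.
have O'E : O' = O :\: rep @: E.
  apply/setP=> o; rewrite !inE andbC; case oO : (o \in O); rewrite ?andbF ?andbT //.
  congr (~~ _); apply/eqP/imsetP => [e|[s sE e]].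
    by exists (eta o) => //; apply: imset_f.
  by have := repP s sE; rewrite -e inE => /andP[_ /eqP ->].
have ES : E \subset S by apply/subsetP => _ /imsetP [o oO ->]; apply: etaS.
have [be [bei bej]] : exists f : 'I_n -> 'I_n, {in O' &, injective f} /\ f @: O' = S :\: E.
  apply: card_eq_bij; rewrite O'E !cardsD.
  have rO : rep @: E \subset O.
    by apply/subsetP => _ /imsetP [s sE ->]; have := repP s sE; rewrite inE => /andP[].
  by rewrite (setIidPr ES) (setIidPr rO) cE Sk Ok.
have beS o : o \in O' -> be o \in S :\: E by move=> h; rewrite -bej imset_f.
have BO' s o : s \in E -> o \in Bs s :\ rep s -> o \in O'.
  move=> sE; rewrite !inE => /andP[h /andP[-> /eqP ->]]; by rewrite h.
have grp s : s \in E -> - (#|Bs s|%:R * x) <= \sum_(o in Bs s) al o +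
    (1 + p%:R^-1) * (ga s + \sum_(o in Bs s :\ rep s) ga (be o)).
  move=> sE; have sS := subsetP ES s sE.
  have pV : 0 <= p%:R^-1 :> rat by rewrite invr_ge0 ler0n.
  have G0 : 0 <= \sum_(o in Bs s :\ rep s) ga (be o) by apply: sumr_ge0.
  have cB : #|Bs s| = (#|Bs s :\ rep s|.+1)%N by rewrite (cardsD1 (rep s)) repP.
  have Binj : {in Bs s :\ rep s &, injective be}.
    by move=> o o' h h'; apply: bei; apply: (BO' s).
  (* A small preimage is opened in one exchange that closes [s] and the partners of the other
     elements. *)
  have [small|large] := leqP #|Bs s| p.
    have sZ : s \notin be @: (Bs s :\ rep s).
      by apply/negP => /imsetP [o /(BO' _ _ sE) /beS h e]; rewrite -e inE sE in h.
    have cA : #|s |: be @: (Bs s :\ rep s)| = #|Bs s|.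
      by rewrite cardsU1 sZ card_in_imset // cB.
    have := swp (s |: be @: (Bs s :\ rep s)) (Bs s); rewrite cA => sw1.
    have h1 : - x <= \sum_(o in Bs s) al o + \sum_(t in s |: be @: (Bs s :\ rep s)) ga t.
      apply: sw1 => //.
      - rewrite subUset sub1set sS /=; apply/subsetP => _ /imsetP [o /(BO' _ _ sE) /beS h ->].
        by move: h; rewrite inE => /andP[].
      - by apply/subsetP => o; rewrite inE => /andP[].
      - move=> o oO; rewrite !inE => /orP[->|]; first by rewrite oO.
        move=> /imsetP [o' /(BO' _ _ sE) /beS h e].
        by move: h; rewrite -e inE imset_f.
    rewrite big_setU1 //= big_imset //= in h1.
    have bx : x <= #|Bs s|%:R * x.
      by rewrite ler_peMl ?x0 // ler1n cB.
    have := mulr_ge0 pV (addr_ge0 (ga0 s) G0).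
    lra.
  (* A large preimage is handled by single exchanges that never close [s]. *)
  have pair o o' : o \in Bs s -> o' \in Bs s :\ rep s -> - x <= al o + ga (be o').
    move=> oB /(BO' _ _ sE) /beS; rewrite inE => /andP[o'E o'S].
    have := swp [set be o'] [set o]; rewrite !cards1 !big_set1; apply=> //.
    - by rewrite sub1set.
    - by rewrite sub1set; move: oB; rewrite inE => /andP[].
    - move=> v vO /set1P e.
      by move: o'E; rewrite -e imset_f.
  set m := #|Bs s :\ rep s| in cB *.
  have m0 : p%:R <= m%:R :> rat by rewrite ler_nat -ltnS -cB.
  have p0' : 0 < p%:R :> rat by rewrite ltr0n.
  have mp : 0 < m%:R :> rat by apply: lt_le_trans m0.
  (* All [(m + 1) * m] pairs are summed; after division by [m], each [o] has weight one and each
     partner [(m + 1) / m], at most [1 + 1/p] because [m >= p]. *)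
  have tot : - (#|Bs s|%:R * m%:R * x) <= m%:R * \sum_(o in Bs s) al o
      + #|Bs s|%:R * \sum_(o in Bs s :\ rep s) ga (be o).
    have : \sum_(o in Bs s) \sum_(o' in Bs s :\ rep s) (- x) <=
       \sum_(o in Bs s) \sum_(o' in Bs s :\ rep s) (al o + ga (be o')).
      by apply: ler_sum => o oB; apply: ler_sum => o' oB'; apply: pair.
    under [X in _ <= X]eq_bigr do rewrite big_split /= sumr_const.
    rewrite big_split /= !sumr_const -/m sumrMnl.
    rewrite -[_ *+ #|_|]mulr_natl -[_ *+ m]mulr_natl -[in leRHS]mulr_natl.
    rewrite -[X in _ + X]mulr_natl.
    by rewrite !mulrN mulrA.
  set AL := \sum_(o in Bs s) al o in tot *.
  set G := \sum_(o in Bs s :\ rep s) _ in tot G0 *.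
  have b1 : #|Bs s|%:R = m%:R + 1 :> rat by rewrite cB -addn1 natrD.
  rewrite b1 in tot *.
  have : - ((m%:R + 1) * x) <= AL + (1 + m%:R^-1) * G.
    rewrite -(ler_pM2l mp); apply: le_trans (_ : m%:R * AL + (m%:R + 1) * G <= _).
      by apply: le_trans tot; lra.
    rewrite mulrDr lerD2l mulrA mulrDr mulr1 mulfV ?gt_eqF //.
  have iv : m%:R^-1 <= p%:R^-1 :> rat by rewrite lef_pV2 ?posrE.
  have := ler_wpM2r G0 iv; have := mulr_ge0 pV (ga0 s); have := ga0 s; lra.
have cSsum : \sum_(s in E) #|Bs s|%:R = k%:R :> rat.
  rewrite -natr_sum -Ok -sum1_card; congr (_%:R).
  rewrite [RHS](partition_big eta (mem E)) /=; last first.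
    by move=> o oO; apply: imset_f.
  apply: eq_bigr => s _; rewrite -sum1_card; apply: eq_bigl => o.
  by rewrite inE.
have : \sum_(s in E) - (#|Bs s|%:R * x) <= \sum_(s in E) (\sum_(o in Bs s) al o +
    (1 + p%:R^-1) * (ga s + \sum_(o in Bs s :\ rep s) ga (be o))).
  by apply: ler_sum => s; apply: grp.
rewrite sumrN -mulr_suml cSsum big_split /= -mulr_sumr.
have -> : \sum_(s in E) \sum_(o in Bs s) al o = cO - cS.
  rewrite -sal [RHS](partition_big eta (mem E)) /=; last first.
    by move=> o oO; apply: imset_f.
  by apply: eq_bigr => s _; apply: eq_bigl => o; rewrite inE.
have -> : \sum_(s in E) (ga s + \sum_(o in Bs s :\ rep s) ga (be o)) = \sum_(s in S) ga s.
  rewrite big_split /= [RHS](big_setID E) /= (setIidPr ES) -bej.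
  rewrite [X in _ = _ + X]big_imset //=.
  congr (_ + _); rewrite [RHS](partition_big eta (mem E)) /=; last first.
    by move=> o; rewrite /O' inE => /andP[oO _]; apply: imset_f.
  apply: eq_bigr => s sE; apply: eq_bigl => o; rewrite /O' !inE.
  case: (eqVneq (eta o) s) => [->|]; rewrite ?andbF ?andbT //; exact: andbC.
have pV : 0 <= p%:R^-1 :> rat by rewrite invr_ge0 ler0n.
have := ler_wpM2l pV sga; rewrite /x; lra.
Qed.
End Locality.

(** * A while language and its compilation to the RAM *)

Inductive aexp :=
  | Cst of int | Var of nat | Plus of aexp & aexp | Minus of aexp & aexp
  | Get of nat & aexp.

Inductive cmd :=
  | Skip | Asn of nat & aexp | Put of nat & aexp & aexp | Seq of cmd & cmd
  | If of aexp & cmd & cmd | While of aexp & cmd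
  | In of nat & nat | Out of nat & nat.

(* [low] is the part of the RAM memory that still holds the input and will
   receive the output; it is only reached through [In] and [Out]. *)
Record store := Store {
  var : nat -> int; arr : nat -> nat -> int; low : nat -> int }.

Definition setv s x v :=
  Store (fun y => if eqn y x then v else var s y) (arr s) (low s).
Definition seta s a i v :=
  Store (var s) (fun b j => if eqn b a && (j == i) then v else arr s b j) (low s).
Definition setl s i v :=
  Store (var s) (arr s) (fun j => if j == i then v else low s j).

Fixpoint eval s e : int :=
  match e with
  | Cst c => c
  | Var x => var s x
  | Plus e1 e2 => eval s e1 + eval s e2
  | Minus e1 e2 => eval s e1 - eval s e2
  | Get a e => arr s a `|eval s e|%N
  end.

(** Time counts commands and loop tests; the evaluation of expressions is covered by a constant
    factor at compilation. [In] and [Out] are confined to [[lo, hi)], away from the registers of the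
    compiled program and from its heap. *)
Inductive exec (lo hi : nat) : cmd -> store -> nat -> store -> Prop :=
| XSkip s : exec lo hi Skip s 1 s
| XAsn x e s : exec lo hi (Asn x e) s 1 (setv s x (eval s e))
| XPut a e1 e2 s :
    exec lo hi (Put a e1 e2) s 1 (seta s a `|eval s e1|%N (eval s e2))
| XSeq c1 c2 s1 s2 s3 t1 t2 : exec lo hi c1 s1 t1 s2 -> exec lo hi c2 s2 t2 s3 ->
    exec lo hi (Seq c1 c2) s1 (t1 + t2) s3
| XIf e c1 c2 s t s' : exec lo hi (if 0 < eval s e then c1 else c2) s t s' ->
    exec lo hi (If e c1 c2) s t.+1 s'
| XWhileF e c s : ~~ (0 < eval s e) -> exec lo hi (While e c) s 1 s
| XWhileT e c s1 s2 s3 t1 t2 : 0 < eval s1 e -> exec lo hi c s1 t1 s2 ->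
    exec lo hi (While e c) s2 t2 s3 -> exec lo hi (While e c) s1 (t1 + t2).+1 s3
| XIn x y s : (lo <= `|var s y| < hi)%N ->
    exec lo hi (In x y) s 1 (setv s x (low s `|var s y|%N))
| XOut y x s : (lo <= `|var s y| < hi)%N ->
    exec lo hi (Out y x) s 1 (setl s `|var s y|%N (var s x)).

(** [ram_run] yields [None] when its fuel runs out, so its partial runs do not compose; runs with an
    exact step count do. *)
Fixpoint steps (P : seq instr) (j : nat) (s : ram_state) : option ram_state :=
  if j is j'.+1 then obind (steps P j') (ram_step P s) else Some s.

Lemma steps_add P i j s : steps P (i + j) s = obind (steps P j) (steps P i s).
Proof. by elim: i s => //= i IH s; case: ram_step => //= s'. Qed.

Lemma steps_trans P i j s1 s2 s3 : steps P i s1 = Some s2 ->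
  steps P j s2 = Some s3 -> steps P (i + j) s1 = Some s3.
Proof. by rewrite steps_add => -> /=. Qed.

Lemma steps1 P s s' : ram_step P s = Some s' -> steps P 1 s = Some s'.
Proof. by move=> /= ->. Qed.

Lemma steps_run P j t s s' : steps P j s = Some s' -> ram_step P s' = None ->
  (j <= t)%N -> ram_run P t s = Some s'.
Proof.
elim: j t s => [|j IH] t s /=; first by move=> [->] h _; case: t => [|t] /=; rewrite h.
case E: ram_step => [s1|] //= h1 h2; case: t => // t jt /=; rewrite E; exact: IH.
Qed.

Definition code_at (P : seq instr) o c :=
  forall i, (i < size c)%N -> nth IHalt P (o + i) = nth IHalt c i.

Lemma code_at_cat P o c1 c2 : code_at P o (c1 ++ c2) <->
  code_at P o c1 /\ code_at P (o + size c1) c2.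
Proof.
split=> [h|[h1 h2] i].
  split=> i ic.
    by rewrite h ?size_cat ?ltn_addr // nth_cat ic.
  by rewrite -addnA h ?size_cat ?ltn_add2l // nth_cat ltnNge leq_addr /= addKn.
rewrite size_cat nth_cat; case: (ltnP i (size c1)) => [ic _|ci ic]; first exact: h1.
have := h2 (i - size c1)%N; rewrite -addnA subnKC // => -> //.
by rewrite ltn_subLR.
Qed.

Lemma code_at_cons P o i c : code_at P o (i :: c) <->
  nth IHalt P o = i /\ code_at P o.+1 c.
Proof.
split=> [h|[h1 h2] [|j] jc].
- split; first by have := h 0%N; rewrite addn0; apply.
  by move=> j jc; rewrite addSnnS h.
- by rewrite addn0.
- by rewrite -addSnnS h2.
Qed.

Lemma updE m i v : upd m i v i = v. Proof. by rewrite /upd eqxx. Qed.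
Lemma updN m i v j : j != i -> upd m i v j = m j.
Proof. by rewrite /upd => /negPf ->. Qed.

Section Compile.
(* Variables live in registers below [V], register [V] holds the heap base
   [H], temporaries are in [V.+1, lo), and cell [i] of array [a < 2 ^ 4] is at
   address [H + (i * 2 ^ 4 + a)]. *)
Variables (V : nat).

Fixpoint esize e : nat :=
  match e with
  | Cst _ | Var _ => 1
  | Plus e1 e2 | Minus e1 e2 => (esize e1 + esize e2).+1
  | Get _ e => (esize e).+1
  end.

Fixpoint csz e : nat :=
  match e with
  | Cst _ => 1
  | Var _ => 2
  | Plus e1 e2 | Minus e1 e2 => csz e1 + (csz e2 + 1)
  | Get _ e => csz e + (10 + 1)
  end.

(** Indices are taken in absolute value, so a value that is not positive is negated first; four
    doublings multiply by 16. Interleaving the sixteen arrays lets each of them grow without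
    bound. *)
Definition caddr o t a : seq instr :=
  [:: IJpos t (o + 3); IConst t.+1 0; ISub t t.+1 t; IAdd t t t; IAdd t t t;
      IAdd t t t; IAdd t t t; IConst t.+1 a%:Z; IAdd t t t.+1; IAdd t t V].

Arguments caddr : simpl never.

Fixpoint cexp o t e : seq instr :=
  match e with
  | Cst c => [:: IConst t c]
  | Var x => [:: IConst t 0; IAdd t t x]
  | Plus e1 e2 => cexp o t e1 ++ cexp (o + csz e1) t.+1 e2 ++ [:: IAdd t t t.+1]
  | Minus e1 e2 => cexp o t e1 ++ cexp (o + csz e1) t.+1 e2 ++ [:: ISub t t t.+1]
  | Get a e => cexp o t e ++ caddr (o + csz e) t a ++ [:: ILoad t t]
  end.

Lemma size_cexp o t e : size (cexp o t e) = csz e.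
Proof.
elim: e o t => //= [e1 IH1 e2 IH2|e1 IH1 e2 IH2|a e IH] o t;
  by rewrite !size_cat ?IH1 ?IH2 ?IH.
Qed.

Lemma csz_le e : (csz e <= 11 * esize e)%N.
Proof. elim: e => //=; lia. Qed.

Lemma esize_gt0 e : (0 < esize e)%N. Proof. by case: e. Qed.

Fixpoint ewf e : bool :=
  match e with
  | Cst _ => true
  | Var x => (x < V)%N
  | Plus e1 e2 | Minus e1 e2 => ewf e1 && ewf e2
  | Get a e => (a < 16)%N && ewf e
  end.

Variables (lo H : nat).

Definition sim s (m : nat -> int) :=
  [/\ forall x, (x < V)%N -> m x = var s x,
      m V = H%:Z,
      forall a i, (a < 16)%N -> m (H + (i * 16 + a))%N = arr s a i &
      forall x, (lo <= x < H)%N -> m x = low s x].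

Definition agree t (m m' : nat -> int) :=
  forall x, (x < t)%N || (lo <= x)%N -> m' x = m x.

Lemma agree_refl t m : agree t m m. Proof. by []. Qed.

Lemma agree_trans t t' m1 m2 m3 : (t <= t')%N ->
  agree t m1 m2 -> agree t' m2 m3 -> agree t m1 m3.
Proof. by move=> tt h1 h2 x hx; rewrite h2 ?h1 //; lia. Qed.

Lemma agree_upd t m m' i v : (t <= i < lo)%N -> agree t m m' ->
  agree t m (upd m' i v).
Proof. by move=> hi h x hx; rewrite updN ?h //; lia. Qed.

Hypothesis loH : (lo <= H)%N.
Hypothesis Vlo : (V < lo)%N.

Lemma sim_agree s t m m' : (V < t)%N -> sim s m -> agree t m m' -> sim s m'.
Proof.
move=> Vt [h1 h2 h3 h4] h; split.
- by move=> x xV; rewrite h ?h1 //; lia.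
- by rewrite h //; lia.
- by move=> a i aW; rewrite h ?h3 //; lia.
- by move=> x hx; rewrite h ?h4 //; lia.
Qed.

Lemma caddr_ok P o t a m z : (V < t)%N -> (t.+1 < lo)%N -> m V = H%:Z -> m t = z ->
  code_at P o (caddr o t a) -> exists j m',
  [/\ steps P j (o, m) = Some ((o + 10)%N, m'), (j <= 10)%N,
      m' t = (H + (`|z| * 16 + a))%N%:Z & agree t m m'].
Proof.
move=> Vt tlo mV mt; rewrite /caddr !code_at_cons.
move=> [i0 [i1 [i2 [i3 [i4 [i5 [i6 [i7 [i8 [i9 _]]]]]]]]]].
have tt : t.+1 != t by lia.
have tV : (V != t) && (V != t.+1) by lia.
have [m1 [j1 [s1 j1l m1t m1V ag1]]] : exists m1 j1,
  [/\ steps P j1 (o, m) = Some ((o + 3)%N, m1), (j1 <= 3)%N, m1 t = `|z|%N%:Z, m1 V = H%:Z & agree t m m1].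
  have [zp|zn] := boolP (0 < z).
    exists m, 1; split=> //; last by rewrite mt; lia.
    by apply: steps1; rewrite /ram_step i0 mt zp.
  exists (upd (upd m t.+1 0) t (0 - z)), 3; split=> //.
  - rewrite /= i0 mt (negPf zn) /= i1 /= i2 /= !updE.
    by rewrite updN 1?eq_sym // mt addn3.
  - by rewrite updE; lia.
  - by move: tV => /andP[? ?]; rewrite !updN.
  - by do !apply: agree_upd; [lia|lia|].
have [m2 [s2 m2t m2V ag2]] : exists m2,
  [/\ steps P 4 (o.+3, m1) = Some ((o + 7)%N, m2), m2 t = (`|z| * 16)%N%:Z,  m2 V = H%:Z & agree t m m2].
  pose v1 := m1 t + m1 t; pose v2 := v1 + v1; pose v3 := v2 + v2.
  exists (upd (upd (upd (upd m1 t v1) t v2) t v3) t (v3 + v3)); split.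
  - have -> : (o + 7 = o.+3.+4)%N by lia.
    by rewrite /= i3 /= i4 /= i5 /= i6 /= !updE.
  - by rewrite updE /v3 /v2 /v1 m1t; lia.
  - by move: tV => /andP[? ?]; rewrite !updN.
  - by do 4!(apply: agree_upd; first lia).
exists (j1 + (4 + 3))%N, (upd (upd (upd m2 t.+1 a%:Z) t (m2 t + a%:Z)) t (m2 t + a%:Z + H%:Z)).
split.
- apply: steps_trans s1 _; rewrite (addn3 o); apply: steps_trans s2 _.
  have -> : (o + 7 = o.+3.+4)%N by lia.
  rewrite /= i7 /= i8 /= i9 /= !updE.
  move: tV => /andP[tV1 tV2]; rewrite !(updN _ _ tV1) !(updN _ _ tV2) m2V.
  rewrite (updN _ _ (_ : t != t.+1)) ?updE; last by lia.
  by congr (Some (_, _)); lia.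
- lia.
- by rewrite updE m2t; lia.
- by do 3!(apply: agree_upd; first lia).
Qed.

(** The temporaries from [t] on form a stack: a second operand is computed at [t.+1], and [agree]
    keeps the first one in place. The stack depth is at most [esize e], hence the room required
    below [lo]. *)
Lemma cexp_ok P s e : forall o t m, (V < t)%N -> (t + esize e < lo)%N -> ewf e ->
  sim s m -> code_at P o (cexp o t e) -> exists j m',
  [/\ steps P j (o, m) = Some ((o + csz e)%N, m'), (j <= csz e)%N,
      m' t = eval s e & agree t m m'].
Proof.
elim: e => [c|x|e1 IH1 e2 IH2|e1 IH1 e2 IH2|a e IH] o t m Vt tlo /=.
- move=> _ sm /code_at_cons [i0 _]; exists 1, (upd m t c); split=> //.
  + by apply: steps1; rewrite /ram_step i0 addn1.
  + by rewrite updE.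
  + by apply: agree_upd => //; move: tlo => /=; lia.
- move=> xV [h1 _ _ _] /code_at_cons [i0 /code_at_cons [i1 _]].
  exists 2, (upd (upd m t 0) t (m x)); split=> //.
  + rewrite /= i0 /= i1 /= updE add0r addn2 updN //; lia.
  + by rewrite updE h1.
  + by do 2!(apply: agree_upd; first by move: tlo => /=; lia).
- move=> /andP[w1 w2] sm; rewrite !code_at_cat !size_cexp code_at_cons.
  move=> [c1 [c2 [i0 _]]]; have := esize_gt0 e2; move: tlo => /= tlo es.
  have t0 : (t + esize e1 < lo)%N by lia.
  have [j1 [m1 [s1 j1l m1t ag1]]] := IH1 o t m Vt t0 w1 sm c1.
  have t1 : (t.+1 + esize e2 < lo)%N by lia.
  have [j2 [m2 [s2 j2l m2t ag2]]] :=
    IH2 (o + csz e1)%N t.+1 m1 (ltnW Vt) t1 w2 (sim_agree Vt sm ag1) c2.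
  exists (j1 + (j2 + 1))%N, (upd m2 t (eval s e1 + eval s e2)); split.
  + apply: steps_trans s1 _; apply: steps_trans s2 _; apply: steps1.
    by rewrite /ram_step i0 m2t ag2 ?m1t ?ltnSn // !addnA addn1.
  + lia.
  + by rewrite updE.
  + by apply: agree_upd; [lia|apply: agree_trans ag1 ag2].
- move=> /andP[w1 w2] sm; rewrite !code_at_cat !size_cexp code_at_cons.
  move=> [c1 [c2 [i0 _]]]; have := esize_gt0 e2; move: tlo => /= tlo es.
  have t0 : (t + esize e1 < lo)%N by lia.
  have [j1 [m1 [s1 j1l m1t ag1]]] := IH1 o t m Vt t0 w1 sm c1.
  have t1 : (t.+1 + esize e2 < lo)%N by lia.
  have [j2 [m2 [s2 j2l m2t ag2]]] :=
    IH2 (o + csz e1)%N t.+1 m1 (ltnW Vt) t1 w2 (sim_agree Vt sm ag1) c2.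
  exists (j1 + (j2 + 1))%N, (upd m2 t (eval s e1 - eval s e2)); split.
  + apply: steps_trans s1 _; apply: steps_trans s2 _; apply: steps1.
    by rewrite /ram_step i0 m2t ag2 ?m1t ?ltnSn // !addnA addn1.
  + lia.
  + by rewrite updE.
  + by apply: agree_upd; [lia|apply: agree_trans ag1 ag2].
- rewrite -[X in code_at _ _ (_ ++ X)]/(caddr (o + csz e) t a ++ [:: ILoad t t]).
  move=> /andP[aW w] sm /code_at_cat [c1 /code_at_cat [c2 /code_at_cons [i0 _]]].
  rewrite !size_cexp in c2 i0; have := esize_gt0 e; move: tlo => /= tlo es.
  have t0 : (t + esize e < lo)%N by lia.
  have [j1 [m1 [s1 j1l m1t ag1]]] := IH o t m Vt t0 w sm c1.
  have sm1 := sim_agree Vt sm ag1.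
  have t1 : (t.+1 < lo)%N by lia.
  have m1V : m1 V = H%:Z by have [_ ? _ _] := sm1.
  have [j2 [m2 [s2 j2l m2t ag2]]] := caddr_ok Vt t1 m1V m1t c2.
  exists (j1 + (j2 + 1))%N, (upd m2 t (arr s a `|eval s e|%N)); split.
  + apply: steps_trans s1 _; apply: steps_trans s2 _; apply: steps1.
    have [_ _ h3 _] := sim_agree Vt sm1 ag2.
    have {}i0 : nth IHalt P (o + csz e + 10) = ILoad t t := i0.
    by rewrite /ram_step i0 m2t absz_nat h3 //; congr (Some (_, _)); lia.
  + lia.
  + by rewrite updE.
  + by apply: agree_upd; [lia|apply: agree_trans ag1 ag2].
Qed.
End Compile.

Section CompileCmd.
Variables (V : nat).

Fixpoint cmdsz c : nat :=
  match c with
  | Skip => 0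
  | Asn _ e => csz e + 2
  | Put _ e1 e2 => csz e1 + (10 + (csz e2 + 1))
  | Seq c1 c2 => cmdsz c1 + cmdsz c2
  | If e c1 c2 => csz e + (1 + (cmdsz c2 + (2 + cmdsz c1)))
  | While e c => csz e + (3 + (cmdsz c + 2))
  | In _ _ | Out _ _ => 1
  end.

(** Jump targets are absolute, so code is generated for a known offset and relies on the exact sizes
    [cmdsz]. An unconditional jump is the constant 1 followed by [IJpos]; the else branch comes
    first because a failed test falls through. *)
Fixpoint ccmd o c : seq instr :=
  let t := V.+1 in
  match c with
  | Skip => [::]
  | Asn x e => cexp V o t e ++ [:: IConst t.+1 0; IAdd x t t.+1]
  | Put a e1 e2 => cexp V o t e1 ++ caddr V (o + csz e1) t a ++
      cexp V (o + csz e1 + 10) t.+1 e2 ++ [:: IStore t t.+1]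
  | Seq c1 c2 => ccmd o c1 ++ ccmd (o + cmdsz c1) c2
  | If e c1 c2 =>
      cexp V o t e ++ [:: IJpos t (o + csz e + 1 + cmdsz c2 + 2)] ++
      ccmd (o + csz e + 1) c2 ++
      [:: IConst t 1; IJpos t (o + csz e + 1 + cmdsz c2 + 2 + cmdsz c1)] ++
      ccmd (o + csz e + 1 + cmdsz c2 + 2) c1
  | While e c =>
      cexp V o t e ++ [:: IJpos t (o + csz e + 3); IConst t 1;
         IJpos t (o + csz e + 3 + cmdsz c + 2)] ++
      ccmd (o + csz e + 3) c ++ [:: IConst t 1; IJpos t o]
  | In x y => [:: ILoad x y]
  | Out y x => [:: IStore y x]
  end.
Arguments caddr : simpl never.

Lemma size_ccmd o c : size (ccmd o c) = cmdsz c.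
Proof.
elim: c o => //= [x e|a e1 e2|c1 IH1 c2 IH2|e c1 IH1 c2 IH2|e c IH] o;
  by rewrite !size_cat /= ?size_cat /= ?size_cexp ?IH1 ?size_cat /= ?IH2 ?IH.
Qed.

Fixpoint cwf D c : bool :=
  let ok e := ewf V e && (esize e <= D)%N in
  match c with
  | Skip => true
  | Asn x e => (x < V)%N && ok e
  | Put a e1 e2 => [&& (a < 16)%N, ok e1 & ok e2]
  | Seq c1 c2 => cwf D c1 && cwf D c2
  | If e c1 c2 => [&& ok e, cwf D c1 & cwf D c2]
  | While e c => ok e && cwf D c
  | In x y | Out y x => (x < V)%N && (y < V)%N
  end.

Variables (D lo H : nat).
Hypothesis loH : (lo <= H)%N.
Hypothesis Dlo : (V.+2 + D < lo)%N.

Local Notation sim := (sim V lo H).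
Local Notation agree := (agree lo).

Lemma sim_setv s m x v : (x < V)%N -> sim s m -> sim (setv s x v) (upd m x v).
Proof.
move=> xV [h1 h2 h3 h4]; split=> /=.
- move=> y yV; rewrite /upd; have [->|ne] := eqVneq y x; first by rewrite eqnE eqxx.
  by rewrite eqnE (negPf ne) h1.
- by rewrite updN ?h2 //; lia.
- by move=> a i aW; rewrite updN ?h3 //; lia.
- by move=> y hy; rewrite updN ?h4 //; lia.
Qed.

Lemma sim_seta s m a i v : (a < 16)%N -> sim s m ->
  sim (seta s a i v) (upd m (H + (i * 16 + a))%N v).
Proof.
move=> aW [h1 h2 h3 h4]; split=> /=.
- by move=> y yV; rewrite updN ?h1 //; lia.
- by rewrite updN ?h2 //; lia.
- move=> b j bW; have [e|ne] := boolP (eqn b a && (j == i)).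
    by move: e; rewrite eqnE => /andP[/eqP -> /eqP ->]; rewrite updE.
  rewrite updN ?h3 //; apply: contra ne => /eqP h.
  by rewrite eqnE; apply/andP; split; apply/eqP; lia.
- by move=> y hy; rewrite updN ?h4 //; lia.
Qed.

Lemma sim_setl s m i v : (lo <= i < H)%N -> sim s m ->
  sim (setl s i v) (upd m i v).
Proof.
move=> hi [h1 h2 h3 h4]; split=> /=.
- by move=> y yV; rewrite updN ?h1 //; lia.
- by rewrite updN ?h2 //; lia.
- by move=> b j bW; rewrite updN ?h3 //; lia.
- by move=> y hy; rewrite /upd; case: eqP => // _; apply: h4.
Qed.

Lemma cexp_cmd P s e o m : ewf V e && (esize e <= D)%N -> sim s m ->
  code_at P o (cexp V o V.+1 e) -> exists j m',
  [/\ steps P j (o, m) = Some ((o + csz e)%N, m'), (j <= 11 * D)%N,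
      m' V.+1 = eval s e, sim s m' & agree V.+1 m m'].
Proof.
move=> /andP[w sz] sm c; have Vlo : (V < lo)%N by lia.
have t0 : (V.+1 + esize e < lo)%N by lia.
have [j [m' [s1 jl mt ag]]] := cexp_ok loH Vlo (ltnSn V) t0 w sm c.
exists j, m'; split=> //; last exact: (sim_agree loH Vlo (ltnSn V) sm ag).
by apply: leq_trans jl _; apply: leq_trans (csz_le e) _; rewrite leq_mul2l sz.
Qed.

Lemma jump_ok P o t l m : nth IHalt P o = IConst t 1 -> nth IHalt P o.+1 = IJpos t l ->
  steps P 2 (o, m) = Some (l, upd m t 1).
Proof. by move=> i0 i1; rewrite /= i0 /= i1 /= updE. Qed.

Lemma sim_tmp s m v : sim s m -> sim s (upd m V.+1 v).
Proof.
move=> sm; have Vlo : (V < lo)%N by lia.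
apply: (sim_agree loH Vlo (ltnSn V) sm (m' := upd m V.+1 v)).
by apply: agree_upd; [lia|exact: agree_refl].
Qed.

(** The worst command is [Put]: two expressions of at most [11 * D] instructions each, an address
    computation and a store. *)
Definition kappa := (22 * D + 20)%N.

(** The induction is on the execution and not on the command, because a further loop iteration
    re-enters the same code at the same offset. *)
Lemma ccmd_ok P c s k s' : exec lo H c s k s' -> forall o m, cwf D c ->
  sim s m -> code_at P o (ccmd o c) -> exists j m',
  [/\ steps P j (o, m) = Some ((o + cmdsz c)%N, m'), (j <= kappa * k)%N & sim s' m'].
Proof.
have Vlo : (V < lo)%N by lia.
elim=> {c s k s'}.
- by move=> s o m _ sm _; exists 0, m; rewrite addn0.
- move=> x e s o m /andP[xV w] sm /code_at_cat [c1 /code_at_cons [i0 /code_at_cons [i1 _]]].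
  have [j [m1 [s1 jl mt sm1 _]]] := cexp_cmd w sm c1.
  rewrite size_cexp in i0 i1.
  exists (j + 2)%N, (upd (upd m1 V.+2 0) x (eval s e)); split.
  + apply: steps_trans s1 _; rewrite /= i0 /= i1 /= updE updN; last by lia.
    by rewrite mt addr0; congr (Some (_, _)); lia.
  + rewrite /kappa; lia.
  + apply: sim_setv => //; apply: (sim_agree loH Vlo (ltnSn V) sm1 (m' := upd m1 V.+2 0)).
    by apply: agree_upd; [lia|exact: agree_refl].
- move=> a e1 e2 s o m /and3P[aW w1 w2] sm /code_at_cat [c1 /code_at_cat [c2 /code_at_cat [c3 /code_at_cons [i0 _]]]].
  rewrite !size_cexp in c2 c3 i0.
  have {}c3 : code_at P (o + csz e1 + 10) (cexp V (o + csz e1 + 10) V.+2 e2) := c3.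
  have {}i0 : nth IHalt P (o + csz e1 + 10 + csz e2) = IStore V.+1 V.+2 := i0.
  have [j [m1 [s1 jl mt sm1 _]]] := cexp_cmd w1 sm c1.
  have m1V : m1 V = H%:Z by have [_ ? _ _] := sm1.
  have t2 : (V.+2 < lo)%N by lia.
  have [j2 [m2 [s2 j2l m2t ag2]]] := caddr_ok loH Vlo (ltnSn V) t2 m1V mt c2.
  have sm2 := sim_agree loH Vlo (ltnSn V) sm1 ag2.
  have /andP[w3 w4] := w2.
  have t3 : (V.+2 + esize e2 < lo)%N by lia.
  have [j3 [m3 [s3 j3l m3t ag3]]] := cexp_ok loH Vlo (ltnW (ltnSn V.+1)) t3 w3 sm2 c3.
  have sm3 := sim_agree loH Vlo (ltnW (ltnSn V.+1)) sm2 ag3.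
  exists (j + (j2 + (j3 + 1)))%N, (upd m3 (H + (`|eval s e1| * 16 + a))%N (eval s e2)); split.
  + apply: steps_trans s1 _; apply: steps_trans s2 _; apply: steps_trans s3 _.
    apply: steps1; rewrite /ram_step i0 m3t ag3 ?ltnSn // m2t absz_nat.
    by congr (Some (_, _)); rewrite /=; lia.
  + have := csz_le e2; rewrite /kappa; nia.
  + exact: sim_seta.
- move=> c1 c2 s1 s2 s3 t1 t2 _ IH1 _ IH2 o m /andP[w1 w2] sm /code_at_cat [p1 p2].
  rewrite size_ccmd in p2.
  have [j1 [m1 [st1 jl1 sm1]]] := IH1 o m w1 sm p1.
  have [j2 [m2 [st2 jl2 sm2]]] := IH2 _ m1 w2 sm1 p2.
  exists (j1 + j2)%N, m2; split=> //.
  + by apply: steps_trans st1 _; rewrite st2 /= addnA.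
  + by rewrite mulnDr leq_add.
- move=> e c1 c2 s t s' _ IH o m /and3P[w w1 w2] sm.
  move=> /code_at_cat [p0 /code_at_cat [/code_at_cons [i0 _] /code_at_cat
    [p2 /code_at_cat [/code_at_cons [i1 /code_at_cons [i2 _]] p1]]]].
  rewrite !size_cexp !size_ccmd /= in i0 i1 i2 p1 p2.
  have [j [m1 [s1 jl mt sm1 _]]] := cexp_cmd w sm p0.
  case: ifP IH => ev IH.
    have [j2 [m2 [st2 jl2 sm2]]] := IH _ m1 w1 sm1 p1.
    exists (j + (1 + j2))%N, m2; split=> //.
    + apply: steps_trans s1 _; apply: steps_trans (steps1 _) _.
        by rewrite /ram_step i0 mt ev.
      by rewrite st2 /=; congr (Some (_, _)); lia.
    + rewrite /kappa in jl2 *; lia.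
  have [j2 [m2 [st2 jl2 sm2]]] := IH _ m1 w2 sm1 p2.
  exists (j + (1 + (j2 + 2)))%N, (upd m2 V.+1 1); split.
  + apply: steps_trans s1 _; apply: steps_trans (steps1 _) _.
      by rewrite /ram_step i0 mt ev.
    rewrite -(addn1 (o + csz e)); apply: steps_trans st2 _.
    rewrite (jump_ok _ i1 i2) /=; congr (Some (_, _)); lia.
  + rewrite /kappa in jl2 *; lia.
  + exact: sim_tmp.
- move=> e c s ev o m /andP[w w1] sm.
  move=> /code_at_cat [p0 /code_at_cat [/code_at_cons [i0 /code_at_cons [i1 /code_at_cons [i2 _]]] _]].
  rewrite !size_cexp in i0 i1 i2.
  have [j [m1 [s1 jl mt sm1 _]]] := cexp_cmd w sm p0.
  exists (j + (1 + 2))%N, (upd m1 V.+1 1); split.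
  + apply: steps_trans s1 _; apply: steps_trans (steps1 _) _.
      by rewrite /ram_step i0 mt (negPf ev).
    rewrite (jump_ok _ i1 i2) /=; congr (Some (_, _)); lia.
  + rewrite /kappa; lia.
  + exact: sim_tmp.
- move=> e c s1 s2 s3 t1 t2 ev _ IH1 _ IH2 o m ww sm pp; have /andP[w w1] := ww.
  have := pp => /code_at_cat [p0 /code_at_cat [/code_at_cons [i0 _] /code_at_cat
    [p1 /code_at_cons [i1 /code_at_cons [i2 _]]]]].
  rewrite !size_cexp !size_ccmd /= in i0 i1 i2 p1.
  have [j [m1 [st1 jl mt sm1 _]]] := cexp_cmd w sm p0.
  have [j2 [m2 [st2 jl2 sm2]]] := IH1 _ m1 w1 sm1 p1.
  have [j3 [m3 [st3 jl3 sm3]]] := IH2 o (upd m2 V.+1 1) ww (sim_tmp _ sm2) pp.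
  exists (j + (1 + (j2 + (2 + j3))))%N, m3; split=> //.
  + apply: steps_trans st1 _; apply: steps_trans (steps1 _) _.
      by rewrite /ram_step i0 mt ev.
    apply: steps_trans st2 _; apply: steps_trans (jump_ok _ i1 i2) _.
    exact: st3.
  + rewrite /kappa in jl2 jl3 *; lia.
- move=> x y s hy o m /andP[xV yV] sm /code_at_cons [i0 _].
  have [h1 _ _ h4] := sm.
  exists 1, (upd m x (low s `|var s y|%N)); split.
  + by apply: steps1; rewrite /ram_step i0 (h1 _ yV) h4 //= addn1.
  + rewrite /kappa; lia.
  + exact: sim_setv.
- move=> y x s hy o m /andP[yV xV] sm /code_at_cons [i0 _].
  have [h1 _ _ h4] := sm.
  exists 1, (upd m `|var s y|%N (var s x)); split.
  + by apply: steps1; rewrite /ram_step i0 (h1 _ yV) (h1 _ xV) /= addn1.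
  + rewrite /kappa; lia.
  + exact: sim_setl.
Qed.
End CompileCmd.

(** * Loading and unloading the machine *)

Section Boot.
Variables (V lo : nat).
Hypothesis V6 : (6 < V)%N.
Hypothesis Vlo : (V < lo)%N.

(** An address beyond the [4 + 2 n ^ 2] input cells, obtained by [n] doublings; its magnitude is
    harmless at unit cost per step. *)
Definition heap n := ((lo + 64) * 2 ^ n)%N.

(* Only registers 4 and 5 (the entry d(0,0) = 0/1) are free at the start;
   register 6 is reloaded from d(1,0) = d(0,1), at address 4 + 2 n. *)
Definition boot_base : seq instr :=
  [:: IConst 6 1; IConst 4 (lo + 64)%N%:Z; IConst 5 0; IAdd 5 5 0;
      IJpos 5 6; IJpos 6 9; IAdd 4 4 4; ISub 5 5 6; IJpos 6 4;
      IAdd 5 0 0; IConst 6 4; IAdd 5 5 6; ILoad 6 5].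

(** Moves the registers below [lo] into array 0 before the compiled program overwrites them;
    register 4 holds the heap base and register 5 is the pointer. *)
Definition boot_save : seq instr :=
  flatten [seq [:: IConst 5 (16 * i)%N%:Z; IAdd 5 5 4; IStore 5 i] | i <- iota 0 lo].

Definition boot : seq instr :=
  boot_base ++ boot_save ++ [:: IConst V 0; IAdd V V 4].

Definition boot_sz := (13 + (3 * lo + 2))%N.

Lemma size_flatten_const (T : Type) (f : nat -> seq T) k a c :
  (forall i, size (f i) = c) -> size (flatten [seq f i | i <- iota a k]) = (c * k)%N.
Proof.
move=> h; elim: k a => [|k IH] a /=; first by rewrite muln0.
by rewrite size_cat h IH mulnS.
Qed.

Lemma size_boot : size boot = boot_sz.
Proof.
by rewrite /boot /boot_save !size_cat (@size_flatten_const _ _ _ _ 3).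
Qed.

Lemma boot_loop P r m b : code_at P 0 boot_base -> m 5 = r%:Z -> m 4 = b%:Z -> m 6 = 1 ->
  exists m', [/\ steps P (4 * r + 2) (4%N, m) = Some (9%N, m'),
    m' 4 = (b * 2 ^ r)%N%:Z & forall x, (x < 4)%N || (6 < x)%N -> m' x = m x].
Proof.
move=> c; have i4 : nth IHalt P 4 = IJpos 5 6 by apply: (c 4).
have i5 : nth IHalt P 5 = IJpos 6 9 by apply: (c 5).
have i6 : nth IHalt P 6 = IAdd 4 4 4 by apply: (c 6).
have i7 : nth IHalt P 7 = ISub 5 5 6 by apply: (c 7).
have i8 : nth IHalt P 8 = IJpos 6 4 by apply: (c 8).
elim: r m b => [|r IH] m b m5 m4 m6.
  exists m; rewrite muln1; split=> //.
  by rewrite /= i4 m5 /= i5 m6.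
pose m1 := upd (upd m 4 (b%:Z + b%:Z)) 5 (r.+1%:Z - 1).
have [||| m' [s1 m'4 ag]] := IH m1 (b + b)%N.
- by rewrite /m1 updE; lia.
- by rewrite /m1 updN // updE; lia.
- by rewrite /m1 !updN.
exists m'; split.
- rewrite mulnS -addnA; apply: steps_trans s1.
  rewrite /= i4 m5 /= i6 /= i7 /= i8 /= !(updN _ _ (j := 6)) // m6 /=.
  by rewrite m4 updN // m5.
- by rewrite m'4 expnS; congr (Posz _); lia.
- move=> x hx; rewrite ag // /m1 !updN //; lia.
Qed.

Lemma boot_save_ok P o k m H : (lo <= H)%N -> (k <= lo)%N -> m 4 = H%:Z ->
  code_at P o (flatten [seq [:: IConst 5 (16 * i)%N%:Z; IAdd 5 5 4; IStore 5 i] | i <- iota 0 k]) ->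
  exists m', [/\ steps P (3 * k) (o, m) = Some ((o + 3 * k)%N, m'),
    forall x, (x < H)%N -> x != 5%N -> m' x = m x &
    forall i, (i < k)%N -> i != 5%N -> m' (H + (i * 16 + 0))%N = m i].
Proof.
move=> loH; elim: k => [|k IH] klo m4.
  by move=> _; exists m; rewrite muln0 addn0; split.
rewrite -[in iota 0 k.+1]addn1 iotaD map_cat flatten_cat => /code_at_cat [c1 c2].
rewrite (@size_flatten_const _ _ _ _ 3) //= add0n in c2.
case/code_at_cons: c2 => i0 /code_at_cons [i1 /code_at_cons [i2 _]].
have [m1 [s1 low1 sv1]] := IH (ltnW klo) m4 c1.
have m14 : m1 4 = H%:Z by rewrite low1 //; lia.
pose v := (16 * k)%N%:Z + H%:Z.
have vE : `|v|%N = (H + (k * 16 + 0))%N by rewrite /v; lia.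
exists (upd (upd (upd m1 5 (16 * k)%N%:Z) 5 v) (H + (k * 16 + 0))%N
   (upd (upd m1 5 (16 * k)%N%:Z) 5 v k)); split.
- rewrite mulnSr; apply: steps_trans s1 _.
  rewrite /= i0 /= i1 /= i2 /= !updE (updN _ _ (_ : 4 != 5)%N) // m14 -/v vE.
  by congr (Some (_, _)); lia.
- by move=> x xH x5; rewrite !updN ?low1 //; lia.
- move=> i ik i5; have [ek|nk] := eqVneq i k.
    by rewrite ek updE !updN ?low1 -?ek //; lia.
  rewrite updN; last by lia.
  rewrite !updN; [|lia|lia].
  by apply: sv1 => //; lia.
Qed.

(** The initial store is whatever the memory contains, so that [sim] only asks for the heap base in
    register [V]. *)
Definition store_of H (m : nat -> int) : store :=
  Store m (fun a i => m (H + (i * 16 + a))%N) m.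

(** For [n = 1] the address [4 + 2 n] is register 6 itself, which holds the constant 4 at that
    moment; the input then ends before cell 6, so the value does no harm. *)
Lemma boot_ok P n m : (0 < n)%N -> m 0 = n%:Z -> code_at P 0 boot ->
  exists j s m', [/\ steps P j (0%N, m) = Some (boot_sz, m'),
   (j <= 4 * n + (3 * lo + 20))%N, sim V lo (heap n) s m',
   (forall i, (i < lo)%N -> i != 4%N -> i != 5%N ->
      arr s 0 i = if i == 6%N then (if n == 1%N then 4 else m (4 + 2 * n)%N) else m i) &
   forall x, (lo <= x < heap n)%N -> low s x = m x].
Proof.
move=> n0 mn; rewrite /boot => /code_at_cat [c1 /code_at_cat [c2 /code_at_cons [e0 /code_at_cons [e1 _]]]].
have loH : (lo <= heap n)%N.
  rewrite /heap; apply: (@leq_trans (lo + 64)); first exact: leq_addr.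
  by rewrite leq_pmulr // expn_gt0.
have i0 : nth IHalt P 0 = IConst 6 1 by apply: (c1 0%N).
have i1 : nth IHalt P 1 = IConst 4 (lo + 64)%N%:Z by apply: (c1 1%N).
have i2 : nth IHalt P 2 = IConst 5 0 by apply: (c1 2).
have i3 : nth IHalt P 3 = IAdd 5 5 0 by apply: (c1 3).
have i9 : nth IHalt P 9 = IAdd 5 0 0 by apply: (c1 9).
have i10 : nth IHalt P 10 = IConst 6 4 by apply: (c1 10).
have i11 : nth IHalt P 11 = IAdd 5 5 6 by apply: (c1 11).
have i12 : nth IHalt P 12 = ILoad 6 5 by apply: (c1 12).
pose m1 := upd (upd (upd (upd m 6 1) 4 (lo + 64)%N%:Z) 5 0) 5 n%:Z.
have s1 : steps P 4 (0%N, m) = Some (4%N, m1).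
  rewrite /= i0 /= i1 /= i2 /= i3 /= updE add0r.
  by rewrite !(updN _ _ (j := 0%N)) // mn.
have [m2 [s2 m24 ag2]] : exists m', [/\ steps P (4 * n + 2) (4%N, m1) = Some (9%N, m'),
    m' 4 = ((lo + 64) * 2 ^ n)%N%:Z & forall x, (x < 4)%N || (6 < x)%N -> m' x = m1 x].
  by apply: boot_loop.
pose m3 := upd (upd (upd m2 5 (n%:Z + n%:Z)) 6 4) 5 (n%:Z + n%:Z + 4).
pose m4 := upd m3 6 (m3 (4 + 2 * n)%N).
have s3 : steps P 4 (9%N, m2) = Some (13%N, m4).
  have m20 : m2 0 = n%:Z by rewrite ag2 // /m1 !updN.
  rewrite /= i9 /= i10 /= i11 /= i12 /= m20 !updE (updN _ _ (_ : 5 != 6)%N) // updE.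
  rewrite -/m3 /m4; congr (Some (_, upd m3 _ (m3 _))); lia.
have m44 : m4 4 = (heap n)%:Z by rewrite /m4 /m3 !updN.
have [m5 [s5 low5 sv5]] := boot_save_ok loH (leqnn _) m44 c2.
have m5V : m5 4 = (heap n)%:Z by rewrite low5 //; lia.
exists (4 + (4 * n + 2 + (4 + (3 * lo + 2))))%N.
pose m6 := upd (upd m5 V 0) V (heap n)%:Z.
exists (store_of (heap n) m6), m6; split.
- apply: steps_trans s1 _; apply: steps_trans s2 _; apply: steps_trans s3 _.
  apply: steps_trans s5 _.
  rewrite /boot_save (@size_flatten_const _ _ _ _ 3) // in e0 e1.
  rewrite /= e0 /= e1 /= updE add0r (updN _ _ (_ : 4%N != V)); last by lia.
  by rewrite m5V /m6; congr (Some (_, _)); rewrite /boot_sz; lia.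
- lia.
- by split=> //; rewrite /m6 updE.
- move=> i ilo i4 i5; rewrite /= /m6 !updN; try lia.
  rewrite sv5 // /m4; case: (eqVneq i 6%N) => [->|i6].
    rewrite updE; case: eqP => [->|n1]; first by rewrite /m3 updN // updE.
    by rewrite /m3 !updN ?ag2 /m1 ?updN //; lia.
  by rewrite updN // /m3 !updN // ag2 /m1 ?updN //; lia.
- move=> x hx; rewrite /= /m6 !updN; try lia.
  rewrite low5; [|lia|lia].
  rewrite /m4 /m3 !updN; try lia.
  by rewrite ag2 /m1 ?updN //; lia.
Qed.

(** All registers below [lo] must be overwritten, including the one with the heap base, and no
    scratch register remains. Each register is therefore given the address of its own final value
    and then loads through itself. *)
Definition finish a : seq instr :=
  [:: IConst 0 0; IAdd 0 0 V; IConst 1 a%:Z; IAdd 0 0 1] ++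
  flatten [seq [:: IConst i (16 * i)%N%:Z; IAdd i i 0] | i <- iota 1 lo.-1] ++
  [seq ILoad i i | i <- iota 0 lo].

Definition finish_sz := (4 + (2 * lo.-1 + lo))%N.

Lemma size_finish a : size (finish a) = finish_sz.
Proof.
by rewrite /finish !size_cat (@size_flatten_const _ _ _ _ 2) // size_map size_iota.
Qed.

Lemma finish_addr P o k m h : m 0 = h%:Z ->
  code_at P o (flatten [seq [:: IConst i (16 * i)%N%:Z; IAdd i i 0] | i <- iota 1 k]) ->
  exists m', [/\ steps P (2 * k) (o, m) = Some ((o + 2 * k)%N, m'),
    forall i, (i <= k)%N -> m' i = (h + i * 16)%N%:Z &
    forall x, (k < x)%N -> m' x = m x].
Proof.
move=> m0; elim: k => [|k IH].
  move=> _; exists m; rewrite muln0 addn0; split=> // i.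
  by rewrite leqn0 => /eqP ->; rewrite m0 addn0.
have -> : iota 1 k.+1 = iota 1 k ++ [:: k.+1] by rewrite -[X in iota _ X]addn1 iotaD add1n.
rewrite map_cat flatten_cat => /code_at_cat [c1 c2].
rewrite (@size_flatten_const _ _ _ _ 2) //= in c2.
case/code_at_cons: c2 => i0 /code_at_cons [i1 _].
have [m1 [s1 a1 ag1]] := IH c1.
have m10 : m1 0 = h%:Z by rewrite a1 // addn0.
exists (upd (upd m1 k.+1 (16 * k.+1)%N%:Z) k.+1 ((16 * k.+1)%N%:Z + h%:Z)); split.
- rewrite mulnSr; apply: steps_trans s1 _.
  rewrite /= i0 /= i1 /= !updE (updN _ _ (_ : 0 != k.+1)%N) // m10.
  by congr (Some (_, _)); lia.
- move=> i ik; have [->|ne] := eqVneq i k.+1; first by rewrite updE; lia.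
  by rewrite !updN // a1 //; lia.
- by move=> x kx; rewrite !updN ?ag1 //; lia.
Qed.

(** The loads cannot disturb each other: sources lie at or above [lo], targets below. *)
Lemma finish_load P o k m : (k <= lo)%N -> 
  (forall i, (i < lo)%N -> exists2 z, m i = z%:Z & (lo <= z)%N) ->
  code_at P o [seq ILoad i i | i <- iota 0 k] ->
  exists m', [/\ steps P k (o, m) = Some ((o + k)%N, m'),
    forall i, (i < k)%N -> m' i = m `|m i|%N &
    forall x, (k <= x)%N -> m' x = m x].
Proof.
move=> klo ad; elim: k klo => [|k IH] klo.
  by move=> _; exists m; rewrite addn0; split.
rewrite -[in iota 0 k.+1]addn1 iotaD map_cat => /code_at_cat [c1 c2].
rewrite size_map size_iota /= add0n in c2; case/code_at_cons: c2 => i0 _.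
have [m1 [s1 a1 ag1]] := IH (ltnW klo) c1.
exists (upd m1 k (m1 `|m1 k|%N)); split.
- rewrite -addn1; apply: steps_trans s1 _; apply: steps1.
  by rewrite /ram_step i0; congr (Some (_, _)); lia.
- move=> i ik; have [->|ne] := eqVneq i k.
    rewrite updE (ag1 k) //; have [z -> lz] := ad k klo.
    by rewrite ag1 // absz_nat; lia.
  by rewrite updN // a1 //; lia.
- by move=> x kx; rewrite updN ?ag1 //; lia.
Qed.

Lemma finish_ok P o a s m H : (a < 16)%N -> (lo <= H)%N -> sim V lo H s m ->
  code_at P o (finish a) -> exists m',
  [/\ steps P finish_sz (o, m) = Some ((o + finish_sz)%N, m'),
     forall i, (i < lo)%N -> m' i = arr s a i &
     forall i, (lo <= i < H)%N -> m' i = low s i].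
Proof.
move=> a16 loH [h1 h2 h3 h4]; rewrite /finish => /code_at_cat [c1 /code_at_cat [c2 c3]].
rewrite (@size_flatten_const _ _ _ _ 2) // in c3.
move: c1 => /code_at_cons [i0 /code_at_cons [i1 /code_at_cons [i2 /code_at_cons [i3 _]]]].
pose m1 := upd (upd (upd (upd m 0 0) 0 H%:Z) 1 a%:Z) 0 (H%:Z + a%:Z).
have s1 : steps P 4 (o, m) = Some ((o + 4)%N, m1).
  rewrite /= i0 /= i1 /= i2 /= i3 /= !updE add0r (updN _ _ (_ : V != 0)%N); last by lia.
  by rewrite h2 (updN _ _ (_ : 0 != 1)%N) // updE addn4.
have m10 : m1 0 = (H + a)%N%:Z by rewrite /m1 updE; lia.
have [m2 [s2 a2 ag2]] := finish_addr m10 c2.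
have ad i : (i < lo)%N -> m2 i = (H + a + i * 16)%N%:Z by move=> hi; apply: a2; lia.
have ad' i : (i < lo)%N -> exists2 z, m2 i = z%:Z & (lo <= z)%N.
  by move=> hi; exists (H + a + i * 16)%N; [exact: ad | lia].
have [m3 [s3 a3 ag3]] := finish_load (leqnn lo) ad' c3.
exists m3; split.
- apply: steps_trans s1 _; apply: steps_trans s2 _; rewrite s3.
  by congr (Some (_, _)); rewrite /finish_sz /=; lia.
- move=> i hi; rewrite a3 // (ad i hi) absz_nat ag2; last by lia.
  rewrite /m1 !updN; try lia.
  by rewrite -h3 //; congr (m _); lia.
- move=> i hi; rewrite ag3; last by lia.
  rewrite ag2; last by lia.
  by rewrite /m1 !updN ?h4 //; lia.
Qed.
End Boot.

(** * Running-time logic *)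

Fixpoint modv c : seq nat :=
  match c with
  | Asn x _ | In x _ => [:: x]
  | Seq c1 c2 | If _ c1 c2 => modv c1 ++ modv c2
  | While _ c => modv c
  | _ => [::]
  end.

Fixpoint moda c : seq nat :=
  match c with
  | Put a _ _ => [:: a]
  | Seq c1 c2 | If _ c1 c2 => moda c1 ++ moda c2
  | While _ c => moda c
  | _ => [::]
  end.

Fixpoint nout c : bool :=
  match c with
  | Out _ _ => false
  | Seq c1 c2 | If _ c1 c2 => nout c1 && nout c2
  | While _ c => nout c
  | _ => true
  end.

(** A syntactic frame rule. For concrete commands its side conditions are decided by computation, so
    invariants mention only what changes. *)
Definition frame c s s' :=
  [/\ forall x, x \notin modv c -> var s' x = var s x,
      forall a, a \notin moda c -> forall i, arr s' a i = arr s a i &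
      nout c -> low s' = low s].

Lemma frame_trans c s1 s2 s3 : frame c s1 s2 -> frame c s2 s3 -> frame c s1 s3.
Proof.
move=> [v1 a1 l1] [v2 a2 l2]; split.
- by move=> x h; rewrite v2 ?v1.
- by move=> a h i; rewrite a2 ?a1.
- by move=> h; rewrite l2 ?l1.
Qed.

Lemma frame_sub c c' s s' : {subset modv c <= modv c'} -> {subset moda c <= moda c'} ->
  (nout c' -> nout c) -> frame c s s' -> frame c' s s'.
Proof.
move=> sv sa sn [v a l]; split.
- by move=> x h; apply: v; apply: contra h => /sv.
- by move=> b h; apply: a; apply: contra h => /sa.
- by move=> /sn.
Qed.

Lemma exec_frame lo hi c s t s' : exec lo hi c s t s' -> frame c s s'.
Proof.
elim=> {c s t s'} //=.
- by move=> x e s; split=> //= y; rewrite inE eqnE => /negPf ->.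
- by move=> a e1 e2 s; split=> //= b; rewrite inE eqnE => /negPf ->.
- move=> c1 c2 s1 s2 s3 t1 t2 _ f1 _ f2; apply: (@frame_trans _ _ s2).
    by apply: frame_sub f1 => /= [x h|x h|/andP[] //]; rewrite mem_cat h.
  by apply: frame_sub f2 => /= [x h|x h|/andP[] //]; rewrite mem_cat h orbT.
- move=> e c1 c2 s t s' _; case: ifP => _ f; apply: frame_sub f => /= [x h|x h|/andP[] //];
    by rewrite mem_cat h ?orbT.
- by move=> e c s1 s2 s3 t1 t2 _ _ f1 _ f2; apply: frame_trans f2.
- by move=> x y s _; split=> //= z; rewrite inE eqnE => /negPf ->.
Qed.

Section Run.
Variables lo hi : nat.

(** Total correctness within a time budget [T]. Triples nest like weakest preconditions, and
    [run_seq] splits the budget. *)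
Definition run c s T (Q : store -> Prop) :=
  exists t s', [/\ exec lo hi c s t s', (t <= T)%N & Q s'].

Lemma run_weaken c s T T' (Q Q' : store -> Prop) : run c s T' Q' -> (T' <= T)%N ->
  (forall s', frame c s s' -> Q' s' -> Q s') -> run c s T Q.
Proof.
move=> [t [s' [e le q]]] TT h; exists t, s'; split=> //; first exact: leq_trans TT.
by apply: h => //; apply: exec_frame e.
Qed.

Lemma run_skip s T (Q : store -> Prop) : (0 < T)%N -> Q s -> run Skip s T Q.
Proof. by move=> T0 q; exists 1, s; split=> //; constructor. Qed.

Lemma run_asn x e s T (Q : store -> Prop) : (0 < T)%N -> Q (setv s x (eval s e)) ->
  run (Asn x e) s T Q.
Proof. by move=> T0 q; eexists; eexists; split; [constructor| |exact: q]. Qed.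

Lemma run_put a e1 e2 s T (Q : store -> Prop) : (0 < T)%N ->
  Q (seta s a `|eval s e1|%N (eval s e2)) -> run (Put a e1 e2) s T Q.
Proof. by move=> T0 q; eexists; eexists; split; [constructor| |exact: q]. Qed.

Lemma run_in x y s T (Q : store -> Prop) : (0 < T)%N -> (lo <= `|var s y| < hi)%N ->
  Q (setv s x (low s `|var s y|%N)) -> run (In x y) s T Q.
Proof. by move=> T0 h q; eexists; eexists; split; [constructor| |exact: q]. Qed.

Lemma run_out x y s T (Q : store -> Prop) : (0 < T)%N -> (lo <= `|var s y| < hi)%N ->
  Q (setl s `|var s y|%N (var s x)) -> run (Out y x) s T Q.
Proof. by move=> T0 h q; eexists; eexists; split; [constructor| |exact: q]. Qed.

Lemma run_seq T1 c1 c2 s T (Q : store -> Prop) : (T1 <= T)%N ->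
  run c1 s T1 (fun s1 => run c2 s1 (T - T1) Q) -> run (Seq c1 c2) s T Q.
Proof.
move=> le [t1 [s1 [e1 l1 [t2 [s2 [e2 l2 q]]]]]].
exists (t1 + t2)%N, s2; split=> //; first by apply: XSeq e2.
by rewrite -(subnKC le) leq_add.
Qed.

Lemma run_if e c1 c2 s T (Q : store -> Prop) : (0 < T)%N ->
  (0 < eval s e -> run c1 s T.-1 Q) -> (~~ (0 < eval s e) -> run c2 s T.-1 Q) ->
  run (If e c1 c2) s T Q.
Proof.
case: T => // T _ /= h1 h2; have [ev|ev] := boolP (0 < eval s e).
  have [t [s' [ee le q]]] := h1 ev; exists t.+1, s'; split=> //.
  by constructor; rewrite ev.
have [t [s' [ee le q]]] := h2 ev; exists t.+1, s'; split=> //.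
by constructor; rewrite (negPf ev).
Qed.

Lemma run_while_idx e c s Tb N (I : nat -> store -> Prop) : I N s ->
  (forall m s', (m <= N)%N -> frame c s s' -> I m s' -> 0 < eval s' e ->
     run c s' Tb (fun s'' => exists2 m', (m' < m)%N & I m' s'')) ->
  run (While e c) s (N * Tb.+1 + 1) (fun s' => (exists m, I m s') /\ ~~ (0 < eval s' e)).
Proof.
move=> Is body.
suff gen m s0 : frame c s s0 -> I m s0 -> (m <= N)%N ->
    run (While e c) s0 (m * Tb.+1 + 1) (fun s' => (exists m, I m s') /\ ~~ (0 < eval s' e)).
  by apply: gen.
elim/ltn_ind: m s0 => m IH s0 fr Im mN.
have [ev|ev] := boolP (0 < eval s0 e); last first.
  by exists 1%N, s0; split; [exact: XWhileF|rewrite addn1|split=> //; exists m].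
have [t [s1 [e1 l1 [m' lt I1]]]] := body m s0 mN fr Im ev.
have [|t2 [s2 [e2 l2 q]]] := IH m' lt s1 (frame_trans fr (exec_frame e1)) I1.
  exact: leq_trans (ltnW lt) mN.
exists (t + t2).+1, s2; split=> //; first exact: XWhileT e2.
have : (m'.+1 * Tb.+1 <= m * Tb.+1)%N by rewrite leq_mul2r lt orbT.
by rewrite mulSn; lia.
Qed.

Lemma run_while e c s Tb N (mu : store -> nat) (I : store -> Prop) :
  I s -> (mu s <= N)%N ->
  (forall s', frame c s s' -> I s' -> 0 < eval s' e ->
     run c s' Tb (fun s'' => I s'' /\ (mu s'' < mu s')%N)) ->
  run (While e c) s (N * Tb.+1 + 1) (fun s' => I s' /\ ~~ (0 < eval s' e)).
Proof.
move=> Is sN body.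
have [||t [s' [e1 l1 [[m [Is' _]] nev]]]] :=
    @run_while_idx e c s Tb N (fun m s => I s /\ (mu s <= m)%N); first by [].
  move=> m s' _ fr [Is' sm] ev; have [t [s2 [e1 l1 [I2 lt]]]] := body s' fr Is' ev.
  by exists t, s2; split=> //; exists (mu s2) => //; apply: leq_trans sm.
by exists t, s'.
Qed.

Definition For x y body := Seq (Asn x (Cst 0))
  (While (Minus (Var y) (Var x)) (Seq body (Asn x (Plus (Var x) (Cst 1))))).

Lemma notin_for z x y body :
  (z \notin modv (For x y body)) = (z != x) && (z \notin modv body).
Proof.
rewrite /= inE mem_cat inE !negb_or; case: (z != x) => //=.
by rewrite andbT.
Qed.

(** The invariant is required after the counter has advanced, so it may mention the counter. Two
    extra steps per round pay for the test and the increment. *)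
Lemma run_for x y body s n Tb (I : nat -> store -> Prop) :
  x != y -> x \notin modv body -> y \notin modv body -> var s y = n%:Z ->
  I 0%N (setv s x 0) ->
  (forall j s', (j < n)%N -> frame (For x y body) s s' ->
     var s' x = j%:Z -> I j s' ->
     run body s' Tb (fun s'' => I j.+1 (setv s'' x j.+1%:Z))) ->
  run (For x y body) s (n * Tb.+2 + 2) (fun s' => I n s' /\ var s' x = n%:Z).
Proof.
move=> xy xb yb sy I0 body_ok; apply: (@run_seq 1); first by rewrite addn2.
apply: run_asn => //=.
have f0 : frame (For x y body) s (setv s x 0).
  by split=> //= z; rewrite inE negb_or eqnE => /andP[/negPf ->].
pose c := Seq body (Asn x (Plus (Var x) (Cst 1))).
have sub z : z \in modv c -> z \in modv (For x y body) by rewrite /= !inE => ->; rewrite orbT.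
have suba z : z \in moda c -> z \in moda (For x y body) by [].
have yx : eqn y x = false by rewrite eqnE eq_sym (negPf xy).
have xx : eqn x x by rewrite eqnE.
pose J s' := exists j, [/\ (j <= n)%N, var s' x = j%:Z, var s' y = n%:Z & I j s'].
apply: (@run_weaken _ _ _ (n * Tb.+2 + 1) _ (fun s' => J s' /\ ~~ (0 < n%:Z - var s' x))); last 2 first.
- lia.
- move=> s' _ [[j [jn sx _ Ij]] h]; have e : j = n by move: h; rewrite sx; lia.
  by split; [rewrite -e|rewrite sx e].
have := @run_while (Minus (Var y) (Var x)) c (setv s x 0) Tb.+1 n (fun s' => `|n%:Z - var s' x|%N) J.
move=> h; apply: run_weaken (h _ _ _) _ _ => //.
- by exists 0%N; rewrite /= xx yx.
- by rewrite /= xx; lia.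
- move=> s' fr [j [jn sx sy' Ij]] /=; rewrite sy' sx => jn'.
  apply: (@run_seq Tb) => //; have lt : (j < n)%N by lia.
  have f1 : frame (For x y body) s s' by apply: frame_trans f0 (frame_sub _ _ _ fr).
  apply: run_weaken (body_ok j s' lt f1 sx Ij) _ _ => // s2 [v2 _ _] I2.
  apply: run_asn; first by lia.
  have s2x : var s2 x = j%:Z by rewrite v2.
  have s2y : var s2 y = n%:Z by rewrite v2.
  rewrite /= s2x; have -> : j%:Z + 1 = j.+1%:Z by lia.
  split; last by rewrite /= xx; lia.
  by exists j.+1; rewrite /= xx yx.
- by move=> s' _ [[j [jn sx sy' Ij]]] /=; rewrite sy' => h'; split=> //; exists j.
Qed.
End Run.

(** * Integer scaling of the input *)

Local Notation vN := 0%N.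
Local Notation vNN := 1%N.
Local Notation vBIG := 2%N.
Local Notation vQ := 3%N.
Local Notation vCUR := 4%N.
Local Notation vC := 5%N.
Local Notation vFLAG := 6%N.
Local Notation vU := 7%N.
Local Notation vW := 8%N.
Local Notation vROW := 9%N.
Local Notation vBEST := 10%N.
Local Notation vBY := 11%N.
Local Notation vFND := 12%N.
Local Notation vI := 13%N.
Local Notation vJ := 14%N.
Local Notation vMX := 15%N.
Local Notation vMY := 16%N.
Local Notation vMR := 17%N.
Local Notation vMH := 18%N.
Local Notation vREM := 19%N.
Local Notation vA := 20%N.
Local Notation vBND := 21%N.
Local Notation vXX := 22%N.
Local Notation vF := 23%N.
Local Notation vDD := 24%N.
Local Notation vZ := 25%N.
Local Notation vK := 26%N.
Local Notation vZI := 27%N.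
Local Notation vCI := 28%N.
Local Notation vPI := 29%N.

Local Notation aIN := 0%N.
Local Notation aMA := 1%N.
Local Notation aMB := 2%N.
Local Notation aS := 3%N.
Local Notation aT := 4%N.
Local Notation aX := 5%N.
Local Notation aPW := 6%N.
Local Notation aXS := 7%N.
Local Notation aM := 8%N.

Definition incr x := Asn x (Plus (Var x) (Cst 1)).

(** Multiplication by doubling: [2 ^ h] and [x * 2 ^ h] are tabulated until [2 ^ h] exceeds [y], and
    [mul_down] then subtracts powers greedily. As tests are strict, a guard [a - b + 1] stands for
    [b <= a]. *)
Definition mul_up :=
  While (Plus (Minus (Var vMY) (Get aPW (Var vMH))) (Cst 1))
   (Seq (Put aPW (Plus (Var vMH) (Cst 1)) (Plus (Get aPW (Var vMH)) (Get aPW (Var vMH))))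
   (Seq (Put aXS (Plus (Var vMH) (Cst 1)) (Plus (Get aXS (Var vMH)) (Get aXS (Var vMH))))
    (incr vMH))).

Definition mul_down :=
  While (Var vMH)
   (Seq (Asn vMH (Minus (Var vMH) (Cst 1)))
    (If (Plus (Minus (Var vREM) (Get aPW (Var vMH))) (Cst 1))
      (Seq (Asn vREM (Minus (Var vREM) (Get aPW (Var vMH))))
           (Asn vMR (Plus (Var vMR) (Get aXS (Var vMH)))))
      Skip)).

Definition mul_cmd :=
  Seq (Asn vMH (Cst 0)) (Seq (Put aPW (Cst 0) (Cst 1)) (Seq (Put aXS (Cst 0) (Var vMX))
  (Seq mul_up (Seq (Asn vMR (Cst 0)) (Seq (Asn vREM (Var vMY)) mul_down))))).

Ltac asn := apply: run_asn => /=; [try lia|].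
Ltac put := apply: run_put => /=; [try lia|].
Ltac sq T := apply: (@run_seq _ _ T) => /=; [try lia|].

Section Mul.
Variables lo hi : nat.
Local Notation run := (run lo hi).

Lemma mul_ok s (x : int) (y L : nat) T : var s vMX = x -> var s vMY = y%:Z ->
  (ibits y%:Z <= L)%N -> (11 * L + 10 <= T)%N ->
  run mul_cmd s T (fun s' => var s' vMR = x * y%:Z).
Proof.
move=> sx sy yL LT.
apply: (@run_weaken _ _ _ _ _ (11 * L + 10) _ (fun s' => var s' vMR = x * y%:Z)) => //.
have T0 k : (k < 11 * L + 10)%N -> (0 < 11 * L + 10 - k)%N by lia.
rewrite /mul_cmd; sq 1%N; asn; sq 1%N; put.
sq 1%N; put.
set s1 := seta _ _ _ _.
sq (L * 4 + 1)%N.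
pose I s' := exists h : nat, [/\ (h <= L)%N, var s' vMH = h%:Z &
  forall i, (i <= h)%N -> arr s' aPW i = (2 ^ i)%N%:Z /\ arr s' aXS i = x * (2 ^ i)%N%:Z].
apply: (run_weaken (@run_while lo hi _ _ s1 3 L (fun s' => L - `|var s' vMH|)%N I _ _ _)) => //.
- exists 0%N; split=> // i; rewrite leqn0 => /eqP -> /=; by rewrite sx mulr1.
- by rewrite /=; lia.
- move=> s' [fv _ _] [h [hL sh ar]] /=.
  have sy' : var s' vMY = y%:Z by rewrite fv.
  have [p1 p2] := ar h (leqnn h).
  rewrite sh absz_nat p1 sy' => lt.
  have hy : (2 ^ h <= y)%N by lia.
  sq 1%N; put; rewrite sh absz_nat p1.
  sq 1%N; put; rewrite sh absz_nat p2.
  have hL1 : (h < L)%N.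
    by have := trunc_log_max (isT : 1 < 2)%N hy; move: yL; rewrite /ibits absz_nat; lia.
  have e1 : `|(h%:Z + 1)%R|%N = h.+1 by lia.
  asn; rewrite sh e1; split; last by lia.
  exists h.+1; split=> //=; first by lia.
  move=> i ih; rewrite addn1; have [->|ne] := eqVneq i h.+1; last by apply: (ar i); lia.
  by rewrite expnS; split; [lia|rewrite -mulrDr; congr (_ * _); lia].
move=> s2 [fv2 _ _] [[h [hL sh ar]] /= nlt].
have sy' : var s2 vMY = y%:Z by rewrite fv2.
have [p1 _] := ar h (leqnn h).
rewrite sh absz_nat p1 sy' in nlt.
have hy : (y < 2 ^ h)%N by lia.
sq 1%N; asn; sq 1%N; asn.
set s3 := setv (setv _ _ _) _ _.
pose J s' := exists (k r : nat), [/\ (k <= h)%N, var s' vMH = k%:Z, var s' vREM = r%:Z,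
  (r < 2 ^ k)%N & var s' vMR + x * r%:Z = x * y%:Z].
apply: (run_weaken (@run_while lo hi _ _ s3 4 h (fun s' => `|var s' vMH|)%N J _ _ _)) => //.
- by exists h, y; rewrite /s3 /= sh sy'; split=> //; rewrite add0r.
- by rewrite /= sh.
- move=> s' [_ fa _] [k [r [kh sk sr rk e]]] /=; rewrite sk => k0.
  case: k kh sk rk k0 => // k kh sk rk _.
  have e1 : k.+1%:Z - 1 = k by lia.
  sq 1%N; asn; rewrite sk e1.
  have [q1 q2] := ar k (ltnW kh).
  have a1 : arr s' aPW k = (2 ^ k)%N%:Z by rewrite fa.
  have a2 : arr s' aXS k = x * (2 ^ k)%N%:Z by rewrite fa.
  rewrite expnS in rk.
  apply: run_if => //=; rewrite a1 sr => c.
    sq 1%N; asn; asn; split; last by lia.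
    rewrite a1 a2 sr; exists k, (r - 2 ^ k)%N; split=> //=; try lia.
    rewrite -e -addrA; congr (_ + _); rewrite -mulrDr; congr (_ * _); lia.
  by apply: run_skip => //=; split; [exists k, r; split=> //=; lia|lia].
- lia.
move=> s' _ [[k [r [_ sk _ rk e]]] k0]; rewrite -e.
have k00 : k = 0%N by move: k0; rewrite /= sk; lia.
by move: rk; rewrite k00 ltnS leqn0 => /eqP ->; rewrite mulr0 addr0.
Qed.
End Mul.

Definition square := For vI vN (Asn vNN (Plus (Var vNN) (Var vN))).
Definition copy_in :=
  While (Minus (Var vBND) (Var vA))
    (Seq (In vXX vA) (Seq (Put aIN (Var vA) (Var vXX)) (incr vA))).

(** The cells below [lo] are already in the array, so copying starts at [lo]. Cells 4 and 5, lost in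
    the boot, encode [d(0,0)], which is [0 / 1] in every metric. *)
Definition load lo :=
  Seq (Asn vN (Get aIN (Cst 0))) (Seq (Asn vNN (Cst 0)) (Seq square
  (Seq (Asn vBND (Plus (Cst 4) (Plus (Var vNN) (Var vNN))))
  (Seq (Asn vA (Cst (Posz lo))) (Seq copy_in
  (Seq (Put aIN (Cst 4) (Cst 0)) (Put aIN (Cst 5) (Cst 1)))))))).

Definition scale_init :=
  For vI vNN (Put aM (Var vI) (Get aIN (Plus (Cst 4) (Plus (Var vI) (Var vI))))).
Definition neq_ij :=
  If (Minus (Var vI) (Var vJ)) (Asn vF (Cst 1))
   (If (Minus (Var vJ) (Var vI)) (Asn vF (Cst 1)) (Asn vF (Cst 0))).
Definition mul_den :=
  Seq (Asn vMX (Get aM (Var vJ)))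
  (Seq (Asn vMY (Get aIN (Plus (Cst 5) (Plus (Var vI) (Var vI)))))
  (Seq mul_cmd (Put aM (Var vJ) (Var vMR)))).
Definition scale_den :=
  For vI vNN (For vJ vNN (Seq neq_ij (If (Var vF) mul_den Skip))).
Definition scale_rho :=
  For vJ vNN (Seq (Asn vMX (Get aM (Var vJ)))
    (Seq (Asn vMY (Get aIN (Cst 3))) (Seq mul_cmd (Seq (Put aMA (Var vJ) (Var vMR))
    (Seq (Asn vMY (Get aIN (Cst 2))) (Seq mul_cmd (Put aMB (Var vJ) (Var vMR)))))))).
(** Each entry is multiplied by all denominators except its own, so the common scale is their full
    product and no division occurs. Median weights then take the denominator of [rho] and forest
    weights its numerator, so one factor clears both parts of the objective. *)
Definition scale := Seq scale_init (Seq scale_den scale_rho).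

Section Load.
Variables lo hi : nat.
Local Notation run := (run lo hi).

Lemma square_ok s n T : var s vN = n%:Z -> var s vNN = 0 -> (n * 3 + 2 <= T)%N ->
  run square s T (fun s' => var s' vNN = (n * n)%N%:Z).
Proof.
move=> sn s0 TT; apply: (run_weaken (@run_for lo hi vI vN _ s n 1
  (fun j s' => var s' vNN = (j * n)%N%:Z) _ _ _ sn _ _)) => //.
- move=> j s' jn [fv _ _] _ Ij; asn; rewrite Ij.
  by rewrite (fv vN) // sn mulSn; lia.
- by move=> s' _ [].
Qed.

Lemma load_ok s n T : (6 < lo)%N -> (4 + (n * n + n * n) <= hi)%N ->
  arr s aIN 0 = n%:Z -> (n * 3 + (4 + (n * n + n * n)) * 4 + 20 <= T)%N ->
  run (load lo) s T (fun s' => [/\ var s' vN = n%:Z, var s' vNN = (n * n)%N%:Z &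
    forall a, (a < 4 + (n * n + n * n))%N -> arr s' aIN a =
      if a == 4%N then 0 else if a == 5%N then 1 else
      if (a < lo)%N then arr s aIN a else low s a]).
Proof.
move=> lo6 hi4 sn TT; rewrite /load.
sq 1%N; asn; sq 1%N; asn; rewrite sn.
sq (n * 3 + 2)%N.
apply: (run_weaken (@square_ok _ n (n * 3 + 2)%N _ _ _)) => //= s1 [fv1 fa1 fl1] s1n.
sq 1%N; asn; sq 1%N; asn.
set b := (4 + (n * n + n * n))%N in hi4 TT *.
set s2 := setv _ _ _; sq (b * 4 + 1)%N.
pose I s' := exists a : nat, [/\ var s' vA = a%:Z, (lo <= a)%N, ((lo <= b) ==> (a <= b))%N &
  forall i, arr s' aIN i = if (lo <= i < a)%N then low s i else arr s aIN i].
apply: (run_weaken (@run_while lo hi _ _ s2 3 b (fun s' => b - `|var s' vA|)%N I _ _ _)) => //.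
- exists lo; split=> //=; first exact/implyP.
  by move=> i; rewrite (_ : (lo <= i < lo)%N = false); [rewrite fa1|lia].
- lia.
- move=> s' [fv _ fl] [a [sa la ba ar]] /=.
  have -> : var s' vBND = b%:Z by rewrite fv //= s1n /b; lia.
  have fl' : low s' = low s by rewrite fl // /s2 /= fl1.
  rewrite sa => ab; have lt : (a < b)%N by lia.
  sq 1%N; apply: run_in => //=; first by rewrite sa; lia.
  sq 1%N; put; asn; rewrite sa absz_nat fl'; split; last by lia.
  exists a.+1; split=> //=; try lia.
  move=> i; rewrite ar; have [->|ne] := eqVneq i a; first by rewrite la ltnSn.
  by congr (if _ then _ else _); lia.
move=> s3 [fv3 _ _] [[a [sa la ba ar]] /= nlt].
have e3 : var s3 vBND = b%:Z by rewrite fv3 //= s1n /b; lia.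
rewrite e3 sa in nlt.
have s3n : var s3 vN = n%:Z by rewrite fv3 //= fv1.
have s3nn : var s3 vNN = (n * n)%N%:Z by rewrite fv3.
sq 1%N; put; put.
split=> // i ib; case: (i =P 5%N) => [->|n5] //; case: (i =P 4%N) => // n4.
by rewrite ar; case: (leqP lo i) => h; rewrite //= ifT //; lia.
Qed.

Lemma scale_ok s nn (num : nat -> int) (den : nat -> nat) (rn rd L T : nat) :
  var s vNN = nn%:Z ->
  (forall i, (i < nn)%N -> arr s aIN (4 + (i + i))%N = num i /\
     arr s aIN (5 + (i + i))%N = (den i)%:Z /\ (ibits (den i)%:Z <= L)%N) ->
  arr s aIN 2 = rn%:Z -> arr s aIN 3 = rd%:Z -> (ibits rn%:Z <= L)%N -> (ibits rd%:Z <= L)%N ->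
  ((nn.+1 * nn.+1) * (22 * L + 100) <= T)%N ->
  run scale s T (fun s' => forall j, (j < nn)%N ->
    arr s' aMA j = num j * (\prod_(l < nn | l != j :> nat) den l)%N%:Z * rd%:Z /\
    arr s' aMB j = num j * (\prod_(l < nn | l != j :> nat) den l)%N%:Z * rn%:Z).
Proof.
move=> snn sin srn srd Ln Ld TT; rewrite /scale.
sq (nn * 3 + 2)%N.
apply: (run_weaken (@run_for lo hi vI vNN _ s nn 1
  (fun j s' => forall i, (i < j)%N -> arr s' aM i = num i) _ _ _ snn _ _)) => //.
  move=> j s' jn [fv fa _] sj Ij; put; move=> i ij; rewrite sj /=.
  have [->|ne] := eqVneq i j; first by rewrite fa //; have [-> _] := sin j jn.
  by apply: Ij; lia.
move=> s1 [fv1 fa1 _] [I1 _].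
set T1 := (11 * L + 30)%N.
sq (nn * (nn * T1 + 2).+2 + 2)%N.
(* The multiplier that entry [j] has collected from the denominators below [i]; in the inner loop
   the entries before [j'] are one denominator ahead. *)
pose pr i j := (\prod_(l < i | l != j :> nat) den l)%N.
have prS i j : pr i.+1 j = (pr i j * (if i != j then den i else 1))%N.
  rewrite /pr big_mkcond big_ord_recr /= -big_mkcond //=.
have s1nn : var s1 vNN = nn%:Z by rewrite fv1.
apply: (run_weaken (@run_for lo hi vI vNN _ s1 nn (nn * T1 + 2)
  (fun i s' => forall j, (j < nn)%N -> arr s' aM j = num j * (pr i j)%:Z) _ _ _ s1nn _ _)) => //.
- by move=> j jn; rewrite /= I1 // /pr big_ord0 mulr1.
- move=> i s' ik [fv fa _] si Ii.
  have snn' : var s' vNN = nn%:Z by rewrite fv.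
  apply: (run_weaken (@run_for lo hi vJ vNN _ s' nn (T1.-2)
   (fun j' s'' => forall j, (j < nn)%N -> arr s'' aM j = num j * (pr (if (j < j')%N then i.+1 else i) j)%:Z) _ _ _ snn' _ _)) => //; last 2 first.
  + by rewrite /T1; lia.
  + by move=> s'' _ [h _] j jn /=; rewrite h // jn.
  move=> j0 s2 j0n [fv2 fa2 _] sj0 I2.
  have si2 : var s2 vI = i%:Z by rewrite fv2.
  apply: (@run_weaken _ _ _ _ _ (11 * L + 20) _ (fun s'' => forall j, (j < nn)%N ->
    arr s'' aM j = num j * (pr (if (j < j0.+1)%N then i.+1 else i) j)%:Z)); last 2 first.
  - by rewrite /T1; lia.
  - by [].
  sq 3%N.
  apply: (@run_weaken _ _ _ _ _ 3 _ (fun s3 => var s3 vF = (i != j0 :> nat)%:Z)) => //.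
    apply: run_if => //= h1; rewrite si2 sj0 in h1.
      by asn; rewrite (_ : i != j0) //; lia.
    apply: run_if => //= h2; rewrite si2 sj0 in h2; asn.
      by rewrite (_ : i != j0) //; lia.
    by rewrite (_ : i == j0) //; lia.
  move=> s3 [fv3 fa3 _] sF.
  have upd_j (v : int) j : (j < nn)%N -> v = num j0 * (pr i.+1 j0)%:Z ->
     (if j == j0 then v else arr s2 aM j) = num j * (pr (if (j < j0.+1)%N then i.+1 else i) j)%:Z.
    move=> jn ev; have [->|ne] := eqVneq j j0; first by rewrite ltnSn.
    by rewrite I2 //; congr (_ * (pr (if _ then _ else _) _)%:Z); lia.
  have Mj : arr s2 aM j0 = num j0 * (pr i j0)%:Z by rewrite I2 // ltnn.
  apply: run_if; [lia| |] => /=; rewrite sF => ij.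
    have nij : i != j0 by move: ij; case: (i != j0).
    have [_ [di dL]] := sin i ik.
    sq 1%N; asn; sq 1%N; asn.
    sq (11 * L + 10)%N.
    apply: (run_weaken (@mul_ok lo hi _ (num j0 * (pr i j0)%:Z) (den i) L _ _ _ dL (leqnn _))) => //=.
    + by rewrite fv3 // sj0 fa3 // Mj.
    + by rewrite fv3 // si2 fa3 // fa2 // fa // fa1 // di.
    move=> s4 [fv4 fa4 _] sR; put.
    move=> j jn; rewrite fv4 //= fv3 // sj0 absz_nat fa4 //= fa3 //; apply: upd_j => //.
    by rewrite sR prS nij PoszM mulrA.
  have nij : i = j0 by apply/eqP; move: ij; case: (i =P j0).
  apply: run_skip; first by lia.
  move=> j jn; rewrite fa3 // -(upd_j _ _ jn (_ : arr s2 aM j0 = _)).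
    by case: eqP => [->|].
  by rewrite Mj prS nij eqxx muln1.
move=> s2 [fv2 fa2 _] [I2 _].
have s2nn : var s2 vNN = nn%:Z by rewrite fv2 // fv1.
apply: (run_weaken (@run_for lo hi vJ vNN _ s2 nn (22 * L + 30)
  (fun i s' => forall j, (j < i)%N -> arr s' aMA j = num j * (pr nn j)%:Z * rd%:Z /\
    arr s' aMB j = num j * (pr nn j)%:Z * rn%:Z) _ _ _ s2nn _ _)) => //.
- move=> i s' ik [fv fa _] si Ii.
  sq 1%N; asn; sq 1%N; asn.
  sq (11 * L + 10)%N.
  apply: (run_weaken (@mul_ok lo hi _ (num i * (pr nn i)%:Z) rd L _ _ _ Ld (leqnn _))) => //=.
  + by rewrite si fa // I2.
  + by rewrite fa // fa2 // fa1.
  move=> s4 [fv4 fa4 _] sR; sq 1%N; put.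
  sq 1%N; asn; sq (11 * L + 10)%N.
  apply: (run_weaken (@mul_ok lo hi _ (num i * (pr nn i)%:Z) rn L _ _ _ Ln (leqnn _))) => //=.
  + by rewrite fv4 //= si fa // I2.
  + by rewrite fa4 //= fa // fa2 // fa1.
  move=> s5 [fv5 fa5 _] sR5; put.
  have s4J : var s4 vJ = i by rewrite fv4.
  have s5J : var s5 vJ = i by rewrite fv5.
  move=> j ji; rewrite s5J (fa5 aMA) // (fa5 aMB) //= s4J absz_nat !fa4 //=.
  have [->|ne] := eqVneq j i; first by rewrite sR sR5.
  by apply: Ii; lia.
- nia.
- by move=> s' _ [h _] j jn; apply: h.
Qed.
End Load.

(** * Evaluating the cost of a set *)

Definition copy a b := For vCI vN (Put a (Var vCI) (Get b (Var vCI))).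

Definition nearest_cmd :=
  For vW vN (If (Get aT (Var vW))
    (If (Minus (Var vBEST) (Get aMA (Plus (Var vROW) (Var vW))))
        (Asn vBEST (Get aMA (Plus (Var vROW) (Var vW)))) Skip) Skip).

Definition median_cmd :=
  For vU vN (Seq (Asn vBEST (Var vBIG)) (Seq nearest_cmd
    (Seq (Asn vC (Plus (Var vC) (Var vBEST))) (Asn vROW (Plus (Var vROW) (Var vN)))))).

Definition scan_row :=
  For vW vN (If (Get aX (Var vW)) Skip
    (If (Minus (Var vBEST) (Get aMB (Plus (Var vROW) (Var vW))))
      (Seq (Asn vBEST (Get aMB (Plus (Var vROW) (Var vW))))
      (Seq (Asn vBY (Var vW)) (Asn vFND (Cst 1)))) Skip)).

Definition scan :=
  Seq (Asn vBEST (Var vBIG)) (Seq (Asn vFND (Cst 0)) (Seq (Asn vROW (Cst 0))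
   (For vU vN (Seq (If (Get aX (Var vU)) scan_row Skip)
      (Asn vROW (Plus (Var vROW) (Var vN))))))).

Definition prim_cmd :=
  For vPI vN (Seq scan (If (Var vFND)
    (Seq (Asn vC (Plus (Var vC) (Var vBEST))) (Put aX (Var vBY) (Cst 1))) Skip)).

Definition cost_cmd :=
  Seq (Asn vC (Cst 0)) (Seq (Asn vROW (Cst 0)) (Seq median_cmd (Seq (copy aX aT) prim_cmd))).

Section Cost.
Variables (lo hi n : nat) (fA fB : nat -> int) (big : int).
Local Notation run := (run lo hi).
Hypothesis Abig : forall i, (i < n * n)%N -> fA i < big.
Hypothesis Bbig : forall i, (i < n * n)%N -> fB i < big.

Definition wA (u w : 'I_n) := fA (u * n + w).
Definition wB (u w : 'I_n) := fB (u * n + w).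

Definition ctx s := [/\ var s vN = n%:Z, var s vBIG = big,
  forall i, (i < n * n)%N -> arr s aMA i = fA i &
  forall i, (i < n * n)%N -> arr s aMB i = fB i].

Definition isset s a (A : {set 'I_n}) := forall i : 'I_n, arr s a i = (nat_of_bool (i \in A))%:Z.

Lemma ctx_frame c s s' : frame c s s' ->
  [&& vN \notin modv c, vBIG \notin modv c, aMA \notin moda c & aMB \notin moda c] ->
  ctx s -> ctx s'.
Proof.
move=> [fv fa _] /and4P[h1 h2 h3 h4] [c1 c2 c3 c4]; split; rewrite ?fv //.
  by move=> i; rewrite fa //; apply: c3.
by move=> i; rewrite fa //; apply: c4.
Qed.

Lemma isset_frame c s s' a A : frame c s s' -> isset s a A -> a \notin moda c -> isset s' a A.
Proof. by move=> [_ fa _] x h i; rewrite fa. Qed.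

Lemma idx_lt (u w : 'I_n) : (u * n + w < n * n)%N.
Proof.
have := ltn_ord u; have := ltn_ord w => h1 h2.
by apply: (@leq_trans (u * n + n)); [rewrite ltn_add2l|rewrite -mulSnr leq_mul2r h2 orbT].
Qed.

Lemma copy_ok a b s A T : a != b -> var s vN = n%:Z -> isset s b A -> (n * 3 + 2 <= T)%N ->
  run (copy a b) s T (fun s' => isset s' a A).
Proof.
move=> ab sn sb TT.
apply: (run_weaken (@run_for lo hi vCI vN _ s n 1
  (fun j s' => forall i : 'I_n, (i < j)%N -> arr s' a i = (nat_of_bool (i \in A))%:Z) _ _ _ sn _ _)) => //.
- move=> j s' jn [fv fa _] sj Ij; put; move=> i ij; rewrite sj /= eqnE eqxx /=.
  have [e|ne] := eqVneq (i : nat) j; last by apply: Ij; lia.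
  by rewrite fa ?inE 1?eq_sym // -e sb.
- by move=> s' _ [h _] i; apply: h.
Qed.

Section Fixed.
Variable A : {set 'I_n}.
Hypothesis A0 : A != set0.

Definition nearN (u : nat) := \big[Num.min/big]_(w in A) fA (u * n + w)%N.

Lemma nearest_ok s (u : 'I_n) T : ctx s -> isset s aT A -> var s vROW = (u * n)%N%:Z ->
  var s vBEST = big -> (n * 5 + 2 <= T)%N ->
  run nearest_cmd s T (fun s' => var s' vBEST = nearN u).
Proof.
move=> cs ts sr sb TT; have [sn _ _ _] := cs.
apply: (run_weaken (@run_for lo hi vW vN _ s n 3
  (fun j s' => (forall w : 'I_n, w \in A -> (w < j)%N -> var s' vBEST <= wA u w) /\
     (var s' vBEST = big \/ exists2 w, w \in A & var s' vBEST = wA u w)) _ _ _ sn _ _)) => //.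
- by split; [|left].
- move=> j s' jn fr sj [I1 I2]; have [_ _ cA _] := ctx_frame fr isT cs.
  have ts' := isset_frame fr ts isT; have [fv _ _] := fr.
  pose jo := Ordinal jn.
  have sr' : var s' vROW = (u * n)%N%:Z by rewrite fv.
  have cj : arr s' aMA (u * n + j)%N = wA u jo by rewrite cA //; exact: (idx_lt u jo).
  apply: run_if => //=; rewrite sj /= (ts' jo).
    case jA: (jo \in A) => // _; apply: run_if => //=; rewrite sj sr' /= cj => h.
      asn; rewrite sj sr' /= cj; split.
        move=> w wA'; rewrite ltnS leq_eqVlt => /orP[/eqP e|wj].
          by rewrite (_ : w = jo) //; apply: val_inj.
        have := I1 w wA' wj; rewrite subr_gt0 in h; move: h; lia.
      by right; exists jo.
    apply: run_skip => //=; split=> // w wA'; rewrite ltnS leq_eqVlt => /orP[/eqP e|]; last exact: I1.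
    by have -> : w = jo; [apply: val_inj | rewrite leNgt -subr_gt0].
  case jA: (jo \in A) => // _; apply: run_skip => //=; split=> // w wA'.
  rewrite ltnS leq_eqVlt => /orP[/eqP e|]; last exact: I1.
  by move: wA'; rewrite (_ : w = jo) ?jA //; apply: val_inj.
move=> s' _ [[I1 I2] _].
have /set0Pn [a aA] := A0.
apply/eqP; rewrite eq_le; apply/andP; split.
  apply: le_bigmin => [|w wA']; last exact: I1.
  by apply: le_trans (I1 a aA (ltn_ord a)) _; apply: ltW; apply: Abig; apply: idx_lt.
case: I2 => [->|[w wA' ->]]; last by apply: bigmin_le_cond.
by rewrite bigmin_le_id.
Qed.

Lemma median_ok s T : ctx s -> isset s aT A -> var s vROW = 0 -> var s vC = 0 ->
  (n * (n * 5 + 10) + 2 <= T)%N ->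
  run median_cmd s T (fun s' => var s' vC = \sum_(u < n) nearN u).
Proof.
move=> cs ts sr sc TT; have [sn _ _ _] := cs.
apply: (run_weaken (@run_for lo hi vU vN _ s n (n * 5 + 8)
  (fun j s' => var s' vROW = (j * n)%N%:Z /\ var s' vC = \sum_(u < j) nearN u) _ _ _ sn _ _)) => //.
- by rewrite big_ord0.
- move=> j s' jn fr sj [I1 I2]; have cs' := ctx_frame fr isT cs.
  have ts' := isset_frame fr ts isT.
  have [sn' sb' _ _] := cs'.
  sq 1%N; asn; sq (n * 5 + 2)%N.
  set s0 := setv _ _ _; have cs0 : ctx s0 by case: cs'.
  have b0 : var s0 vBEST = big by [].
  apply: (run_weaken (@nearest_ok s0 (Ordinal jn) _ cs0 ts' I1 b0 (leqnn _))) => //=.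
  move=> s1 [fv _ _] s1b; sq 1%N; asn; asn.
  rewrite (fv vROW) // (fv vC) // (fv vN) //= s1b I1 I2 sn' big_ord_recr /= mulSn; split=> //; lia.
- lia.
- by move=> s' _ [[]].
Qed.
End Fixed.

Section Prim.
Variable X : {set 'I_n}.

(** [K] marks the pairs already scanned. All weights are strictly below [big], so after a full scan
    [vFND = 0] means that no edge leaves [X]. *)
Definition found (K : 'I_n -> 'I_n -> Prop) s :=
  (forall x y, K x y -> x \in X -> y \notin X -> var s vBEST <= wB x y) /\
  ((var s vFND = 0 /\ var s vBEST = big) \/
   (var s vFND = 1 /\ exists x y : 'I_n,
     [/\ var s vBY = (y : nat)%:Z, x \in X, y \notin X & var s vBEST = wB x y])).

Lemma scan_row_ok s (u : 'I_n) T : ctx s -> isset s aX X -> u \in X ->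
  var s vROW = (u * n)%N%:Z -> found (fun x _ => x < u)%N s -> (n * 8 + 2 <= T)%N ->
  run scan_row s T (found (fun x _ => x < u.+1)%N).
Proof.
move=> cs xs uX sr F TT; have [sn _ _ _] := cs.
apply: (run_weaken (@run_for lo hi vW vN _ s n 6
  (fun j s' => found (fun x y => (x < u)%N \/ x = u /\ (y < j)%N) s') _ _ _ sn _ _)) => //.
- case: F => F1 F2; split=> // x y [h|[_]] //; exact: F1.
- move=> j s' jn fr sj [I1 I2]; have [_ _ _ cB] := ctx_frame fr isT cs.
  have xs' := isset_frame fr xs isT; have [fv _ _] := fr.
  pose jo := Ordinal jn.
  have sr' : var s' vROW = (u * n)%N%:Z by rewrite fv.
  have cj : arr s' aMB (u * n + j)%N = wB u jo by rewrite cB //; exact: (idx_lt u jo).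
  have step (b : int) : b <= var s' vBEST -> (jo \notin X -> b <= wB u jo) ->
     forall x y : 'I_n, ((x < u)%N \/ x = u /\ (y < j.+1)%N) -> x \in X -> y \notin X -> b <= wB x y.
    move=> b1 b2 x y [h|[-> h]] xX yX; first by apply: le_trans b1 (I1 _ _ _ xX yX); left.
    move: h; rewrite ltnS leq_eqVlt => /orP[/eqP e|h].
      by move: yX; rewrite (_ : y = jo); [exact: b2|apply: val_inj].
    by apply: le_trans b1 (I1 _ _ _ _ yX) => //; right.
  apply: run_if => //=; rewrite sj /= (xs' jo).
    case jX: (jo \in X) => // _; apply: run_skip => //; split=> //=.
    by apply: step => //; rewrite jX.
  case jX: (jo \in X) => // _; apply: run_if => //=; rewrite sj sr' /= cj subr_gt0 => h.
    sq 1%N; asn; sq 1%N; asn; asn; rewrite sj sr' /= cj; split=> /=.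
      by apply: step => //; apply: ltW.
    by right; split=> //; exists u, jo; split=> //; rewrite jX.
  apply: run_skip => //; split=> //=; apply: step => // _.
  by rewrite leNgt.
- move=> s' _ [[I1 I2] _]; split=> // x y xu; apply: I1.
  move: xu; rewrite ltnS leq_eqVlt => /orP[/eqP e|]; last by left.
  by right; split=> //; apply: val_inj.
Qed.

Lemma scan_ok s T : ctx s -> isset s aX X -> (n * (n * 8 + 10) + 10 <= T)%N ->
  run scan s T (found (fun _ _ => True)).
Proof.
move=> cs xs TT; have [sn sb _ _] := cs; rewrite /scan.
sq 1%N; asn; sq 1%N; asn; sq 1%N; asn.
set s0 := setv _ _ _.
have cs0 : ctx s0 by case: cs.
apply: (run_weaken (@run_for lo hi vU vN _ s0 n (n * 8 + 7)
  (fun j s' => var s' vROW = (j * n)%N%:Z /\ found (fun x _ => x < j)%N s') _ _ _ sn _ _)) => //.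
- by split=> //; split=> //=; left.
- move=> j s' jn fr sj [I1 I2]; have cs' := ctx_frame fr isT cs0.
  have xs' := isset_frame fr xs isT.
  pose jo := Ordinal jn; have [sn' _ _ _] := cs'.
  sq (n * 8 + 3)%N.
  apply: (@run_weaken _ _ _ _ _ (n * 8 + 3) _ (fun s2 => found (fun x _ => x < j.+1)%N s2)) => //.
    apply: run_if => //=; rewrite ?addn3 //= sj /= (xs' jo).
      case jX: (jo \in X) => // _; apply: (@scan_row_ok _ jo) => //; lia.
    case jX: (jo \in X) => // _; apply: run_skip => //; case: I2 => F1 F2; split=> //.
    move=> x y; rewrite ltnS leq_eqVlt => /orP[/eqP e|]; last exact: F1.
    by rewrite (_ : x = jo) ?jX //; apply: val_inj.
  move=> s2 [fv _ _] F; asn; split=> //; rewrite !fv // I1 sn' mulSn; lia.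
- lia.
move=> s' _ [[_ [F1 F2]] _]; split=> // x y _; apply: F1; exact: ltn_ord.
Qed.
End Prim.

(** A derivation of [prim] is built from its end, but the program runs from its beginning; the
    invariant therefore carries a derivation with a hole, turning any completion from [X] into one
    from [A]. Each round enlarges [X] until it is full, so [n] rounds suffice. *)
Lemma prim_cmd_ok s A T : ctx s -> isset s aX A -> A != set0 -> (n * (n * (n * 8 + 10) + 20) + 2 <= T)%N ->
  run prim_cmd s T (fun s' => exists2 m, prim wB A m & var s' vC = var s vC + m).
Proof.
move=> cs xs A0 TT; have [sn _ _ _] := cs.
apply: (run_weaken (@run_for lo hi vPI vN _ s n (n * (n * 8 + 10) + 18)
  (fun j s' => exists X acc, [/\ isset s' aX X, X != set0, var s' vC = var s vC + acc,
      (j <= #|X|)%N & forall m, prim wB X m -> prim wB A (acc + m)]) _ _ _ sn _ _)) => //.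
- by exists A, 0; split=> //=; [rewrite addr0|move=> m; rewrite add0r].
- move=> j s' jn fr sj [X [acc [xX X0 sc jX hX]]]; have cs' := ctx_frame fr isT cs.
  sq (n * (n * 8 + 10) + 10)%N.
  apply: (run_weaken (@scan_ok X _ _ cs' xX (leqnn _))) => // s1 fr1 [F1 F2].
  have [fv _ _] := fr1; have x1 := isset_frame fr1 xX isT.
  have c1 : var s1 vC = var s vC + acc by rewrite fv.
  case: F2 => [[f0 fb]|[f1 [x [y [sy xX' yX sbe]]]]].
    have XT : X = setT.
      apply/setP=> y; rewrite inE; apply: contraT => yX; have /set0Pn [x xX'] := X0.
      have := F1 x y I xX' yX.
      by rewrite fb leNgt Bbig // idx_lt.
    apply: run_if; [lia| |] => /=; rewrite f0 // => _.
    apply: run_skip; first lia.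
    exists X, acc; split=> //.
    by rewrite XT cardsT card_ord.
  apply: run_if; [lia| |] => /=; rewrite f1 // => _.
  sq 1%N; asn; put.
  exists (y |: X), (acc + wB x y); split=> /=.
  + move=> i; rewrite sy absz_nat /= !inE; have [e|ne] := eqVneq (i : nat) y.
      by rewrite (_ : i == y) //; apply/eqP/val_inj.
    by rewrite x1; have -> : (i == y) = false by apply: contraNF ne => /eqP ->.
  + by apply/set0Pn; exists y; rewrite !inE eqxx.
  + by rewrite c1 sbe addrA.
  + by rewrite cardsU1 yX add1n; lia.
  + move=> m hm; rewrite -addrA; apply: hX; apply: prim_step => // x' y' h1 h2.
    by rewrite -sbe; apply: F1.
- lia.
- move=> s' _ [[X [acc [xX X0 sc jX hX]]] _]; exists acc => //.
  rewrite -[acc]addr0; apply: hX; have -> : X = setT; last by left.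
  by apply/eqP; rewrite eqEcard subsetT cardsT card_ord.
Qed.

Lemma cost_cmd_ok s A T : ctx s -> isset s aT A -> A != set0 ->
  (20 * (n.+1 * (n.+1 * n.+1)) + 20 <= T)%N ->
  run cost_cmd s T (fun s' => exists2 m, prim wB A m &
    var s' vC = \sum_(u < n) \big[Num.min/big]_(w in A) wA u w + m).
Proof.
move=> cs ts A0 TT; rewrite /cost_cmd.
sq 1%N; asn; sq 1%N; asn.
set s0 := setv _ _ _; have cs0 : ctx s0 by case: cs.
sq (n * (n * 5 + 10) + 2)%N.
apply: (run_weaken (@median_ok A A0 s0 _ cs0 ts erefl erefl (leqnn _))) => // s1 fr1 c1.
have cs1 := ctx_frame fr1 isT cs0; have ts1 := isset_frame fr1 ts isT.
have [sn1 _ _ _] := cs1.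
sq (n * 3 + 2)%N.
apply: (run_weaken (copy_ok (isT : aX != aT) sn1 ts1 (leqnn _))) => // s2 fr2 x2.
have cs2 := ctx_frame fr2 isT cs1.
apply: (run_weaken (prim_cmd_ok cs2 x2 A0 (leqnn _))); first nia.
move=> s' _ [m hm ->]; exists m => //.
by have [fv _ _] := fr2; rewrite fv // c1.
Qed.
End Cost.

(** * Local search *)

(** The product of [vQ] and the saving is formed by repeated addition, which is affordable as [q] is
    linear in [n]. An accepted set is copied to [aS] only; the enumeration goes on around the set in
    [aT]. *)
Definition test_cmd :=
  Seq (Asn vDD (Minus (Var vCUR) (Var vC))) (Seq (Asn vZ (Cst 0))
  (Seq (For vZI vQ (Asn vZ (Plus (Var vZ) (Var vDD))))
  (If (Minus (Var vZ) (Var vCUR))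
    (Seq (copy aS aT) (Seq (Asn vCUR (Var vC)) (Asn vFLAG (Cst 1)))) Skip))).

(* Variables 0 to 29 are the named ones. *)
Definition va j := (30 + 2 * j)%N.
Definition vb j := (31 + 2 * j)%N.

(* Visits every set at most [j] swaps away from the set in array [aT], which is
   restored at the end. *)
Fixpoint try_cmd j :=
  let leaf := Seq cost_cmd test_cmd in
  if j is j'.+1 then
    Seq leaf (For (va j') vN (For (vb j') vN
      (If (Get aT (Var (va j'))) (If (Get aT (Var (vb j'))) Skip
        (Seq (Put aT (Var (va j')) (Cst 0)) (Seq (Put aT (Var (vb j')) (Cst 1))
        (Seq (try_cmd j')
        (Seq (Put aT (Var (va j')) (Cst 1)) (Put aT (Var (vb j')) (Cst 0)))))))
      Skip)))
  else leaf.

Definition search_loop p :=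
  While (Var vFLAG) (Seq (Asn vFLAG (Cst 0)) (Seq (copy aT aS) (try_cmd p))).

Definition search p :=
  Seq (copy aT aS) (Seq cost_cmd (Seq (Asn vCUR (Var vC)) (Seq (Asn vFLAG (Cst 1))
    (search_loop p)))).

(** For a symbolic depth [j] the frame conditions cannot be decided by computation; ranges of
    variables take their place. *)
Lemma modv_try j : all (fun x => (4 <= x)%N && (x < 30 + 2 * j)%N) (modv (try_cmd j)).
Proof.
elim: j => [|j IH] //.
have {}IH : all (fun x => (4 <= x)%N && (x < 30 + 2 * j.+1)%N) (modv (try_cmd j)).
  by apply: sub_all IH => x; lia.
rewrite /= !all_cat /= IH /va /vb; lia.
Qed.

Lemma moda_try j : all (fun a => (3 <= a <= 5)%N) (moda (try_cmd j)).
Proof. by elim: j => [|j IH] //=; rewrite !all_cat /= IH. Qed.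

Lemma try_frame j s s' : frame (try_cmd j) s s' ->
  (forall x, (x < 4)%N || (30 + 2 * j <= x)%N -> var s' x = var s x) /\
  (forall a, (a < 3)%N || (5 < a)%N -> forall i, arr s' a i = arr s a i).
Proof.
move=> [fv fa _]; split.
  move=> x hx; apply: fv; apply/negP => /(allP (modv_try j)); lia.
move=> a ha; apply: fa; apply/negP => /(allP (moda_try j)); lia.
Qed.

Section Search.
Variables (lo hi n : nat) (fA fB : nat -> int) (big : int).
Hypothesis Abig : forall i, (i < n * n)%N -> fA i < big.
Hypothesis Bbig : forall i, (i < n * n)%N -> fB i < big.
Variable F : {set 'I_n} -> int.
Hypothesis FE : forall A m, A != set0 -> prim (@wB n fB) A m ->
  \sum_(u < n) \big[Num.min/big]_(w in A) wA fA u w + m = F A.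
Hypothesis F0 : forall A, A != set0 -> 0 <= F A.
Variables k q : nat.
Hypothesis k0 : (0 < k)%N.
Hypothesis q0 : (0 < q)%N.
Local Notation run := (run lo hi).
Local Notation ctx := (ctx n fA fB big).

(** This is [F B < (1 - 1/q) * F A], multiplied out to stay in the integers. *)
Definition better A B := F A < q%:Z * (F A - F B).

Lemma better_lt A B : A != set0 -> better A B -> F B < F A.
Proof. by move=> /F0; rewrite /better; nia. Qed.

(** The incumbent may be replaced several times in one pass; the last one must still beat the first
    by the required factor. *)
Lemma better_trans A B C : A != set0 -> B != set0 -> better A B -> better B C -> better A C.
Proof. move=> A0 B0 ab /(better_lt B0); move: ab; rewrite /better; nia. Qed.

Definition good (A : {set 'I_n}) s :=
  [/\ ctx s, isset s aS A, var s vCUR = F A, var s vQ = q%:Z & #|A| = k].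

Lemma card_set0 (A : {set 'I_n}) : #|A| = k -> A != set0.
Proof. by move=> h; rewrite -card_gt0 h. Qed.

Definition leaf_time := (20 * (n.+1 * (n.+1 * n.+1)) + (q * 3 + (n * 3 + 40)))%N.

(** The outcomes of a part of a pass that tests the sets in [P]. After an acceptance nothing is
    claimed about [P], because another pass will follow. *)
Definition step (P : {set 'I_n} -> Prop) A (f : int) A' s' :=
  good A' s' /\
  (A' = A /\ var s' vFLAG = f /\ (forall B, P B -> ~ better A B) \/
   var s' vFLAG = 1 /\ better A A').

Lemma leaf_ok A B s T : good A s -> isset s aT B -> #|B| = k -> (leaf_time <= T)%N ->
  run (Seq cost_cmd test_cmd) s T (fun s' => isset s' aT B /\
    exists A', step (fun C => C = B) A (var s vFLAG) A' s').
Proof.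
move=> [cs sS sc sq' cA] sT cB; rewrite /leaf_time => TT.
have B0 := card_set0 cB; have A0 := card_set0 cA.
sq (20 * (n.+1 * (n.+1 * n.+1)) + 20)%N.
apply: (run_weaken (cost_cmd_ok lo hi Abig Bbig cs sT B0 (leqnn _))) => // s1 fr1 [m pm c1].
have {pm m} c1 : var s1 vC = F B by rewrite c1 (FE B0 pm).
have cs1 := ctx_frame fr1 isT cs; have sT1 := isset_frame fr1 sT isT.
have sS1 := isset_frame fr1 sS isT; have [fv1 _ _] := fr1; have [sn1 _ _ _] := cs1.
have scur : var s1 vCUR = F A by rewrite fv1.
have sq1 : var s1 vQ = q%:Z by rewrite fv1.
rewrite /test_cmd; sq 1%N; asn; sq 1%N; asn; sq (q * 3 + 2)%N.
set s2 := setv _ _ _.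
apply: (run_weaken (@run_for lo hi vZI vQ _ s2 q 1
  (fun j s' => var s' vZ = j%:Z * (F A - F B)) _ _ _ sq1 _ _)) => //.
- by rewrite /= mul0r.
- move=> j s' jn [fv _ _] _ Ij; asn; rewrite Ij (fv vDD) //= scur c1; lia.
move=> s3 fr3 [z3 _]; have [fv3 _ _] := fr3.
have cs2 : ctx s2 by case: cs1.
have cs3 := ctx_frame fr3 isT cs2; have sT3 := isset_frame fr3 sT1 isT.
have sS3 := isset_frame fr3 sS1 isT; have [sn3 _ _ _] := cs3.
have scur3 : var s3 vCUR = F A by rewrite fv3.
have sq3 : var s3 vQ = q%:Z by rewrite fv3.
apply: run_if => /=; [lia| |]; rewrite z3 scur3 => h.
  sq (n * 3 + 2)%N.
  apply: (run_weaken (copy_ok lo hi (isT : aS != aT) sn3 sT3 (leqnn _))) => // s4 fr4 sS4.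
  have cs4 := ctx_frame fr4 isT cs3; have sT4 := isset_frame fr4 sT3 isT.
  have [fv4 _ _] := fr4.
  sq 1%N; asn; asn; split=> //; exists B; split.
    split=> //=; first by rewrite fv4 // fv3.
    by rewrite fv4.
  by right; split=> //; rewrite /better -subr_gt0.
apply: run_skip; [lia|]; split=> //; exists A; split; first by split.
left; split=> //; split; first by rewrite fv3 //= fv1.
by move=> C ->; rewrite /better -subr_gt0 => b; rewrite b in h.
Qed.

(** Mirrors the recursion of [try_cmd]; reflexivity holds at every depth because each level tests
    its own starting set. *)
Inductive reach : nat -> {set 'I_n} -> {set 'I_n} -> Prop :=
| reach_refl (j : nat) (B : {set 'I_n}) : reach j B B
| reach_step (j : nat) (B C : {set 'I_n}) (a b : 'I_n) : a \in B -> b \notin B -> reach j (b |: B :\ a) C ->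
    reach j.+1 B C.

Fixpoint try_time j :=
  if j is j'.+1 then (leaf_time + (n * (n * (try_time j' + 10) + 10) + 10))%N
  else leaf_time.

Lemma card_swap (B : {set 'I_n}) a b : a \in B -> b \notin B -> #|b |: B :\ a| = #|B|.
Proof.
by move=> aB bB; rewrite cardsU1 !inE (negPf bB) andbF (cardsD1 a B) aB.
Qed.

Lemma step_trans P Q A1 A2 A3 s2 s3 f : A1 != set0 -> A2 != set0 ->
  step P A1 f A2 s2 ->
  step Q A2 (var s2 vFLAG) A3 s3 -> step (fun B => P B \/ Q B) A1 f A3 s3.
Proof.
move=> A10 A20 [_ h1] [g3 h2]; split=> //.
case: h1 => [[e1 [f1 n1]]|[f1 b1]]; case: h2 => [[e2 [f2 n2]]|[f2 b2]].
- left; rewrite e2 e1; split=> //; split; first by rewrite f2 f1.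
  by move=> B [/n1|/n2] //; rewrite e1.
- by right; split=> //; rewrite -e1.
- by right; rewrite f2 f1 e2.
- by right; split=> //; apply: better_trans b1 b2.
Qed.

Lemma step_sub (P Q : {set 'I_n} -> Prop) A1 A2 s2 f : (forall B, Q B -> P B) ->
  step P A1 f A2 s2 -> step Q A1 f A2 s2.
Proof.
move=> h [g [[e [f' nb]]|r]]; split=> //; last by right.
by left; split=> //; split=> // B /h; apply: nb.
Qed.

Lemma good_ext A s s' : (forall x, (x <= 4)%N -> var s' x = var s x) ->
  (forall a, (a <= 3)%N -> forall i, arr s' a i = arr s a i) -> good A s -> good A s'.
Proof.
move=> hv ha [[c1 c2 c3 c4] sS sc sq' cA]; split=> //; rewrite ?hv //.
- by split; rewrite ?hv // => i ii; rewrite ha //; [apply: c3|apply: c4].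
- by move=> i; rewrite ha.
Qed.

Lemma step_ext P A f A' s s' : (forall x, (x <= 6)%N -> var s' x = var s x) ->
  (forall a, (a <= 3)%N -> forall i, arr s' a i = arr s a i) ->
  step P A f A' s -> step P A f A' s'.
Proof.
move=> hv ha [g h]; split; last by rewrite hv.
by apply: good_ext g => // x x4; apply: hv; lia.
Qed.

(** The enumeration stays centred at [B] while the incumbent may change. Verdicts of successive
    parts combine by [step_trans], since without an acceptance they all refer to the same
    incumbent. *)
Lemma try_ok j A B s T : good A s -> isset s aT B -> #|B| = k -> (try_time j <= T)%N ->
  run (try_cmd j) s T (fun s' => isset s' aT B /\
    exists A', step (reach j B) A (var s vFLAG) A' s').
Proof.
elim: j A B s T => [|j IH] A B s T gs sT cB TT.
  apply: (run_weaken (leaf_ok gs sT cB TT)) => // s' _ [sT' [A' st]]; split=> //.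
  exists A'; apply: step_sub st => C h; inversion h; subst => //.
rewrite /try_cmd -/try_cmd; move: TT; rewrite /try_time -/try_time => TT.
sq leaf_time; apply: (run_weaken (leaf_ok gs sT cB (leqnn _))) => // s1 _ [sT1 [A1 st1]].
have [gs1 _] := st1; have [cs1 _ _ _ cA1] := gs1; have [sn1 _ _ _] := cs1.
have [_ _ _ _ cA] := gs.
have A0 := card_set0 cA; have A10 := card_set0 cA1.
set body := If _ _ _.
have mb : all (fun x => (4 <= x)%N && (x < 30 + 2 * j)%N) (modv body).
  by rewrite /body /= !cats0 modv_try.
have ma : all (fun a => (3 <= a <= 5)%N) (moda body).
  by rewrite /body /= !cats0 all_cat /= moda_try.
have nb x : (x < 4)%N || (30 + 2 * j <= x)%N -> x \notin modv body.
  by move=> hx; apply/negP => /(allP mb); lia.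
have na x : (x < 3)%N || (5 < x)%N -> x \notin moda body.
  by move=> hx; apply/negP => /(allP ma); lia.
(* The sets reached through a swap that precedes [(a, b)] lexicographically, hence already visited
   by the two loops. *)
pose R a b C := exists x y : 'I_n, [/\ (x < a)%N \/ (x = a :> nat /\ (y < b)%N), x \in B, y \notin B & reach j (y |: B :\ x) C].
pose J f (a b : nat) s' := isset s' aT B /\ exists A', step (R a b) A1 f A' s'.
have J_setv f a b s' x v : (6 < x)%N -> J f a b s' -> J f a b (setv s' x v).
  move=> x6 [h1 [A' h2]]; split=> //; exists A'; apply: step_ext h2 => // y y6 /=.
  by rewrite eqnE; case: eqP => // e; lia.
have J_sub f a b a' b' s' : (forall C, R a' b' C -> R a b C) -> J f a b s' -> J f a' b' s'.
  by move=> h [h1 [A' h2]]; split=> //; exists A'; apply: step_sub h2.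
have vaN : va j != vN by rewrite /va; lia.
have vbN : vb j != vN by rewrite /vb; lia.
have ab : va j != vb j by rewrite /va /vb; lia.
have nba : va j \notin modv body by apply: nb; rewrite /va; lia.
have nbb : vb j \notin modv body by apply: nb; rewrite /vb; lia.
apply: (run_weaken (@run_for lo hi (va j) vN _ s1 n (n * (try_time j + 10) + 4)
   (fun a s' => J (var s1 vFLAG) a 0%N s') vaN _ _ sn1 _ _)).
- by rewrite notin_for ab nba.
- by rewrite notin_for (eq_sym vN); apply/andP; split=> //; apply: nb.
- apply: J_setv; first by rewrite /va; lia.
  split=> //; exists A1; split=> //; left; split=> //; split=> // C [x [y [[|[_]] //]]].
- move=> a s2 an fr2 s2a J2; have [fv2 _ _] := fr2.
  have sn2 : var s2 vN = n%:Z.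
    by rewrite fv2 // !notin_for !(eq_sym vN); apply/and3P; split=> //; apply: nb.
  eapply run_weaken; [apply: (@run_for lo hi (vb j) vN body s2 n (try_time j + 8)%N
    (fun b s' => J (var s1 vFLAG) a b s') vbN nbb (nb vN isT) sn2)| |].
  + by apply: J_setv => //; rewrite /vb; lia.
  + move=> b s3 bn fr3 s3b J3; have [fv3 _ _] := fr3.
    have s3a : var s3 (va j) = a%:Z.
      by rewrite fv3 // notin_for ab nba.
    pose ao := Ordinal an; pose bo := Ordinal bn.
    have [sT3 [A3 st3]] := J3.
    have skip : ~~ ((ao \in B) && (bo \notin B)) -> J (var s1 vFLAG) a b.+1 (setv s3 (vb j) b.+1%:Z).
      move=> h; apply: J_setv; first by rewrite /vb; lia.
      apply: J_sub J3 => C [x [y [xy xB yB rr]]]; exists x, y; split=> //.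
      case: xy => [|[xa yb]]; [by left|right; split=> //].
      move: yb; rewrite ltnS leq_eqVlt => /orP[/eqP yb|//]; case/negP: h.
      have -> : ao = x by apply: val_inj.
      by have -> : bo = y by [apply: val_inj]; rewrite xB yB.
    apply: run_if => /=; [lia| |]; rewrite s3a absz_nat (sT3 ao); last first.
      move=> h; apply: run_skip; [lia|apply: skip].
      by move: h; case: (ao \in B).
    case aB: (ao \in B) => // _.
    apply: run_if => /=; [lia| |]; rewrite s3b absz_nat (sT3 bo).
      move=> h; apply: run_skip; [lia|apply: skip].
      by move: h; case: (bo \in B); rewrite ?andbF.
    case bB: (bo \in B) => // _.
    sq 1%N; put; sq 1%N; put; sq (try_time j).
    rewrite s3a s3b !absz_nat.
    set s4 := seta _ _ _ _; pose B1 := bo |: B :\ ao.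
    have sT4 : isset s4 aT B1.
      move=> i; rewrite /s4 /= /B1 !inE.
      have -> : (i == bo) = (i == b :> nat) by [].
      have -> : (i == ao) = (i == a :> nat) by [].
      by case: (i == b :> nat) => //; case: (i == a :> nat) => //=; rewrite sT3.
    have gs3 : good A3 s3 by case: st3.
    have gs4 : good A3 s4 by apply: good_ext gs3 => // c c3 i /=; case: c c3 => [|[|[|[|]]]].
    have cB1 : #|B1| = k by rewrite card_swap ?aB ?bB.
    apply: (run_weaken (IH A3 B1 s4 _ gs4 sT4 cB1 (leqnn _))) => // s5 fr5 [sT5 [A5 st5]].
    have [fv5 _] := try_frame fr5.
    have s5a : var s5 (va j) = a%:Z by rewrite fv5 //= /va; lia.
    have s5b : var s5 (vb j) = b%:Z by rewrite fv5 //= /vb; lia.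
    sq 1%N; put; put; rewrite s5a s5b !absz_nat.
    set s6 := seta _ _ _ _.
    apply: J_setv; first by rewrite /vb; lia.
    split.
      move=> i; rewrite /s6 /= sT5 /B1 !inE.
      have -> : (i == bo) = (i == b :> nat) by [].
      have -> : (i == ao) = (i == a :> nat) by [].
      have [e|_] := eqVneq (i : nat) b; first by rewrite (_ : i = bo) ?bB //; apply: val_inj.
      by have [e|//] := eqVneq (i : nat) a; first by rewrite (_ : i = ao) ?aB //; apply: val_inj.
    exists A5; have cA3 : #|A3| = k by case: gs3.
    have st6 : step (reach j B1) A3 (var s3 vFLAG) A5 s6.
      by apply: step_ext st5 => // c c3 i /=; case: c c3 => [|[|[|[|]]]].
    apply: step_sub (step_trans A10 (card_set0 cA3) st3 st6) => C [x [y [xy xB yB rr]]].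
    have [e|ne] := boolP ((x == ao) && (y == bo)).
      by right; move: rr; case/andP: e => /eqP -> /eqP ->.
    left; exists x, y; split=> //; case: xy => [|[xa yb]]; [by left|right; split=> //].
    move: yb; rewrite ltnS leq_eqVlt => /orP[/eqP yb|//].
    by case/negP: ne; apply/andP; split; apply/eqP; apply: val_inj.
  + lia.
  + move=> s3 _ [J3 _]; apply: J_setv; first by rewrite /va; lia.
    apply: J_sub J3 => C [x [y [xy xB yB rr]]]; exists x, y; split=> //.
    case: xy => [|[//]]; rewrite ltnS leq_eqVlt => /orP[/eqP xa|]; last by left.
    by right; split.
- lia.
move=> s' _ [[sT' [A' st']] _]; split=> //; exists A'.
apply: step_sub (step_trans A0 A10 st1 st') => C rC; inversion rC; subst; first by left.
right; exists a, b; split=> //; left; exact: ltn_ord.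
Qed.

(** Swapping an element of [B :\: C] for one of [C :\: B] shrinks the difference by one; equal
    cardinals make both nonempty together. *)
Lemma reach_near j (B C : {set 'I_n}) : #|B| = #|C| -> (#|B :\: C| <= j)%N -> reach j B C.
Proof.
elim: j B => [|j IH] B BC le.
  move: le; rewrite leqn0 cards_eq0 setD_eq0 => sBC.
  have -> : C = B by apply/esym/eqP; rewrite eqEcard sBC BC leqnn.
  exact: reach_refl.
have [e|] := eqVneq (B :\: C) set0.
  have -> : C = B by apply/esym/eqP; rewrite eqEcard BC leqnn -setD_eq0 e eqxx.
  exact: reach_refl.
move=> /set0Pn [a aBC]; have := aBC; rewrite inE => /andP[aC aB].
have /set0Pn [b] : C :\: B != set0.
  rewrite -card_gt0; have := cardsID C B; have := cardsID B C.
  rewrite setIC BC => e1 e2; have : (0 < #|B :\: C|)%N by apply/card_gt0P; exists a.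
  by move: e1 e2; lia.
rewrite inE => /andP[bB bC].
apply: (reach_step aB bB); apply: IH; first by rewrite card_swap.
rewrite -ltnS; apply: leq_trans le; rewrite [in X in (_ < X)%N](cardsD1 a) aBC add1n ltnS.
apply: subset_leq_card; apply/subsetP => x; rewrite !inE.
case: eqP => [->|_] /=; first by rewrite bC.
by move=> /andP[-> /andP[-> ->]].
Qed.

(** Bernoulli's inequality gives [(1 + 1/q) ^ q >= 2]; hence [q * E] improvements exhaust an initial
    cost below [2 ^ E]. *)
Lemma pow_ratio E : (2 ^ E * q ^ (q * E) <= q.+1 ^ (q * E))%N.
Proof.
have bern m : (q ^ m + m * q ^ m.-1 <= q.+1 ^ m)%N.
  elim: m => [|m IH]; first by rewrite !expn0.
  rewrite [(q.+1 ^ _)%N]expnS mulSn; apply: leq_trans (_ : q ^ m + q * (q ^ m + m * q ^ m.-1) <= _)%N.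
    case: m {IH} => [|m] /=; first by rewrite !expn0; lia.
    by rewrite !expnS; nia.
  rewrite leq_add //; last by rewrite leq_mul2l IH orbT.
  by apply: leq_trans IH; apply: leq_addr.
have two : (2 * q ^ q <= q.+1 ^ q)%N.
  apply: leq_trans (bern q); rewrite -[(q * q ^ _)%N]expnS prednK //.
  by rewrite mul2n addnn.
case: E => [|E]; first by rewrite muln0.
by rewrite !expnM -expnMn leq_exp2r.
Qed.

Definition pass_time p := (try_time p + (n * 3 + 10))%N.

Definition local_opt p A :=
  forall B : {set 'I_n}, #|B| = k -> (#|A :\: B| <= p)%N -> ~ better A B.

Lemma search_ok p A s E T : ctx s -> isset s aS A -> var s vQ = q%:Z -> #|A| = k ->
  F A < (2 ^ E)%N%:Z -> ((q * E + 1) * pass_time p + (leaf_time + 20) <= T)%N ->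
  run (search p) s T (fun s' => exists A', good A' s' /\ local_opt p A').
Proof.
move=> cs sS sq' cA FAE TT; have [sn _ _ _] := cs; have A0 := card_set0 cA.
rewrite /search; sq (n * 3 + 2)%N; first by rewrite /leaf_time in TT; lia.
apply: (run_weaken (copy_ok lo hi (isT : aT != aS) sn sS (leqnn _))) => // s1 fr1 sT1.
have cs1 := ctx_frame fr1 isT cs; have sS1 := isset_frame fr1 sS isT.
have [fv1 _ _] := fr1.
sq (20 * (n.+1 * (n.+1 * n.+1)) + 20)%N; first by rewrite /leaf_time in TT; lia.
apply: (run_weaken (cost_cmd_ok lo hi Abig Bbig cs1 sT1 A0 (leqnn _))) => // s2 fr2 [m pm c2].
have {pm m} c2 : var s2 vC = F A by rewrite c2 (FE A0 pm).
have cs2 := ctx_frame fr2 isT cs1; have sS2 := isset_frame fr2 sS1 isT.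
have [fv2 _ _] := fr2.
have sq2 : var s2 vQ = q%:Z by rewrite fv2 // fv1.
rewrite /leaf_time in TT.
sq 1%N; asn; sq 1%N; asn; rewrite /search_loop.
(* While the flag is up, [F A] is below [((q + 1) / q) ^ m'], and an improvement removes one factor
   since [1 - 1/q <= q / (q + 1)]. The index is one larger to count the last pass, which leaves the
   flag down. *)
pose J m s' := exists A, good A s' /\
  ((var s' vFLAG = 1 /\ exists2 m', m = m'.+1 & F A * (q ^ m')%N%:Z < (q.+1 ^ m')%N%:Z) \/
   (var s' vFLAG = 0 /\ local_opt p A)).
set s3 := setv _ _ _.
have pow0 x y : (0 < x)%N -> (0 < x ^ y)%N by rewrite expn_gt0 => ->.
have J0 : J (q * E).+1 s3.
  exists A; split; first by split.
  left; split=> //; exists (q * E)%N => //.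
  have := pow_ratio E; have := pow0 q (q * E)%N q0; have := F0 A0; nia.
apply: (run_weaken (@run_while_idx lo hi (Var vFLAG) _ s3 (try_time p + (n * 3 + 5)) (q * E).+1 J J0 _)).
- move=> m s' mN fr [A' [gA' h]] /= fl.
  case: h => [[f1 [m' em lt]]|[f0 _]]; last by rewrite f0 in fl.
  sq 1%N; asn; set s4 := setv _ _ _.
  have g4 : good A' s4 by apply: good_ext gA' => // x x4 /=; case: x x4 => [|[|[|[|[|]]]]].
  have [cs4 sS4 _ _ cA'] := g4; have [sn4 _ _ _] := cs4; have A'0 := card_set0 cA'.
  sq (n * 3 + 2)%N.
  apply: (run_weaken (copy_ok lo hi (isT : aT != aS) sn4 sS4 (leqnn _))) => // s5 fr5 sT5.
  have [fv5 fa5 _] := fr5.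
  have g5 : good A' s5.
    apply: good_ext g4 => [x x4|a a3 i].
      by rewrite fv5 //; case: x x4 => [|[|[|[|[|]]]]].
    by rewrite fa5 //; case: a a3 => [|[|[|[|]]]].
  have f5 : var s5 vFLAG = 0 by rewrite fv5.
  have tle : (try_time p <= try_time p + (n * 3 + 5) - 1 - (n * 3 + 2))%N by lia.
  apply: (run_weaken (try_ok g5 sT5 cA' (leqnn _)) tle) => s6 _ [_ [A6 [g6 h6]]].
  have [_ _ _ _ cA6] := g6; have A60 := card_set0 cA6.
  exists m'; first by rewrite em.
  exists A6; split=> //.
  case: h6 => [[eA [f6 nb]]|[f6 bt]].
    right; split; first by rewrite f6.
    by move=> B cB near; rewrite eA in near *; apply: nb; apply: reach_near near; rewrite cA'.
  left; split=> //; have blt := better_lt A'0 bt.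
  (* With no factor left the cost is an integer below 1, hence 0, and nothing can have been
     accepted. *)
  case: m' {em} lt => [|m'] lt.
    move: lt bt; rewrite !expn0 mulr1 /better => lt bt.
    have := F0 A'0; have := F0 A60; lia.
  exists m' => //.
  have h1 : q.+1%:Z * F A6 <= q%:Z * F A'.
    by move: bt; rewrite /better; have := F0 A'0; nia.
  have qm : 0 <= (q ^ m')%N%:Z by [].
  have := ler_wpM2r qm h1; move: lt; rewrite !expnS !PoszM => l1 l2.
  rewrite -(ltr_pM2l (_ : 0 < q.+1%:Z)) //; apply: le_lt_trans l1.
  by rewrite [in leRHS]mulrA (mulrC (F A')) [leLHS]mulrA.
- rewrite /pass_time in TT; nia.
move=> s' _ [[m [A' [g' h]]] nfl]; exists A'; split=> //.
by case: h => [[f1 _]|[_ //]]; rewrite /= f1 in nfl.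
Qed.
End Search.

(** * Starting set, constants of the search, and output *)

Definition init_set := For vI vN (If (Minus (Var vK) (Var vI))
  (Put aS (Var vI) (Cst 1)) (Put aS (Var vI) (Cst 0))).
(** Since [vBIG] starts at 1 and weights are nonnegative, the sum is a strict bound on each of
    them. *)
Definition init_big := For vI vNN (Asn vBIG (Plus (Var vBIG)
  (Plus (Get aMA (Var vI)) (Get aMB (Var vI))))).
Definition init_q N := For vI vN (Asn vQ (Plus (Var vQ) (Cst (Posz N)))).

Definition setup N :=
  Seq (Asn vK (Get aIN (Cst 1))) (Seq init_set (Seq (Asn vBIG (Cst 1))
  (Seq init_big (Seq (Asn vQ (Cst 0)) (init_q N))))).

(** Output cells below [lo] are registers in use while the program runs; [finish] fills those from
    the array. *)
Definition output_cmd lo :=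
  Seq (Asn vA (Cst (Posz lo))) (While (Minus (Var vN) (Var vA))
    (Seq (Asn vXX (Get aS (Var vA))) (Seq (Out vA vXX) (incr vA)))).

Section Setup.
Variables (lo hi n : nat).
Local Notation run := (run lo hi).

Lemma setup_ok N k s T : var s vN = n%:Z -> var s vNN = (n * n)%N%:Z ->
  arr s aIN 1 = k%:Z -> (n * n * 3 + n * 10 + 20 <= T)%N ->
  run (setup N) s T (fun s' => [/\ isset s' aS [set i : 'I_n | (i < k)%N],
    var s' vBIG = 1 + \sum_(i < n * n) (arr s aMA i + arr s aMB i) &
    var s' vQ = (n * N)%N%:Z]).
Proof.
move=> sn snn sk TT; rewrite /setup; sq 1%N; asn; rewrite sk.
set s0 := setv _ _ _.
sq (n * 4 + 2)%N.
apply: (run_weaken (@run_for lo hi vI vN _ s0 n 2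
  (fun j s' => forall i : 'I_n, (i < j)%N -> arr s' aS i = (nat_of_bool (i < k)%N)%:Z) _ _ _ sn _ _)) => //.
  move=> j s' jn [fv _ _] sj Ij.
  have sk' : var s' vK = k%:Z by rewrite fv.
  have key (v : int) : v = (nat_of_bool (j < k)%N)%:Z -> forall i : 'I_n, (i < j.+1)%N ->
     (if (i == j :> nat) then v else arr s' aS i) = (nat_of_bool (i < k)%N)%:Z.
    by move=> ev i ij; have [->|ne] := eqVneq (i : nat) j => //; apply: Ij; lia.
  apply: run_if => //=; rewrite sk' sj => h; put; rewrite sj /=; apply: key.
    by have -> : (j < k)%N by lia.
  by have -> : (j < k)%N = false by lia.
move=> s1 [fv1 fa1 _] [I1 _].
sq 1%N; asn; set s2 := setv _ _ _; sq (n * n * 3 + 2)%N.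
have s2nn : var s2 vNN = (n * n)%N%:Z by rewrite /s2 /= fv1.
apply: (run_weaken (@run_for lo hi vI vNN _ s2 (n * n) 1
  (fun j s' => var s' vBIG = 1 + \sum_(i < j) (arr s aMA i + arr s aMB i)) _ _ _ s2nn _ _)) => //.
- by rewrite /= big_ord0 addr0.
- move=> j s' jn [_ fa _] sj Ij; asn; rewrite sj Ij absz_nat !fa //= !fa1 //=.
  by rewrite big_ord_recr /= [RHS]addrA.
move=> s3 [fv3 fa3 _] [I3 _].
sq 1%N; asn; set s4 := setv _ _ _.
have s4n : var s4 vN = n%:Z by rewrite /s4 /= fv3 //= fv1.
apply: (run_weaken (@run_for lo hi vI vN _ s4 n 1
  (fun j s' => var s' vQ = (j * N)%N%:Z) _ _ _ s4n _ _)) => //.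
- move=> j s' jn _ sj Ij; asn; rewrite Ij mulSn; lia.
- lia.
move=> s5 [fv5 fa5 _] [I5 _]; split=> //.
- move=> i; rewrite fa5 //= fa3 //= I1 ?ltn_ord //; by rewrite inE.
- by rewrite fv5.
Qed.

Lemma output_ok (A : {set 'I_n}) s T : (n <= hi)%N -> var s vN = n%:Z -> isset s aS A ->
  (n * 4 + 10 <= T)%N ->
  run (output_cmd lo) s T (fun s' => isset s' aS A /\
    forall i : 'I_n, (lo <= i)%N -> low s' i = (nat_of_bool (i \in A))%:Z).
Proof.
move=> nhi sn sS TT; rewrite /output_cmd; sq 1%N; asn; set s0 := setv _ _ _.
pose J s' := exists a, [/\ var s' vA = a%:Z, (lo <= a)%N, isset s' aS A &
  forall i : 'I_n, (lo <= i < a)%N -> low s' i = (nat_of_bool (i \in A))%:Z].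
apply: (run_weaken (@run_while lo hi (Minus (Var vN) (Var vA)) _ s0 3 n (fun s' => n - `|var s' vA|)%N J _ _ _)) => //.
- exists lo; split=> // i; lia.
- lia.
- move=> s' [fv _ _] [a [sa la sS' lw]] /=; have sn' : var s' vN = n%:Z by rewrite fv.
  rewrite sn' sa => an; have {}an : (a < n)%N by lia.
  sq 1%N; asn; sq 1%N; apply: run_out => //=; first by rewrite sa; lia.
  asn; rewrite sa absz_nat; split; last by lia.
  exists a.+1; split=> //=; [lia|lia|].
  move=> i hi'; have [e|ne] := eqVneq (i : nat) a; last by apply: lw; lia.
  by rewrite -(sS' i) e.
- lia.
move=> s' [fv _ _] [[a [sa la sS' lw]] /=]; have sn' : var s' vN = n%:Z by rewrite fv.
rewrite sn' sa => an; split=> // i li; apply: lw; have := ltn_ord i; lia.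
Qed.
End Setup.

(** * Correctness of the scaled instance *)

Lemma idx_inj n (i j i' j' : 'I_n) : (i * n + j = i' * n + j')%N -> i = i' /\ j = j'.
Proof.
move=> e; have n0 : (0 < n)%N by case: n i {j i' j' e} => [[]|].
have := congr1 (divn^~ n) e; rewrite /= !divnMDl // !divn_small // !addn0 => ei.
by split; apply: val_inj => //=; move: e; rewrite ei; lia.
Qed.

Lemma idx_surj n l : (l < n * n)%N -> exists u w : 'I_n, l = (u * n + w)%N.
Proof.
move=> ln; have n0 : (0 < n)%N by case: n ln.
have h1 : (l %/ n < n)%N by rewrite ltn_divLR.
have h2 : (l %% n < n)%N by rewrite ltn_mod.
by exists (Ordinal h1), (Ordinal h2); rewrite /= -divn_eq.
Qed.

Lemma lt_pow_ibits (z : int) : (`|z| < 2 ^ ibits z)%N.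
Proof. exact: trunc_log_ltn. Qed.

Section Instance.
Variables (n : nat) (d : 'I_n -> 'I_n -> rat) (k : nat) (rho : rat).
Local Notation inp := (kmf_input d k rho).
Local Notation sz := (kmf_size d k rho).

Lemma input_entry (i j : 'I_n) :
  inp (4 + ((i * n + j) + (i * n + j)))%N = numq (d i j) /\
  inp (5 + ((i * n + j) + (i * n + j)))%N = denq (d i j).
Proof.
have kE a : (4 <= a)%N -> inp a = \sum_(i : 'I_n) \sum_(j : 'I_n)
       (if a == (4 + 2 * (i * n + j))%N then numq (d i j)
        else if a == (5 + 2 * (i * n + j))%N then denq (d i j) else 0).
  by case: a => [|[|[|[|a]]]].
split; rewrite kE //.
- rewrite (bigD1 i) //= (bigD1 j) //= !big1 ?addr0.
  + by rewrite (_ : _ == _) // addnn -mul2n.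
  + move=> i' ii; rewrite big1 // => j' _; rewrite ifF; last first.
      apply/negP => /eqP e; case/eqP: ii.
      by have [] := @idx_inj n i j i' j' _; first lia.
    by rewrite ifF //; apply/negP => /eqP; lia.
  + move=> j' jj; rewrite ifF; last first.
      apply/negP => /eqP e; case/eqP: jj.
      by have [] := @idx_inj n i j i j' _; first lia.
    by rewrite ifF //; apply/negP => /eqP; lia.
- rewrite (bigD1 i) //= (bigD1 j) //= !big1 ?addr0.
  + rewrite ifF; last by apply/negP => /eqP; lia.
    by rewrite (_ : _ == _) // addnn -mul2n.
  + move=> i' ii; rewrite big1 // => j' _; rewrite ifF; last first.
      by apply/negP => /eqP e; lia.
    rewrite ifF //; apply/negP => /eqP e; case/eqP: ii.
    by have [] := @idx_inj n i j i' j' _; first lia.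
  + move=> j' jj; rewrite ifF; last by apply/negP => /eqP e; lia.
    rewrite ifF //; apply/negP => /eqP e; case/eqP: jj.
    by have [] := @idx_inj n i j i j' _; first lia.
Qed.

Definition entry_num l : int := inp (4 + (l + l))%N.
Definition entry_den l : nat := `|inp (5 + (l + l))%N|%N.
Definition rho_num := `|numq rho|%N.
Definition rho_den := `|denq rho|%N.
Definition den_prod := (\prod_(l < n * n) entry_den l)%N.
Definition median_weight l : int := entry_num l * (\prod_(l' < n * n | l' != l :> nat) entry_den l')%N%:Z * rho_den%:Z.
Definition mst_weight l : int := entry_num l * (\prod_(l' < n * n | l' != l :> nat) entry_den l')%N%:Z * rho_num%:Z.
Definition scale_factor := (den_prod * rho_den)%N.

Lemma entry_num_idx (u w : 'I_n) : entry_num (u * n + w) = numq (d u w).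
Proof. by have [] := input_entry u w. Qed.
Lemma entry_den_idx (u w : 'I_n) : (entry_den (u * n + w))%:Z = denq (d u w).
Proof. by have [_ e] := input_entry u w; rewrite /entry_den e gez0_abs // ltW. Qed.

Lemma entry_den_gt0 l : (l < n * n)%N -> (0 < entry_den l)%N.
Proof. by move=> /idx_surj [u [w ->]]; rewrite -ltz_nat entry_den_idx. Qed.

Lemma rho_denE : rho_den%:Z = denq rho. Proof. by rewrite /rho_den gez0_abs // ltW. Qed.
Lemma scale_factor_gt0 : (0 < scale_factor)%N.
Proof.
rewrite /scale_factor muln_gt0 prodn_gt0 /=; first by rewrite -ltz_nat rho_denE.
by move=> i; apply: entry_den_gt0.
Qed.

Let numden (x : rat) : (numq x)%:~R = x * (denq x)%:~R.
Proof. by rewrite -{2}(divq_num_den x) mulfVK // intr_eq0 denq_neq0. Qed.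

Lemma den_prod_split (u w : 'I_n) :
  (entry_num (u * n + w) * (\prod_(l' < n * n | l' != (u * n + w)%N :> nat) entry_den l')%N%:Z)%:~R
   = den_prod%:R * d u w :> rat.
Proof.
set Pi := (\prod_(l' < n * n | _) entry_den l')%N.
have DE : den_prod = (entry_den (u * n + w) * Pi)%N by rewrite /den_prod (bigD1 (Ordinal (idx_lt u w))).
rewrite intrM entry_num_idx numden -entry_den_idx DE natrM -!pmulrn; ring.
Qed.

Lemma median_weight_idx (u w : 'I_n) : (wA median_weight u w)%:~R = scale_factor%:R * d u w :> rat.
Proof.
rewrite /wA /median_weight intrM den_prod_split /scale_factor natrM -pmulrn; ring.
Qed.

Lemma size_sum : (ibits rho_num%:Z + ibits rho_den%:Z +
   \sum_(i < n) \sum_(j < n) (ibits (numq (d i j)) + ibits (denq (d i j))) <= sz)%N.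
Proof. by rewrite /kmf_size /rho_num /rho_den /ibits !absz_nat; lia. Qed.

Lemma sum_idx (f : nat -> nat) :
  (\sum_(l < n * n) f l = \sum_(i < n) \sum_(j < n) f (i * n + j))%N.
Proof.
rewrite pair_big /= (reindex (fun p : 'I_n * 'I_n => Ordinal (idx_lt p.1 p.2))) //=.
have inj : injective (fun p : 'I_n * 'I_n => Ordinal (idx_lt p.1 p.2)).
  by move=> [i j] [i' j'] /(congr1 val) /= /idx_inj [-> ->].
by apply: onW_bij; apply: inj_card_bij => //; rewrite card_prod !card_ord.
Qed.

Lemma size_idx : (ibits rho_num%:Z + ibits rho_den%:Z +
   \sum_(l < n * n) (ibits (entry_num l) + ibits (entry_den l)%:Z) <= sz)%N.
Proof.
apply: leq_trans size_sum; rewrite leq_add2l (sum_idx (fun l => ibits (entry_num l) + ibits (entry_den l)%:Z)%N).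
by apply: leq_sum => i _; apply: leq_sum => j _; rewrite entry_num_idx entry_den_idx.
Qed.

(** The factors are distinct parts of the input: one numerator, the denominators of the other
    entries, one half of [rho]. Bit lengths add up under multiplication, so they stay within the
    input size. *)
Lemma scaled_entry_lt l (r : nat) : (l < n * n)%N -> (r == rho_num) || (r == rho_den) ->
  (`|(entry_num l * (\prod_(l' < n * n | l' != l :> nat) entry_den l')%N%:Z * r%:Z)%R|%N < 2 ^ sz)%N.
Proof.
move=> ln hr.
have pr : (\prod_(l' < n * n | l' != l :> nat) entry_den l' <=
    2 ^ (\sum_(l' < n * n | l' != l :> nat) ibits (entry_den l')%:Z))%N.
  elim/big_ind2: _ => [//|x1 y1 x2 y2 h1 h2|i _]; first by rewrite expnD leq_mul.
  by rewrite ltnW // -{1}[entry_den i]absz_nat lt_pow_ibits.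
have hr2 : (r < 2 ^ (ibits rho_num%:Z + ibits rho_den%:Z))%N.
  case/orP: hr => /eqP ->; rewrite expnD.
    apply: leq_trans (lt_pow_ibits rho_num%:Z) _; by rewrite leq_pmulr // expn_gt0.
  apply: leq_trans (lt_pow_ibits rho_den%:Z) _; by rewrite leq_pmull // expn_gt0.
rewrite !abszM !absz_nat.
apply: leq_trans (_ : 2 ^ (ibits (entry_num l)) * 2 ^ (\sum_(l' < n * n | l' != l :> nat) ibits (entry_den l')%:Z)
   * 2 ^ (ibits rho_num%:Z + ibits rho_den%:Z) <= _)%N; last first.
  rewrite -!expnD leq_exp2l //; apply: leq_trans size_idx.
  rewrite addnC leq_add2l big_split /= leq_add //.
    by rewrite (bigD1 (Ordinal ln)) //= leq_addr.
  by rewrite [leqRHS](bigID (fun i : 'I_(n * n) => i != l :> nat)) /= leq_addr.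
apply: leq_ltn_trans (leq_mul (leq_mul (ltnW (lt_pow_ibits _)) pr) (leqnn r)) _.
by rewrite ltn_pmul2l // muln_gt0 !expn_gt0.
Qed.

Lemma nn_size : (n * n + n * n <= sz)%N.
Proof.
apply: leq_trans size_sum; apply: leq_trans (leq_addl _ _).
apply: leq_trans (_ : \sum_(i < n) \sum_(j < n) 2 <= _)%N.
  by rewrite !sum_nat_const !card_ord; lia.
by apply: leq_sum => i _; apply: leq_sum => j _; rewrite /ibits; lia.
Qed.

Lemma n_size : (n <= sz)%N.
Proof.
have h a : (a <= a * a + a * a)%N by case: a => // a; nia.
exact: leq_trans (h n) nn_size.
Qed.

Hypothesis rho0 : 0 <= rho.

Lemma rho_numE : rho_num%:Z = numq rho. Proof. by rewrite /rho_num gez0_abs // numq_ge0. Qed.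

Lemma mst_weight_idx (u w : 'I_n) : (wB mst_weight u w)%:~R = scale_factor%:R * rho * d u w :> rat.
Proof.
rewrite /wB /mst_weight intrM den_prod_split rho_numE numden -rho_denE /scale_factor natrM -pmulrn; ring.
Qed.

Hypothesis dM : is_metric d.
Let d0 u v : 0 <= d u v. Proof. by case: dM. Qed.
Let dC u v : d u v = d v u. Proof. by case: dM. Qed.

Lemma wB_ge0 u v : 0 <= @wB n mst_weight u v.
Proof. by rewrite -(ler0z rat) mst_weight_idx !mulr_ge0 // ler0n. Qed.

Lemma wA_ge0 u v : 0 <= @wA n median_weight u v.
Proof. by rewrite -(ler0z rat) median_weight_idx !mulr_ge0 // ler0n. Qed.

Lemma wB_sym u v : @wB n mst_weight u v = wB mst_weight v u.
Proof. by apply/eqP; rewrite -(eqr_int rat) !mst_weight_idx dC. Qed.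

Definition weight_bound : int := 1 + \sum_(i < n * n) (median_weight i + mst_weight i).

Lemma median_weight_ge0 l : (l < n * n)%N -> 0 <= median_weight l.
Proof. by move=> /idx_surj [u [w ->]]; apply: wA_ge0. Qed.
Lemma mst_weight_ge0 l : (l < n * n)%N -> 0 <= mst_weight l.
Proof. by move=> /idx_surj [u [w ->]]; apply: wB_ge0. Qed.

Lemma weight_lt_bound l : (l < n * n)%N -> median_weight l < weight_bound /\ mst_weight l < weight_bound.
Proof.
move=> ln; have h : median_weight l + mst_weight l <= \sum_(i < n * n) (median_weight i + mst_weight i).
  rewrite (bigD1 (Ordinal ln)) //= lerDl; apply: sumr_ge0 => i _.
  by rewrite addr_ge0 ?median_weight_ge0 ?mst_weight_ge0.
by have := median_weight_ge0 ln; have := mst_weight_ge0 ln; rewrite /weight_bound; split; lia.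
Qed.

(* The product is an integer by [scaled_costE]; [numq] extracts it. *)
Definition scaled_cost (A : {set 'I_n}) : int := numq (scale_factor%:R * kmf_cost d rho A).

Lemma near_scaled (A : {set 'I_n}) u : A != set0 ->
  (\big[Num.min/weight_bound]_(w in A) wA median_weight u w)%:~R = scale_factor%:R * dist_to d A u :> rat.
Proof.
move=> A0; have /set0Pn [a aA] := A0.
have [||w1 w1A e1] := @bigmin_attained _ _ (mem A) (fun w => wA median_weight u w) weight_bound.
- by exists a.
- by move=> i _; apply: ltW; have [] := weight_lt_bound (idx_lt u i).
have [w2 w2A e2] := dist_to_attained d u A0.
apply/eqP; rewrite eq_le; apply/andP; split.
  by rewrite e2 -median_weight_idx ler_int; apply: bigmin_le_cond.
by rewrite e1 median_weight_idx; apply: ler_wpM2l; [rewrite ler0n|apply: dist_to_le].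
Qed.

(** A run of Prim is at most every feasible edge set by [prim_min] and yields one itself by
    [grow_feasible]; the weight found by the machine is thus independent of ties. *)
Lemma mst_scaled (A : {set 'I_n}) m : A != set0 -> prim (@wB n mst_weight) A m ->
  m%:~R = scale_factor%:R * rho * mst_contracted d A :> rat.
Proof.
move=> A0 pm.
have sumE (G : {set 'I_n * 'I_n}) : (\sum_(e in G) wB mst_weight e.1 e.2)%:~R = scale_factor%:R * rho * eweight d G :> rat.
  by rewrite rmorph_sum /= /eweight mulr_sumr; apply: eq_bigr => e _; rewrite mst_weight_idx.
have c0 : 0 <= scale_factor%:R * rho :> rat by rewrite mulr_ge0 // ler0n.
apply/eqP; rewrite eq_le; apply/andP; split.
  have [G cG ->] := @mst_attained _ _ dM A A0.
  by rewrite -sumE ler_int; apply: (prim_min wB_ge0 wB_sym pm).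
have [G cG le] := grow_feasible wB_ge0 (prim_grow pm).
apply: le_trans (_ : (\sum_(e in G) wB mst_weight e.1 e.2)%:~R <= _); last by rewrite ler_int.
by rewrite sumE; apply: ler_wpM2l => //; apply: mst_le.
Qed.

Lemma scaled_cost_prim (A : {set 'I_n}) m : A != set0 -> prim (@wB n mst_weight) A m ->
  \sum_(u < n) \big[Num.min/weight_bound]_(w in A) wA median_weight u w + m = scaled_cost A.
Proof.
move=> A0 pm; rewrite /scaled_cost.
have -> : scale_factor%:R * kmf_cost d rho A =
    (\sum_(u < n) \big[Num.min/weight_bound]_(w in A) wA median_weight u w + m)%:~R :> rat.
  rewrite intrD (mst_scaled A0 pm) rmorph_sum /= /kmf_cost mulrDr mulr_sumr mulrA.
  by congr (_ + _); apply: eq_bigr => u _; rewrite near_scaled.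
by rewrite numq_int.
Qed.

Lemma scaled_costE (A : {set 'I_n}) : A != set0 -> (scaled_cost A)%:~R = scale_factor%:R * kmf_cost d rho A :> rat.
Proof.
move=> A0; have [m pm] := prim_exists (@wB n mst_weight) A0.
rewrite -(scaled_cost_prim A0 pm) intrD (mst_scaled A0 pm) rmorph_sum /= /kmf_cost mulrDr mulr_sumr mulrA.
by congr (_ + _); apply: eq_bigr => u _; rewrite near_scaled.
Qed.

Lemma scaled_cost_ge0 (A : {set 'I_n}) : A != set0 -> 0 <= scaled_cost A.
Proof.
by move=> A0; rewrite -(ler0z rat) scaled_costE // mulr_ge0 ?ler0n // kmf_cost_ge0.
Qed.

(** There are [n] service terms, and the forest costs at most the full set of [n * n] edges, each
    term being at most [2 ^ sz]; and [n + n * n < 2 ^ sz] as every entry has at least two bits. *)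
Lemma scaled_cost_lt (A : {set 'I_n}) : A != set0 -> scaled_cost A < (2 ^ (2 * sz))%N%:Z.
Proof.
move=> A0; have [m pm] := prim_exists (@wB n mst_weight) A0; rewrite -(scaled_cost_prim A0 pm).
have /set0Pn [a aA] := A0.
have lA u v : @wA n median_weight u v <= (2 ^ sz)%N%:Z.
  by have := @scaled_entry_lt _ rho_den (idx_lt u v); rewrite eqxx orbT => /(_ isT); rewrite /wA /median_weight; lia.
have lB u v : @wB n mst_weight u v <= (2 ^ sz)%N%:Z.
  by have := @scaled_entry_lt _ rho_num (idx_lt u v); rewrite eqxx => /(_ isT); rewrite /wB /mst_weight; lia.
have s1 : \sum_(u < n) \big[Num.min/weight_bound]_(w in A) wA median_weight u w <= n%:Z * (2 ^ sz)%N%:Z.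
  apply: le_trans (_ : \sum_(u < n) (2 ^ sz)%N%:Z <= _); last first.
    by rewrite sumr_const card_ord -mulr_natl natz.
  apply: ler_sum => u _; apply: le_trans (lA u a).
  exact: bigmin_le_cond.
have s2 : m <= (n * n)%N%:Z * (2 ^ sz)%N%:Z.
  apply: le_trans (prim_min wB_ge0 wB_sym pm (connects_to_setT A0)) _.
  apply: le_trans (_ : \sum_(e in [set: 'I_n * 'I_n]) (2 ^ sz)%N%:Z <= _).
    by apply: ler_sum => e _; apply: lB.
  by rewrite sumr_const cardsT card_prod !card_ord -mulr_natl natz.
have sm : (n + n * n < 2 ^ sz)%N.
  by apply: leq_ltn_trans (ltn_expl sz (isT : 1 < 2)%N); have := nn_size; nia.
apply: le_lt_trans (lerD s1 s2) _.
have -> : (2 ^ (2 * sz))%N%:Z = (2 ^ sz)%N%:Z * (2 ^ sz)%N%:Z.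
  by rewrite mul2n -addnn expnD PoszM.
rewrite -mulrDl ltr_pM2r; last by rewrite ltz_nat expn_gt0.
by rewrite -PoszD ltz_nat.
Qed.
End Instance.

(** * Polynomial running time *)

Unset Implicit Arguments.
Set Strict Implicit.

(** One constant is both coefficient and exponent, as in the time bound of the theorem; for positive
    arguments it can be raised freely, which gives closure under sums and products. *)
Definition polyb (f : nat -> nat) := exists c, forall Y, (0 < Y)%N -> (f Y <= c * Y ^ c)%N.

Lemma polyb_const a : polyb (fun _ => a).
Proof. by exists a => Y Y0; rewrite leq_pmulr // expn_gt0 Y0. Qed.

Lemma polyb_id : polyb (fun Y => Y).
Proof. by exists 1%N => Y _; rewrite mul1n. Qed.

Lemma polyb_add f g : polyb f -> polyb g -> polyb (fun Y => f Y + g Y)%N.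
Proof.
move=> [a fa] [b gb]; exists (a + b)%N => Y Y0; rewrite mulnDl leq_add //.
  by apply: leq_trans (fa Y Y0) _; rewrite leq_mul2l leq_pexp2l ?leq_addr ?orbT.
by apply: leq_trans (gb Y Y0) _; rewrite leq_mul2l leq_pexp2l ?leq_addl ?orbT.
Qed.

Lemma polyb_mul f g : polyb f -> polyb g -> polyb (fun Y => f Y * g Y)%N.
Proof.
move=> [a fa] [b gb]; exists (a * b + (a + b))%N => Y Y0.
apply: leq_trans (leq_mul (fa Y Y0) (gb Y Y0)) _; rewrite mulnACA -expnD.
by rewrite leq_mul ?leq_addr // leq_pexp2l ?leq_addl.
Qed.

Lemma cwf_sub V V' D c : (V <= V')%N -> cwf V D c -> cwf V' D c.
Proof.
move=> VV; have lt x : (x < V)%N -> (x < V')%N by move=> h; apply: leq_trans h VV.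
have sub e : ewf V e -> ewf V' e.
  by elim: e => //= [e1 h1 e2 h2 /andP[/h1 -> /h2 ->]|e1 h1 e2 h2 /andP[/h1 -> /h2 ->]|a e h /andP[-> /h ->]].
elim: c => //= [x e|a e1 e2|c1 h1 c2 h2|e c1 h1 c2 h2|e c h|x y|x y].
- by move=> /andP[/lt -> /andP[/sub -> ->]].
- by move=> /and3P[-> /andP[/sub -> ->] /andP[/sub -> ->]].
- by move=> /andP[/h1 -> /h2 ->].
- by move=> /and3P[/andP[/sub -> ->] /h1 -> /h2 ->].
- by move=> /andP[/andP[/sub -> ->] /h ->].
- by move=> /andP[/lt -> /lt ->].
- by move=> /andP[/lt -> /lt ->].
Qed.

Lemma cwf_try p j : (j <= p)%N -> cwf (30 + 2 * p) 20 (try_cmd j).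
Proof.
have leaf : cwf (30 + 2 * p) 20 (Seq cost_cmd test_cmd).
  by apply: (@cwf_sub 30); [lia|].
elim: j => [|j IH] jp; first exact: leaf.
rewrite /try_cmd -/try_cmd.
have ha : (va j < 30 + 2 * p)%N by rewrite /va; lia.
have hb : (vb j < 30 + 2 * p)%N by rewrite /vb; lia.
by rewrite /= ha hb IH //; lia.
Qed.

(** * The assembled program and its guarantee *)

Definition prog lo N p :=
  Seq (load lo) (Seq scale (Seq (setup N) (Seq (search p) (output_cmd lo)))).

Lemma cwf_prog lo N p : cwf (30 + 2 * p) 20 (prog lo N p).
Proof.
have c1 : cwf (30 + 2 * p) 20 (load lo) by apply: (@cwf_sub 30); [lia|].
have c2 : cwf (30 + 2 * p) 20 scale by apply: (@cwf_sub 30); [lia|].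
have c3 : cwf (30 + 2 * p) 20 (setup N) by apply: (@cwf_sub 30); [lia|].
have c4 : cwf (30 + 2 * p) 20 (search p) by rewrite /= (cwf_try p p).
have c6 : cwf (30 + 2 * p) 20 (output_cmd lo) by apply: (@cwf_sub 30); [lia|].
by apply/and5P; split.
Qed.

Lemma try_time_mono n n' q q' p : (n <= n')%N -> (q <= q')%N ->
  (try_time n q p <= try_time n' q' p)%N.
Proof.
move=> nn qq; have leaf : (leaf_time n q <= leaf_time n' q')%N.
  by rewrite /leaf_time; do !(rewrite ?leq_add ?leq_mul //).
elim: p => //= p IH; rewrite leq_add // leq_add // leq_mul // leq_add //.
by rewrite leq_mul // leq_add.
Qed.

Lemma polyb_try N p : polyb (fun Y => try_time Y (N * Y) p).
Proof.
have leaf : polyb (fun Y => leaf_time Y (N * Y)).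
  rewrite /leaf_time.
  have S1 : polyb (fun Y => Y.+1) by apply: polyb_add (polyb_const 1) polyb_id.
  by do !first [exact: S1 | exact: polyb_const | exact: polyb_id | apply: polyb_add | apply: polyb_mul].
elim: p => // p IH /=.
by do !first [exact: leaf | exact: IH | exact: polyb_const | exact: polyb_id | apply: polyb_add | apply: polyb_mul].
Qed.

Definition prog_time n nn q E L p : nat :=
  ((n * 3 + (4 + (nn + nn)) * 4 + 20) + ((nn.+1 * nn.+1) * (22 * L + 100) +
  ((nn * 3 + n * 10 + 20) + (((q * E + 1) * pass_time n q p + (leaf_time n q + 20)) + (n * 4 + 10)))))%N.

Lemma prog_time_bound N p : exists g, polyb g /\ forall n Y, (n <= Y)%N -> (n * n <= Y)%N ->
  (prog_time n (n * n) (n * N) (2 * Y) Y p <= g Y)%N.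
Proof.
exists (fun Y => (Y * 3 + (4 + (Y + Y)) * 4 + 20) + ((Y.+1 * Y.+1) * (22 * Y + 100) +
  ((Y * 3 + Y * 10 + 20) + (((N * Y * (2 * Y) + 1) * (try_time Y (N * Y) p + (Y * 3 + 10)) + (try_time Y (N * Y) p + 20)) + (Y * 4 + 10)))))%N.
split.
  have S1 : polyb (fun Y => Y.+1) by apply: polyb_add (polyb_const 1) polyb_id.
  by do !first [exact: S1 | exact: polyb_try | exact: polyb_const | exact: polyb_id | apply: polyb_add | apply: polyb_mul].
move=> n Y nY nnY; rewrite /prog_time /pass_time.
have tm : (try_time n (n * N) p <= try_time Y (N * Y) p)%N.
  by apply: try_time_mono => //; rewrite mulnC leq_mul.
have lm : (leaf_time n (n * N) <= try_time Y (N * Y) p)%N.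
  by apply: leq_trans tm; case: (p) => //= p'; apply: leq_addr.
have qm : (n * N <= N * Y)%N by rewrite mulnC leq_mul.
do ![apply: leq_add => // | apply: leq_mul => // | rewrite ltnS //].
Qed.

Section Main.
Variables (n : nat) (d : 'I_n -> 'I_n -> rat) (k : nat) (rho : rat).
Hypothesis dM : is_metric d.
Hypothesis rho0 : 0 <= rho.
Hypothesis kn : (1 <= k <= n)%N.
Local Notation inp := (kmf_input d k rho).
Local Notation sz := (kmf_size d k rho).

Definition locally_opt (p q : nat) (A : {set 'I_n}) :=
  forall B : {set 'I_n}, #|B| = k -> (#|A :\: B| <= p)%N ->
    q%:R * (kmf_cost d rho A - kmf_cost d rho B) <= kmf_cost d rho A.

Lemma prog_ok lo hi N p s : (6 < lo)%N -> (0 < N)%N -> (4 + (n * n + n * n) <= hi)%N ->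
  (forall i, (i < lo)%N -> i != 4%N -> i != 5%N ->
      arr s 0 i = if i == 6%N then (if n == 1%N then 4 else inp (4 + 2 * n)%N) else inp i) ->
  (forall x, (lo <= x < hi)%N -> low s x = inp x) ->
  run lo hi (prog lo N p) s (prog_time n (n * n) (n * N) (2 * sz) sz p)
   (fun s' => exists A : {set 'I_n}, [/\ #|A| = k, locally_opt p (n * N) A,
      isset s' aS A & forall i : 'I_n, (lo <= i)%N -> low s' i = (nat_of_bool (i \in A))%:Z]).
Proof.
move=> lo6 N0 hi4 s_arr s_low; have n0 : (0 < n)%N by lia.
have q0 : (0 < n * N)%N by rewrite muln_gt0 n0.
have k0 : (0 < k)%N by lia.
rewrite /prog_time /prog.
have d00 u : d u u = 0 by case: dM => _ h _ _; apply/h.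
have dC u v : d u v = d v u by case: dM.
sq (n * 3 + (4 + (n * n + n * n)) * 4 + 20)%N.
have s0n : arr s aIN 0 = n%:Z by rewrite s_arr //; lia.
apply: (run_weaken (load_ok lo6 hi4 s0n (leqnn _))) => // s1 _ [s1n s1nn s1in].
have {}s1in a : (a < 4 + (n * n + n * n))%N -> arr s1 aIN a = inp a.
  move=> ha; rewrite s1in //.
  pose o0 := Ordinal n0.
  have [e4 e5] := input_entry d k rho o0 o0.
  case: eqP => [->|/eqP a4]; first by move: e4; rewrite d00.
  case: eqP => [->|/eqP a5]; first by move: e5; rewrite d00.
  case: ifP => al; last by rewrite s_low //; lia.
  (* Cell 6 is inside the input only if [n > 1], and then it is the numerator of [d(0,1)], equal by
     symmetry to the reloaded one of [d(1,0)]. *)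
  rewrite s_arr //; case: eqP => // a6.
  have two b : (6 < 4 + (b * b + b * b))%N -> (1 < b)%N by case: b => [|[|b]].
  have n1 : (1 < n)%N by apply: two; rewrite -a6.
  rewrite ifF; last by lia.
  pose o1 := Ordinal n1.
  have [e6 _] := input_entry d k rho o0 o1; have [e7 _] := input_entry d k rho o1 o0.
  rewrite a6; transitivity (numq (d o1 o0)).
    by rewrite -e7; congr (kmf_input _ _ _ _); rewrite /=; lia.
  by rewrite dC -e6.
have inb i : (i < n * n)%N -> [/\ (4 + (i + i) < 4 + (n * n + n * n))%N & (5 + (i + i) < 4 + (n * n + n * n))%N] by lia.
rewrite addKn.
sq ((n * n).+1 * (n * n).+1 * (22 * sz + 100))%N.
have sc i : (i < n * n)%N -> arr s1 aIN (4 + (i + i))%N = entry_num d k rho i /\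
     arr s1 aIN (5 + (i + i))%N = (entry_den d k rho i)%:Z /\ (ibits (entry_den d k rho i)%:Z <= sz)%N.
  move=> ii; have [b1 b2] := inb i ii; rewrite !s1in //; split=> //; split.
    have [u [w ->]] := idx_surj ii; rewrite entry_den_idx.
    by have [_ ->] := input_entry d k rho u w.
  apply: leq_trans (size_idx d k rho); rewrite (bigD1 (Ordinal ii)) //=; lia.
have s12 : arr s1 aIN 2 = (rho_num rho)%:Z by rewrite s1in ?(rho_numE rho0) //; lia.
have s13 : arr s1 aIN 3 = (rho_den rho)%:Z by rewrite s1in ?rho_denE //; lia.
have l2 : (ibits (rho_num rho)%:Z <= sz)%N by have := size_idx d k rho; lia.
have l3 : (ibits (rho_den rho)%:Z <= sz)%N by have := size_idx d k rho; lia.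
apply: (run_weaken (scale_ok lo hi s1nn sc s12 s13 l2 l3 (leqnn _))) => // s2 fr2 s2f.
have [fv2 fa2 _] := fr2; rewrite addKn.
sq (n * n * 3 + n * 10 + 20)%N.
have s2n : var s2 vN = n%:Z by rewrite fv2.
have s2nn : var s2 vNN = (n * n)%N%:Z by rewrite fv2.
have s2k : arr s2 aIN 1 = k%:Z by rewrite fa2 // s1in.
apply: (run_weaken (setup_ok lo hi N s2n s2nn s2k (leqnn _))) => // s3 fr3 [s3S s3big s3q].
have [fv3 fa3 _] := fr3; rewrite addKn.
pose A0 := [set i : 'I_n | (i < k)%N].
have cA0 : #|A0| = k.
  rewrite -sum1_card (eq_bigl (fun i : 'I_n => (i < k)%N)); last by move=> i; rewrite inE.
  by rewrite -(big_ord_widen n (fun _ => 1%N)) ?sum1_card ?card_ord //; lia.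
set q := (n * N)%N in q0 *.
sq ((q * (2 * sz) + 1) * pass_time n q p + (leaf_time n q + 20))%N.
have cs3 : ctx n (median_weight d k rho) (mst_weight d k rho) (weight_bound d k rho) s3.
  split.
  - by rewrite fv3.
  - rewrite s3big /weight_bound; congr (1 + _); apply: eq_bigr => i _.
    by have [-> ->] := s2f i (ltn_ord i).
  - by move=> i ii; rewrite fa3 //; have [-> _] := s2f i ii.
  - by move=> i ii; rewrite fa3 //; have [_ ->] := s2f i ii.
have A0n : A0 != set0 by rewrite -card_gt0 cA0.
have FAb := scaled_cost_lt k rho0 dM A0n.
apply: (run_weaken (@search_ok lo hi n (median_weight d k rho) (mst_weight d k rho) (weight_bound d k rho)
  (fun l ln => proj1 (weight_lt_bound k rho0 dM ln)) (fun l ln => proj2 (weight_lt_bound k rho0 dM ln)) (scaled_cost d k rho)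
  (@scaled_cost_prim n d k rho rho0 dM) (scaled_cost_ge0 k rho0 dM) k q k0 q0 p A0 s3 (2 * sz)%N _ cs3 s3S s3q cA0 FAb (leqnn _))) => // s4 fr4 [A [gA loc]].
rewrite addKn; have [cs4 sS4 _ _ cA] := gA; have [s4n _ _ _] := cs4.
have nhi : (n <= hi)%N.
  by apply: leq_trans hi4; apply: leq_trans (leq_addl _ _); case: (n) => // m; nia.
apply: (run_weaken (output_ok lo nhi s4n sS4 (leqnn _))) => // s5 _ [sS5 low5].
exists A; split=> // B cB near.
have A0' : A != set0 by rewrite -card_gt0 cA.
have B0' : B != set0 by rewrite -card_gt0 cB.
have := loc B cB near; rewrite /better => /negP; rewrite -leNgt => h.
have : (q%:Z * (scaled_cost d k rho A - scaled_cost d k rho B))%:~R <= (scaled_cost d k rho A)%:~R :> rat by rewrite ler_int.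
rewrite intrM intrB !scaled_costE // -mulrBr -pmulrn mulrCA.
by rewrite ler_pM2l // ltr0n scale_factor_gt0.
Qed.
End Main.

Lemma halt_ok P m : ram_step P (size P, m) = None.
Proof. by rewrite /ram_step nth_default. Qed.

(** With [p = N] and [q = n * N], [k / q <= 1 / N] and the ratio is at most [(3 N + 2) / (N - 1)],
    which is at most [3 + eps] exactly when [5 + eps <= N * eps]. *)
Lemma local_opt_ratio (R : realType) (eps : R) (n N k : nat) (d : 'I_n -> 'I_n -> rat) rho
   (A O : {set 'I_n}) :
  0 < eps -> (5 + eps) / eps <= N%:R -> (0 < N)%N -> is_metric d -> 0 <= rho -> (1 <= k <= n)%N ->
  #|A| = k -> #|O| = k -> locally_opt n d k rho N (n * N) A ->
  ratr (kmf_cost d rho A) <= (3 + eps) * ratr (kmf_cost d rho O).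
Proof.
move=> e0 eN N0 dM rho0 /andP[k0 kn] cA cO loc.
have n0 : (0 < n)%N by apply: leq_trans kn.
have q0 : 0 < (n * N)%N%:R :> rat by rewrite ltr0n muln_gt0 n0.
have := local_opt_bound dM rho0 cA cO k0 N0 q0 loc.
have A0 : A != set0 by rewrite -card_gt0 cA.
have O0 : O != set0 by rewrite -card_gt0 cO.
have := kmf_cost_ge0 dM rho0 A0; have := kmf_cost_ge0 dM rho0 O0.
set a := kmf_cost d rho A; set b := kmf_cost d rho O => b0 a0 h; clearbody a b.
have Np : 0 < N%:R :> rat by rewrite ltr0n.
have kq : k%:R / (n * N)%N%:R <= N%:R^-1 :> rat.
  rewrite ler_pdivrMr // natrM mulrC -mulrA divff ?gt_eqF // mulr1 ler_nat //.
have h1 : (N%:R - 1) * a <= (3 * N%:R + 2) * b.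
  have h2 : (1 - N%:R^-1) * a <= (3 + 2 / N%:R) * b.
    by apply: le_trans h; apply: ler_wpM2r => //; lra.
  have := ler_wpM2l (ltW Np) h2.
  have Nn : N%:R != 0 :> rat by rewrite gt_eqF.
  have -> : N%:R * ((1 - N%:R^-1) * a) = (N%:R - 1) * a by field.
  by have -> : N%:R * ((3 + 2 / N%:R) * b) = (3 * N%:R + 2) * b by field.
have {}h1 : (N%:R - 1) * ratr a <= (3 * N%:R + 2) * ratr b :> R.
  have : ratr ((N%:R - 1) * a) <= ratr ((3 * N%:R + 2) * b) :> R by rewrite ler_rat.
  by rewrite !rmorphM rmorphB rmorphD rmorphM !rmorph_nat rmorph1.
have b0' : 0 <= ratr b :> R by rewrite ler0q.
have eN' : 5 + eps <= N%:R * eps by rewrite -ler_pdivrMr.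
have N1 : 0 < N%:R - 1 :> R.
  by rewrite subr_gt0; apply: lt_le_trans eN; rewrite ltr_pdivlMr //; lra.
rewrite -(ler_pM2l N1); apply: le_trans h1 _; rewrite [leRHS]mulrA; apply: ler_wpM2r => //.
rewrite mulrDr mulrBl; lra.
Qed.

Theorem theorem2 (R : realType) (eps : R) :
  0 < eps ->
  exists (P : seq instr) (c : nat),
    forall (n : nat) (d : 'I_n -> 'I_n -> rat) (k : nat) (rho : rat),
      is_metric d -> (1 <= k <= n)%N -> 0 <= rho ->
      exists m : ram_state,
        ram_run P (c * (kmf_size d k rho).+1 ^ c)%N (0%N, kmf_input d k rho)
          = Some m /\
        #|kmf_output n m.2| = k /\
        forall S' : {set 'I_n}, #|S'| = k ->
          ratr (kmf_cost d rho (kmf_output n m.2))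
            <= (3 + eps) * ratr (kmf_cost d rho S').
Proof.
move=> e0.
have [N N0 eN] : exists2 N, (0 < N)%N & (5 + eps) / eps <= N%:R.
  exists (Num.bound ((5 + eps) / eps)).+1 => //.
  apply: le_trans (_ : (Num.bound ((5 + eps) / eps))%:R <= _); last by rewrite ler_nat.
  by apply: ltW; apply: archi_boundP; rewrite divr_ge0 // ltW // addr_gt0.
(* Thirty named variables and two loop variables per swap level; expressions have size at most 20,
   so 30 further registers hold all temporaries. *)
pose V := (30 + 2 * N)%N; pose lo := (V + 30)%N.
have [g [[c0 gc] hg]] := prog_time_bound N N.
pose P := boot V lo ++ ccmd V (boot_sz lo) (prog lo N N) ++ finish V lo aS.
have [c hc] : polyb (fun Y => (4 * Y + (3 * lo + 20)) + (kappa 20 * (c0 * Y ^ c0) + finish_sz lo))%N.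
  have pw e : polyb (fun Y => Y ^ e)%N by exists e.+1 => Y Y0; rewrite -[leqLHS]mul1n leq_mul // leq_pexp2l.
  by do !first [exact: polyb_const | exact: polyb_id | exact: pw | apply: polyb_add | apply: polyb_mul].
exists P, c => n d k rho dM kn rho0.
have n0 : (0 < n)%N by lia.
have V6 : (6 < V)%N by rewrite /V; lia.
have Vlo : (V < lo)%N by rewrite /lo; lia.
have lo6 : (6 < lo)%N by lia.
have Dlo : (V.+2 + 20 < lo)%N by rewrite /lo; lia.
set inp := kmf_input d k rho; set sz := kmf_size d k rho.
have cP : code_at P 0 P by [].
have [cb /code_at_cat [cc cf]] := (code_at_cat P 0 _ _).1 cP.
rewrite !add0n size_boot // size_ccmd in cc cf.
have [j1 [s1 [m1 [st1 j1l sm1 arr1 low1]]]] := boot_ok V6 Vlo (m := inp) n0 erefl cb.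
set hi := heap lo n in sm1 low1.
have lohi : (lo <= hi)%N.
  by rewrite /hi /heap; apply: (@leq_trans (lo + 64)); rewrite ?leq_addr // leq_pmulr // expn_gt0.
have hi4 : (4 + (n * n + n * n) <= hi)%N.
  rewrite /hi /heap; apply: (@leq_trans (64 * 2 ^ n)); last by rewrite leq_mul2r leq_addl orbT.
  elim: (n) => // b IH; rewrite expnS; have := ltn_expl b (isT : 1 < 2)%N; nia.
have [t [s2 [ex tT [A [cA locA sA lowA]]]]] :=
  @prog_ok n d k rho dM rho0 kn lo hi N N s1 lo6 N0 hi4 arr1 low1.
have [j2 [m2 [st2 j2l sm2]]] := ccmd_ok lohi Dlo ex (cwf_prog lo N N) sm1 cc.
have [m3 [st3 m3lo m3hi]] := finish_ok V6 Vlo (isT : 3 < 16)%N lohi sm2 cf.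
have szP : (boot_sz lo + cmdsz (prog lo N N) + finish_sz lo)%N = size P.
  by rewrite /P size_cat size_boot size_cat size_ccmd size_finish addnA.
have out : kmf_output n m3 = A.
  apply/setP => i; rewrite inE; have hi' : (n <= hi)%N.
    by apply: leq_trans hi4; case: (n) => // b; nia.
  have -> : m3 i = (nat_of_bool (i \in A))%:Z.
    have [il|il] := ltnP i lo; first by rewrite m3lo.
    rewrite m3hi ?lowA //; have := ltn_ord i; lia.
  by case: (i \in A).
exists (size P, m3); split; last first.
  rewrite /= out; split=> // O cO.
  exact: (@local_opt_ratio _ _ n N k).
have st : steps P (j1 + (j2 + finish_sz lo)) (0%N, inp) = Some (size P, m3).
  by apply: steps_trans st1 _; apply: steps_trans st2 _; rewrite st3 szP.
apply: steps_run st (halt_ok _ _) _.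
have nns := nn_size d k rho; have ns := n_size d k rho; rewrite -/sz in nns ns.
have sz0 : (0 < sz)%N by lia.
have tg : (t <= c0 * sz ^ c0)%N.
  apply: leq_trans (gc _ sz0); apply: leq_trans tT (hg _ _ _ _) => //; lia.
apply: leq_trans (_ : c * sz ^ c <= _)%N; last first.
  by rewrite leq_mul //; case: (c) => // e; rewrite leq_exp2r.
apply: leq_trans (hc _ sz0).
have := leq_mul (leqnn (kappa 20)) tg; lia.
Qed.
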